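(* Let $T>0$ and let $a\in C^2(\mathbb R)$ be strictly convex. Let $u\in L^\infty([0,T]\times\mathbb R)$ be a weak solution of $u_t+[a(u)]_x=0$ in $\mathcal D'((0,T)\times\mathbb R)$ which has finite entropy production, i.e. $\mu_\eta$ is a locally finite Radon measure on $[0,T]\times\mathbb R$ for every $C^2$ entropy $\eta$. Let $I=[\inf u,\sup u]$. Then there is an absolute constant $C_0>0$ such that for every $C^2$ entropy $\eta$ (with any entropy flux $q$) and every open set $U\subset[0,T]\times\mathbb R$, $$|\mu_\eta|(U)\le C_0\cdot\sup_I|\eta''|\cdot\limsup_{\epsilon\to0}\sup_{|h|<\epsilon}\frac1{|h|}\iint_U\Delta\big(u(t,x),u(t,x+h)\big)\,dx\,dt.$$
   Context: An entropy is a function $\eta\colon\mathbb R\to\mathbb R$ (here $C^2$); an associated entropy flux is any $q\colon\mathbb R\to\mathbb R$ with $q'=\eta'a'$. The entropy production of $u$ is the distribution $\mu_\eta=[\eta(u)]_t+[q(u)]_x$ on $(0,T)\times\mathbb R$. A weak solution is a bounded measurable $u$ satisfying the equation in the sense of distributions. $\inf u,\sup u$ denote essential infimum and supremum. The regularity cost is $$\Delta(u_1,u_2)=\frac12\int_{u_1}^{u_2}\int_{u_1}^{u_2}|a'(v)-a'(w)|\,dv\,dw=\int_{[u_1,u_2]}(u_2-s)(s-u_1)\,a''(ds),$$ where $[u_1,u_2]$ denotes the closed segment between $u_1$ and $u_2$ regardless of order, and $a''$ is the (nonnegative) distributional second derivative of $a$, viewed as a measure. *)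

(* Defs.v *)
From HB Require Import structures.
From mathcomp Require Import all_boot all_order all_algebra.
From mathcomp Require Import all_classical all_reals all_analysis.
From mathcomp Require Import ess_sup_inf.
Set Implicit Arguments. Unset Strict Implicit. Unset Printing Implicit Defensive.
Import Order.TTheory GRing.Theory Num.Def Num.Theory.
Import numFieldNormedType.Exports.
Local Open Scope classical_set_scope.
Local Open Scope ring_scope.

Section Defs.
Variable R : realType.

(* two-dimensional Lebesgue (Borel product) measure on R x R, points p = (t, x) *)
Definition lam2 := (@lebesgue_measure R \x @lebesgue_measure R)%E.

Definition C2 (f : R -> R) : Prop :=
  (forall x, derivable f x 1) /\ (forall x, derivable (derive1 f) x 1) /\
  continuous (derive1n 2 f).

Definition strictly_convex (f : R -> R) : Prop :=
  forall x y l, x != y -> 0 < l < 1 ->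
    f (l * x + (1 - l) * y) < l * f x + (1 - l) * f y.

Definition is_flux (a eta q : R -> R) : Prop :=
  (forall x, derivable q x 1) /\
  (forall x, derive1 q x = derive1 eta x * derive1 a x).

Definition pt (f : R * R -> R) : R * R -> R :=
  fun p => derive1 (fun s => f (s, p.2)) p.1.
Definition px (f : R * R -> R) : R * R -> R :=
  fun p => derive1 (fun y => f (p.1, y)) p.2.

Definition pder (ds : seq bool) (f : R * R -> R) : R * R -> R :=
  foldr (fun b g => if b then pt g else px g) f ds.

Definition smooth2 (f : R * R -> R) : Prop :=
  forall ds : seq bool,
    continuous (pder ds f) /\
    (forall p, derivable (fun s => pder ds f (s, p.2)) p.1 1 /\
               derivable (fun y => pder ds f (p.1, y)) p.2 1).

Definition test_on (V : set (R * R)) (phi : R * R -> R) : Prop :=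
  smooth2 phi /\
  exists K : set (R * R), compact K /\ K `<=` V /\ (forall p, ~ K p -> phi p = 0).

Definition strip (T : R) : set (R * R) := [set p | 0 < p.1 < T].
Definition cstrip (T : R) : set (R * R) := [set p | 0 <= p.1 <= T].

Definition rel_open (T : R) (U : set (R * R)) : Prop :=
  exists V : set (R * R), open V /\ U = V `&` cstrip T.

Definition Linf (T : R) (u : R * R -> R) : Prop :=
  measurable_fun (strip T) u /\
  (ess_sup lam2 (fun p => if `[< strip T p >] then (`|u p|)%:E else 0%E)
     < +oo)%E.

Definition weak_solution (T : R) (a : R -> R) (u : R * R -> R) : Prop :=
  forall phi, test_on (strip T) phi ->
    Rintegral lam2 (strip T) (fun p => u p * pt phi p + a (u p) * px phi p) = 0.

(* entropy production mu_eta = eta(u)_t + q(u)_x, as a distribution *)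
Definition entropy_prod (T : R) (u : R * R -> R) (eta q : R -> R)
  (phi : R * R -> R) : R :=
  - Rintegral lam2 (strip T) (fun p => eta (u p) * pt phi p + q (u p) * px phi p).

Definition entropy_TV (T : R) (u : R * R -> R) (eta q : R -> R)
  (U : set (R * R)) : \bar R :=
  ereal_sup [set (entropy_prod T u eta q phi)%:E | phi in
              [set phi | test_on (U `&` strip T) phi /\ forall p, `|phi p| <= 1]].

(* finite entropy production: for every C^2 entropy eta and flux q, mu_eta is a
   locally finite Radon measure on [0,T] x R, i.e. has finite total variation on
   every bounded region [0,T] x (-r, r) *)
Definition finite_entropy_production (T : R) (a : R -> R) (u : R * R -> R) : Prop :=
  forall eta q, C2 eta -> is_flux a eta q ->
    forall r : R, 0 < r ->
      (entropy_TV T u eta q [set p | (0 <= p.1 <= T) /\ (- r < p.2 < r)]%R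
         < +oo)%E.

Definition einf (T : R) (u : R * R -> R) : \bar R :=
  ess_inf lam2 (fun p => if `[< strip T p >] then (u p)%:E else +oo%E).
Definition esup (T : R) (u : R * R -> R) : \bar R :=
  ess_sup lam2 (fun p => if `[< strip T p >] then (u p)%:E else -oo%E).

Definition Delta (a : R -> R) (u1 u2 : R) : R :=
  2^-1 * Rintegral lebesgue_measure `[minr u1 u2, maxr u1 u2]%classic
    (fun v => Rintegral lebesgue_measure `[minr u1 u2, maxr u1 u2]%classic
       (fun w => `|derive1 a v - derive1 a w|)).

Definition reg_cost (a : R -> R) (u : R * R -> R) (U : set (R * R)) : \bar R :=
  ereal_inf [set ereal_sup
      [set (((`|h|)^-1)%:E *
           (\int[lam2]_(p in U) (Delta a (u p) (u (p.1, p.2 + h)))%:E))%E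
        | h in [set h : R | 0 < `|h| < e]]
    | e in [set e : R | 0 < e]].

Definition sup_I_eta2 (T : R) (u : R * R -> R) (eta : R -> R) : \bar R :=
  ereal_sup [set (`|derive1n 2 eta v|)%:E
              | v in [set v : R | (einf T u <= v%:E <= esup T u)%E]].

End Defs.

(* Main.v *)
Require Import Defs.
From HB Require Import structures.
From mathcomp Require Import all_boot all_order all_algebra.
From mathcomp Require Import all_classical all_reals all_analysis.
From mathcomp Require Import ess_sup_inf.
From mathcomp Require Import measurable_realfun ring lra.
Set Implicit Arguments. Unset Strict Implicit. Unset Printing Implicit Defensive.
Import Order.TTheory GRing.Theory Num.Def Num.Theory.
Import numFieldNormedType.Exports.
Local Open Scope classical_set_scope.
Local Open Scope ring_scope.

(* Redefine u on a null set so that it takes values in [inf u, sup u], and mollify it in x only,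
   at scale e: v = u * k_e and b = a(u) * k_e satisfy v_t + b_x = 0, where v is merely bounded in t,
   so the chain rule in t is obtained by a further mollification in t.  Hence, tested against phi,
     eta(v)_t + q(v)_x = - (eta'(v) (b - a(v)))_x + eta''(v) v_x (b - a(v)),
   and since b - a(v) tends to 0 the entropy production is bounded by the limit of
   sup |eta''| * iint_{supp phi} |v_x| |b - a(v)|.
   On an interval J of length 2e around x, with mean value m of u, |v_x| is at most
   (C / e^2) int_J |u - m|, and, by Jensen, 0 <= b - a(v) <= (C / e) int_J (a(u) - a(m) - a'(m)(u - m)).
   The product of these two integrals is at most 2 iint_{J x J} Delta(u(y), u(z)) dy dz, because
   Delta(v, w) >= |v - m| (a(w) - a(m) - a'(m)(w - m)) whenever m lies between v and w, and the
   positive and negative parts of u - m have the same integral over J.  Integrating in (t, x) and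
   taking h = z - y as a variable gives at most 16 C^2 times the regularity cost at |h| <= 2e. *)

(** Smoothing in x alone is what keeps the estimate to increments in x: the gap b - a(v) then
    compares values of u at one time t, and the second smoothing, in t, has its own scale, sent to 0
    at fixed e. The difficulty is that v_x may grow like 1 / e while the gap merely tends to 0, so
    only their product is controlled. Both factors must therefore be measured from the same value m;
    this is possible because k_e' has integral zero and because the gap is bounded by the averaged
    Bregman divergence of [a] based at any m. The constant C comes from |k_e| <= C / e and |k_e'| <=
    C / e^2; it depends on the bump only and so can be fixed before T, a and u. Two borderline
    situations shape the end. The set U may meet the times 0 and T, where u is not known to be
    measurable, so costs are compared by monotonicity of the integral of nonnegative functions
    without measurability. And sup |eta''| times the cost may read 0 * +oo, which is 0: the entropy
    production must then be bounded without the cost, using that v keeps its values in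
    [inf u, sup u]. *)

(** * Translation invariance of integrals on the line *)

Section translation.
Context {R : realType}.
Notation mu := (@lebesgue_measure R).

Definition shiftR (h : R) : measurableTypeR R -> measurableTypeR R := fun x : R => (x + h)%R.

Lemma measurable_shiftR h : measurable_fun setT (shiftR h).
Proof. exact: measurable_funD. Qed.

Lemma lebesgue_measure_shift (h : R) (A : set R) : measurable A ->
  pushforward mu (shiftR h) A = mu A.
Proof.
move=> mA; apply/esym.
apply: lebesgue_measure_unique => //; first exact: measurable_shiftR.
move=> ? _ [[a b]] _ <-/=.
rewrite /pushforward.
rewrite [RHS](_ : _ = mu `](a - h), (b - h)]%classic); last first.
  by congr (mu _); apply/seteqP; split => x /=; rewrite !in_itv/= ltrBlDr lerBrDr.
rewrite !lebesgue_measure_itv/= !lte_fin ltrD2r; case: ifPn => // _.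
by rewrite -!EFinB; congr EFin; lra.
Qed.

Lemma ge0_integral_shift (h : R) (f : R -> \bar R) : measurable_fun setT f ->
  (forall x, 0 <= f x)%E -> (\int[mu]_x f (x + h)%R = \int[mu]_x f x)%E.
Proof.
move=> mf f0.
have := ge0_integral_pushforward (measurable_shiftR h) mu measurableT mf (in1W f0).
rewrite preimage_setT => /esym ->; apply: eq_measure_integral.
  exact: measurable_shiftR.
by move=> ? A mA _; exact: lebesgue_measure_shift.
Qed.

(** No integrability enters: positive and negative parts are shifted separately, and [fine] is
    applied to equal extended reals. *)
Lemma Rintegral_shift (h : R) (f : R -> R) : measurable_fun setT f ->
  \int[mu]_x f (x + h) = \int[mu]_x f x.
Proof.
move=> mf; rewrite /Rintegral; congr fine.
rewrite integralE [RHS]integralE; congr (_ - _)%E.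
- rewrite -(@ge0_integral_shift h (EFin \o f)^\+%E)//.
    by apply: eq_integral => x _; rewrite !funeposE.
  by apply: measurable_funepos; exact/measurable_EFinP.
- rewrite -(@ge0_integral_shift h (EFin \o f)^\-%E)//.
    by apply: eq_integral => x _; rewrite !funenegE.
  by apply: measurable_funeneg; exact/measurable_EFinP.
Qed.

End translation.

(** * Open sets and continuous functions on the plane are measurable *)

Section plane.
Context {R : realType}.
Notation mu := (@lebesgue_measure R).

(** Second countability: an open set is the union of the squares with rational centre and radius
    that it contains, and [unpickle] turns this into a union over the naturals. *)
Lemma open_measurable_plane (A : set (R * R)) : open A -> measurable A.
Proof.
move=> oA.
pose F (i : rat * (rat * rat)) : set (R * R) :=
  (ball (ratr i.2.1 : R) (ratr i.1 : R)) `*` (ball (ratr i.2.2 : R) (ratr i.1 : R)).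
pose G i := if `[< F i `<=` A >] then F i else set0.
have -> : A = \bigcup_(n in [set: nat]) oapp G set0 (unpickle n).
  apply/seteqP; split => [p Ap|p [n _]]; last first.
    case: (unpickle n) => [i|]//=; rewrite /G; case: ifPn => // /asboolP; exact.
  have : nbhs p A by apply: open_nbhs_nbhs; split.
  move=> /nbhs_ballP[e /= e0 eA].
  have e20 : 0 < e / 2 by rewrite divr_gt0.
  (* The radius is below [e / 2] and each centre coordinate lies within the radius of that of [p],
     so the square contains [p] and stays within [e] of it. *)
  have [r] := rat_in_itvoo e20.
  rewrite in_itv/= => /andP[r0 re].
  have [q1] := @rat_in_itvoo R (p.1 - ratr r) p.1 ltac:(rewrite ltrBlDr ltrDl//).
  rewrite in_itv/= => /andP[a1 a2].
  have [q2] := @rat_in_itvoo R (p.2 - ratr r) p.2 ltac:(rewrite ltrBlDr ltrDl//).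
  rewrite in_itv/= => /andP[b1 b2].
  have bb (x y q : R) : x - ratr r < q -> q < x -> ball q (ratr r : R) y -> ball x e y.
    rewrite /ball/= => ? ?; rewrite !ltr_distl => /andP[? ?]; apply/andP; split; lra.
  have FA : F (r, (q1, q2)) `<=` A.
    move=> [y1 y2] [/= h1 h2]; apply: eA; split; [exact: (bb _ _ (ratr q1))|exact: (bb _ _ (ratr q2))].
  have [n nE] : exists n, unpickle n = Some (r, (q1, q2)).
    by eexists; exact: pickleK.
  exists n; first by [].
  rewrite nE /= /G asboolT//.
  split; rewrite /F /ball/= ltr_distl; apply/andP; split; lra.
apply: bigcupT_measurable => n; case: (unpickle n) => [i|]//=.
rewrite /G; case: ifPn => // _; apply: measurableX; exact: measurable_ball.
Qed.

Lemma continuous_measurable_plane (f : R * R -> R) :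
  continuous f -> measurable_fun setT f.
Proof.
move=> cf _; apply: (measurability _ (RGenOpens.measurableE R)) => //.
move=> _ [_ [a [b ->] <-]]; apply: measurableI => //; apply: open_measurable_plane.
apply: open_comp => //; exact: interval_open.
Qed.

End plane.

(** * Integrals of bounded functions with bounded support *)

Section integrals.
Context {R : realType}.
Notation mu := (@lebesgue_measure R).
Notation lam := (@lam2 R).

(** Integrability is mostly derived from three facts that are easy to propagate: measurability
    everywhere, a global bound ([bnd]), and vanishing beyond radius [r] ([nz], [nz2]). *)
Definition bnd {T : Type} (f : T -> R) := exists M, forall x, `|f x| <= M.
Definition nz (r : R) (f : R -> R) := forall x, r < `|x| -> f x = 0.
Definition nz2 (r : R) (f : R * R -> R) :=
  forall p, (r < `|p.1|) || (r < `|p.2|) -> f p = 0.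

Lemma aeS (P Q : R -> Prop) : (forall x, P x -> Q x) ->
  {ae mu, forall x, P x} -> {ae mu, forall x, Q x}.
Proof.
move=> PQ [N [mN N0 PN]]; exists N; split => // x nQ; apply: PN => Px.
exact/nQ/PQ.
Qed.

Lemma aeI (P Q : R -> Prop) : {ae mu, forall x, P x} -> {ae mu, forall x, Q x} ->
  {ae mu, forall x, P x /\ Q x}.
Proof.
move=> [N [mN N0 PN]] [M [mM M0 QM]]; exists (N `|` M); split.
- exact: measurableU.
- by rewrite null_set_setU.
- move=> x /not_andP[nP|nQ]; [left; exact: PN|right; exact: QM].
Qed.

Lemma bndP {T : Type} (f : T -> R) : bnd f -> exists2 M, 0 < M & forall x, `|f x| <= M.
Proof.
move=> [M fM]; exists (`|M| + 1); first by rewrite ltr_wpDl.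
by move=> x; rewrite (le_trans (fM x))// (le_trans (ler_norm _))// lerDl.
Qed.

Lemma bndM {T : Type} (f g : T -> R) : bnd f -> bnd g -> bnd (fun x => f x * g x).
Proof.
move=> [M fM] [N gN]; exists (M * N) => x; rewrite normrM.
by apply: ler_pM.
Qed.

Lemma bndD {T : Type} (f g : T -> R) : bnd f -> bnd g -> bnd (fun x => f x + g x).
Proof.
move=> [M fM] [N gN]; exists (M + N) => x.
by rewrite (le_trans (ler_normD _ _))// lerD.
Qed.

Lemma bndB {T : Type} (f g : T -> R) : bnd f -> bnd g -> bnd (fun x => f x - g x).
Proof.
move=> [M fM] [N gN]; exists (M + N) => x.
by rewrite (le_trans (ler_normB _ _))// lerD.
Qed.

Lemma bnd_norm {T : Type} (f : T -> R) : bnd f -> bnd (fun x => `|f x|).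
Proof. by move=> [M fM]; exists M => x; rewrite normr_id. Qed.

Lemma bnd_cst {T : Type} c : bnd (fun _ : T => c).
Proof. by exists `|c|. Qed.

Lemma integrable_bnd d (T : measurableType d) (m : {measure set T -> \bar R})
    (D : set T) (f : T -> R) :
  measurable D -> (m D < +oo)%E -> measurable_fun setT f -> bnd f ->
  (forall x, ~ D x -> f x = 0) -> m.-integrable setT (EFin \o f).
Proof.
move=> mD Doo mf [M fM] f0.
have fE : EFin \o f = ((EFin \o f) \_ D).
  apply/funext => x; rewrite patchE; case: ifPn => //.
  by rewrite notin_setE => /f0 /= ->.
rewrite fE; apply/(integrable_mkcond _ mD).1.
apply: measurable_bounded_integrable => //; first exact: measurable_funTS.
exists M; split; first by rewrite num_real.
by move=> y My x _ /=; rewrite (le_trans (fM x))// ltW.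
Qed.

Lemma lebesgue_seg (a b : R) : a <= b -> mu `[a, b]%classic = (b - a)%:E.
Proof.
move=> ab; rewrite lebesgue_measure_itv/= lte_fin.
by have [//|ba] := ltP a b; rewrite (le_anti (introT andP (conj ab ba))) subrr.
Qed.

Lemma lebesgue_seg_lty (a b : R) : (mu `[a, b]%classic < +oo)%E.
Proof.
by rewrite lebesgue_measure_itv/=; case: ifPn => // _; rewrite -EFinB ltry.
Qed.

Lemma integrable_nz (r : R) (f : R -> R) : measurable_fun setT f -> bnd f -> nz r f ->
  mu.-integrable setT (EFin \o f).
Proof.
move=> mf bf rf; apply: (@integrable_bnd _ _ mu (`[(- r), r]%classic : set R)) => //.
- exact: lebesgue_seg_lty.
- move=> x /=; rewrite in_itv/= -ler_norml => /negP; rewrite -ltNge; exact: rf.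
Qed.

Lemma integrable_itv (a b : R) (f : R -> R) : measurable_fun setT f -> bnd f ->
  mu.-integrable `[a, b]%classic (EFin \o f).
Proof.
move=> mf [M fM]; apply: measurable_bounded_integrable => //.
- exact: lebesgue_seg_lty.
- exact: measurable_funTS.
- exists M; split; first by rewrite num_real.
  by move=> y My x _ /=; rewrite (le_trans (fM x))// ltW.
Qed.

Lemma integrable_nz2 (r : R) (f : R * R -> R) : measurable_fun setT f -> bnd f -> nz2 r f ->
  lam.-integrable setT (EFin \o f).
Proof.
move=> mf bf rf.
apply: (@integrable_bnd _ _ (mu \x mu)%E ((`[(- r), r]%classic : set R) `*` (`[(- r), r]%classic : set R))) => //.
- exact: measurableX.
- suff : (mu `[(- r)%R, r]%classic * mu `[(- r)%R, r]%classic < +oo)%E.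
    apply: le_lt_trans; rewrite le_eqVlt; apply/orP; left; apply/eqP.
    exact: product_measure1E.
  apply: lte_mul_pinfty => //.
  + by rewrite ge0_fin_numE// lebesgue_seg_lty.
  + exact: lebesgue_seg_lty.
- move=> [x y] /= /not_andP; rewrite !in_itv/= -!ler_norml => H; apply: rf => /=.
  by case: H => /negP; rewrite -ltNge => ->//; rewrite orbT.
Qed.

Lemma Rint_bound (a b M : R) (f : R -> R) : a <= b -> 0 <= M ->
  measurable_fun setT f -> (forall x, `|f x| <= M) ->
  `|\int[mu]_(x in `[a, b]) f x| <= M * (b - a).
Proof.
move=> ab M0 mf fM.
have itf : mu.-integrable `[a, b]%classic (EFin \o f) by apply: integrable_itv => //; exists M.
apply: (le_trans (le_normr_Rintegral _ itf)) => //.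
rewrite (_ : M * (b - a) = \int[mu]_(x in `[a, b]) M); last first.
  by rewrite Rintegral_cst//= lebesgue_seg.
apply: le_Rintegral => //.
- by apply: integrable_itv; [exact: measurableT_comp|exists M => x; rewrite normr_id].
- by apply: integrable_itv; [exact: measurable_cst|exists `|M|].
Qed.

Lemma Rint_nz (r : R) (f : R -> R) : nz r f -> \int[mu]_x f x = \int[mu]_(x in `[(- r), r]) f x.
Proof.
move=> rf; rewrite [RHS]Rintegral_mkcond; congr Rintegral; apply/funext => x.
rewrite patchE; case: ifPn => //.
by rewrite notin_setE/= in_itv/= -ler_norml => /negP; rewrite -ltNge => /rf.
Qed.

Lemma measurable_Rint1 d (X : measurableType d) (f : X * R -> R) : measurable_fun setT f ->
  measurable_fun setT (fun t => \int[mu]_x f (t, x)).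
Proof.
move=> mf; apply: measurableT_comp => //.
rewrite (_ : (fun t => _) = fun t => ((\int[mu]_x (EFin \o f)^\+ (t, x)) -
   (\int[mu]_x (EFin \o f)^\- (t, x)))%E); last first.
  apply/funext => t; rewrite integralE; congr (_ - _)%E; apply: eq_integral => x _.
    by rewrite !funeposE.
  by rewrite !funenegE.
have mEf : measurable_fun setT (EFin \o f) by exact/measurable_EFinP.
apply: emeasurable_funB.
- by apply: measurable_fun_fubini_tonelli_F => //; exact: measurable_funepos.
- by apply: measurable_fun_fubini_tonelli_F => //; exact: measurable_funeneg.
Qed.

Lemma measurable_slice1 (f : R * R -> R) t : measurable_fun setT f ->
  measurable_fun setT (fun x => f (t, x)).
Proof. by move=> mf; exact: measurableT_comp. Qed.

Lemma measurable_slice2 (f : R * R -> R) x : measurable_fun setT f ->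
  measurable_fun setT (fun t => f (t, x)).
Proof. by move=> mf; exact: measurableT_comp. Qed.

Lemma Rfubini1 (r : R) (f : R * R -> R) : measurable_fun setT f -> bnd f -> nz2 r f ->
  \int[lam]_p f p = \int[mu]_t \int[mu]_x f (t, x).
Proof.
move=> mf bf rf; have itf := integrable_nz2 mf bf rf.
rewrite /Rintegral; congr fine.
rewrite -(integral12_prod_meas1 itf); apply: eq_integral => t _.
rewrite /fubini_F fineK//; apply: integrable_fin_num => //.
apply: (@integrable_nz r); first exact: measurable_slice1.
- by case: bf => M fM; exists M.
- by move=> x rx; apply: rf; rewrite /= rx orbT.
Qed.

Lemma Rfubini2 (r : R) (f : R * R -> R) : measurable_fun setT f -> bnd f -> nz2 r f ->
  \int[lam]_p f p = \int[mu]_x \int[mu]_t f (t, x).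
Proof.
move=> mf bf rf; have itf := integrable_nz2 mf bf rf.
rewrite /Rintegral; congr fine.
rewrite -(integral21_prod_meas1 itf); apply: eq_integral => t _.
rewrite /fubini_G fineK//; apply: integrable_fin_num => //.
apply: (@integrable_nz r); first exact: measurable_slice2.
- by case: bf => M fM; exists M.
- by move=> x rx; apply: rf; rewrite /= rx.
Qed.

Lemma Rdct (r M : R) (fn : nat -> R -> R) (f : R -> R) :
  (forall n, measurable_fun setT (fn n)) -> measurable_fun setT f ->
  (forall n x, `|fn n x| <= M) -> (forall n, nz r (fn n)) ->
  {ae mu, forall x, fn n x @[n --> \oo] --> f x} ->
  \int[mu]_x fn n x @[n --> \oo] --> \int[mu]_x f x.
Proof.
move=> mfn mf fnM rfn cv.
pose g : R -> R := fun x => M * \1_(`[(- r), r]%classic) x.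
have mg : measurable_fun setT g by apply: measurable_funM => //; exact: measurable_indic.
have ig : mu.-integrable setT (EFin \o g).
  apply: (@integrable_nz r) => //.
  - by exists `|M| => x; rewrite /g normrM ler_piMr// indicE; case: (_ \in _); rewrite ?normr1 ?normr0.
  - move=> x rx; rewrite /g indicE memNset ?mulr0//= in_itv/= -ler_norml.
    by apply/negP; rewrite -ltNge.
have [//|//|||itf _ h] := @dominated_convergence _ _ _ mu setT measurableT (fun n => EFin \o fn n)
  (EFin \o f) (EFin \o g) _ _ _ ig _.
- by move=> n; apply/measurable_EFinP; exact: mfn.
- by apply/measurable_EFinP; exact: mf.
- apply: aeS cv => x fx _; apply: cvg_EFin fx; exact: nearW.
- apply: aeW => x n _ /=; rewrite lee_fin /g indicE.
  case: (boolP (x \in _)) => [_|]; first by rewrite mulr1.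
  rewrite notin_setE/= in_itv/= -ler_norml => /negP; rewrite -ltNge => /rfn ->.
  by rewrite normr0 mulr0.
apply: fine_cvg; rewrite fineK//; exact: integrable_fin_num.
Qed.

(** Mollification in x converges for every [t] at almost every [x], so the hypothesis has that form;
    dominated convergence is applied on each slice, then once more in [t]. *)
Lemma Rdct2 (r M : R) (fn : nat -> R * R -> R) (f : R * R -> R) :
  (forall n, measurable_fun setT (fn n)) -> measurable_fun setT f ->
  (forall n x, `|fn n x| <= M) -> (forall n, nz2 r (fn n)) ->
  bnd f -> nz2 r f ->
  (forall t, {ae mu, forall x, fn n (t, x) @[n --> \oo] --> f (t, x)}) ->
  \int[lam]_p fn n p @[n --> \oo] --> \int[lam]_p f p.
Proof.
move=> mfn mf fnM rfn bf rf cv.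
rewrite (Rfubini1 mf bf rf).
rewrite (_ : (fun n => _) = fun n => \int[mu]_t \int[mu]_x fn n (t, x)); last first.
  by apply/funext => n; rewrite (Rfubini1 (r := r))//; exists M.
have M0 : 0 <= M := le_trans (normr_ge0 _) (fnM 0%N (0, 0)).
have nzx n t : nz r (fun x => fn n (t, x)) by move=> x rx; apply: rfn; rewrite /= rx orbT.
(* The majorant of the slice integrals is [M] times the length of [[-|r|, |r|]]; the absolute value
   appears because the sign of [r] is not assumed. *)
apply: (@Rdct r (M * (`|r| - - `|r|))).
- by move=> n; exact: measurable_Rint1.
- exact: measurable_Rint1.
- move=> n t.
  have nzx' : nz `|r| (fun x => fn n (t, x)).
    by move=> x rx; apply: nzx; rewrite (le_lt_trans _ rx)// ler_norm.
  rewrite (Rint_nz nzx') Rint_bound//; first by rewrite lerNl (le_trans _ (normr_ge0 _))// oppr_le0.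
  exact: measurable_slice1.
- move=> n t rt; rewrite /Rintegral (_ : (fun x => _) = cst 0%E) ?integral0//.
  by apply/funext => x; rewrite rfn//= rt.
- apply: aeW => t; apply: (@Rdct r M) => //.
  + by move=> n; exact: measurable_slice1.
  + exact: measurable_slice1.
Qed.

End integrals.

(** * The smooth bump, the mollifiers, and test functions of product form *)

Section bump.
Context {R : realType}.
Notation mu := (@lebesgue_measure R).
Implicit Types (P : {poly R}) (k : nat) (x : R).

(* The family [bump P k] is closed under differentiation ([is_derive_bump]), which is how all
   partial derivatives of the test functions built from it are controlled at once. *)
Definition bump P k x : R :=
  if `|x| < 1 then P.[x] * ((1 - x ^+ 2)^-1) ^+ k * expR (- (1 - x ^+ 2)^-1) else 0.

(** With y = 1 / (1 - x^2) one has y' = 2 x y^2. Differentiating P y^k exp(-y) and factoring out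
    y^(k+2) exp(-y) leaves this polynomial. *)
Definition dbump P k : {poly R} :=
  P^`() * (1 - 'X ^+ 2) ^+ 2 + (k.*2)%:R *: ('X * P * (1 - 'X ^+ 2)) - 2 *: ('X * P).

Lemma poly_bounded P : exists2 C, 0 <= C & forall x, `|x| <= 1 -> `|P.[x]| <= C.
Proof.
elim/poly_ind: P => [|p c [C C0 pC]].
  by exists 0 => // x _; rewrite horner0 normr0.
exists (C + `|c|); first by rewrite addr_ge0.
move=> x x1; rewrite hornerMXaddC (le_trans (ler_normD _ _))// lerD2r normrM.
by rewrite -[leRHS]mulr1 ler_pM// pC.
Qed.

(** A single term of the exponential series, of degree [k + 2], bounds [expR z] from below; the two
    extra powers leave the factor [z ^ -2]. *)
Lemma expRN_decay k (z : R) : 0 < z -> z ^+ k * expR (- z) <= (k.+2)`!%:R / z ^+ 2.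
Proof.
move=> z0; rewrite expRN ler_pdivrMr ?expR_gt0// mulrAC ler_pdivlMr ?exprn_gt0//.
rewrite -exprD addnC -ler_pdivrMl ?ltr0n ?fact_gt0// mulrC.
by apply: le_trans (expR_ge1Dxn k.+1 (ltW z0)); rewrite lerDr.
Qed.

Lemma one_sub_sqr_gt0 x : `|x| < 1 -> 0 < 1 - x ^+ 2.
Proof. by move=> x1; rewrite subr_gt0 -real_normK ?num_real// expr_lt1. Qed.

(** A quadratic bound around every point where the bump is zero by definition. It gives derivative 0
    at [|y| = 1] and beyond in one stroke, and with [y = 1] it also yields global boundedness. *)
Lemma bump_quad P k : exists2 C, 0 <= C & forall x y, `|y| >= 1 ->
  `|bump P k x| <= C * (x - y) ^+ 2.
Proof.
have [C C0 PC] := poly_bounded P.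
exists (C * (k.+2)`!%:R * 4); first by rewrite !mulr_ge0.
move=> x y y1; rewrite /bump; case: ifPn => [x1|_]; last first.
  by rewrite normr0 mulr_ge0 ?sqr_ge0// !mulr_ge0.
have z0 := one_sub_sqr_gt0 x1.
rewrite -mulrA normrM -!mulrA ler_pM//; first exact/PC/ltW.
rewrite ger0_norm; last by rewrite mulr_ge0 ?expR_ge0// exprn_ge0// invr_ge0 ltW.
apply: (le_trans (expRN_decay _ _)); first by rewrite invr_gt0.
rewrite ler_pM2l ?ltr0n ?fact_gt0// exprVn invrK.
(* [1 - |x| <= |y| - |x| <= |x - y|], and the other factor [1 + |x|] is at most 2. *)
have h : 1 - x ^+ 2 <= 2 * `|x - y|.
  have h1 : 1 - `|x| <= `|x - y|.
    by have := lerB_dist y x; rewrite distrC; lra.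
  have -> : 1 - x ^+ 2 = (1 - `|x|) * (1 + `|x|) by rewrite -(real_normK (num_real x)); ring.
  have x0 := normr_ge0 x; nra.
have -> : 4 * (x - y) ^+ 2 = (2 * `|x - y|) ^+ 2 by rewrite exprMn real_normK ?num_real// -natrX.
by rewrite ler_sqr ?nnegrE ?mulr_ge0// ltW.
Qed.

Lemma is_derive_quad (f : R -> R) (y C : R) : f y = 0 ->
  (forall x, `|f x| <= C * (x - y) ^+ 2) -> is_derive y 1 f 0.
Proof.
move=> fy fC.
have C0 : 0 <= C.
  by have := le_trans (normr_ge0 _) (fC (y + 1)); rewrite addrAC subrr add0r expr1n mulr1.
have cv : h^-1 *: ((f \o shift y) (h *: 1) - f y) @[h --> 0^'] --> (0 : R).
  apply/cvgrPdist_le => e e0; near=> h.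
  rewrite fy subr0 sub0r normrN/= normrZ [h%:A]mulr1 /shift/=.
  have h0 : h != 0 by near: h; exact: nbhs_dnbhs_neq.
  rewrite normfV ler_pdivrMl ?normr_gt0// (le_trans (fC _))// addrK.
  rewrite -real_normK ?num_real// expr2 mulrA mulrC ler_pM2l ?normr_gt0//.
  have : `|h| <= e / (C + 1).
    near: h; apply: dnbhs0_le; rewrite divr_gt0// ltr_wpDl//.
  rewrite ler_pdivlMr ?ltr_wpDl// => /(le_trans _); apply.
  by rewrite mulrC ler_wpM2l// lerDl.
apply: DeriveDef; first by apply/cvg_ex; exists 0.
exact: cvg_lim.
Unshelve. all: by end_near. Qed.

(** For [|x| >= 1] the quadratic bound gives derivative 0. For [|x| < 1] the bump coincides near [x]
    with the smooth expression [g], to which the calculus rules apply. *)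
Lemma is_derive_bump P k x : is_derive x 1 (bump P k) (bump (dbump P k) k.+2 x).
Proof.
have [x1|x1] := ltP `|x| 1; last first.
  have [C C0 bC] := bump_quad P k.
  have b0 Q l : bump Q l x = 0 by rewrite /bump ltNge x1.
  rewrite b0; apply: (@is_derive_quad _ _ C) => //.
  by move=> z; exact: bC.
pose g x := P.[x] * ((1 - x ^+ 2)^-1) ^+ k * expR (- (1 - x ^+ 2)^-1).
have z0 := one_sub_sqr_gt0 x1; have zn0 := lt0r_neq0 z0.
have dz : is_derive x 1 (fun x => 1 - x ^+ 2) (- (2 * x)).
  by apply: is_derive_eq; rewrite /GRing.scale/=; ring.
have dy : is_derive x 1 (fun x => (1 - x ^+ 2)^-1) (2 * x * ((1 - x ^+ 2)^-1) ^+ 2).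
  by apply: is_derive_eq; rewrite /GRing.scale/=; field.
have de : is_derive x 1 (fun x => expR (- (1 - x ^+ 2)^-1))
    (expR (- (1 - x ^+ 2)^-1) * - (2 * x * ((1 - x ^+ 2)^-1) ^+ 2)).
  exact: (@is_derive1_comp _ expR (fun x => - (1 - x ^+ 2)^-1)).
have dyk : is_derive x 1 (fun x => ((1 - x ^+ 2)^-1) ^+ k)
    (k%:R * ((1 - x ^+ 2)^-1) ^+ k.-1 * (2 * x * ((1 - x ^+ 2)^-1) ^+ 2)).
  by have := @is_deriveX _ _ (fun x => (1 - x ^+ 2)^-1) k x 1 _ dy; rewrite exprfctE.
have dPk := @is_deriveM _ _ (horner P) _ x 1 _ _ (is_derive_poly P x) dyk.
have dg : is_derive x 1 g (bump (dbump P k) k.+2 x).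
  apply: (@is_derive_eq _ _ _ _ _ _ _ _ (@is_deriveM _ _ _ _ x 1 _ _ dPk de)).
  have -> : (horner P * (fun x0 => (1 - x0 ^+ 2)^-1 ^+ k)) x = P.[x] * (1 - x ^+ 2)^-1 ^+ k by [].
  rewrite /GRing.scale /bump x1 -[k.+2]addn2 exprD.
  have -> : (dbump P k).[x] = P^`().[x] * (1 - x ^+ 2) ^+ 2 +
      (2 * k%:R) * (x * P.[x] * (1 - x ^+ 2)) - 2 * (x * P.[x]).
    by rewrite /dbump -mul2n natrM !hornerE; ring.
  case: k {g dyk dPk} => [|n] /=; first by rewrite expr0; field.
  by rewrite exprS; set w := (1 - x ^+ 2)^-1 ^+ n; field.
apply: near_eq_is_derive dg.
near=> y; rewrite /g /bump; case: ifPn => // /negP; elim.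
near: y; exact: (cvgr_lt (`|x|) (continuous_comp (@cvg_id _ _) (@norm_continuous _ R x)) _ x1).
Unshelve. all: by end_near. Qed.

Lemma bump_cont P k : continuous (bump P k).
Proof.
move=> x; apply/differentiable_continuous/derivable1_diffP.
by have [] := is_derive_bump P k x.
Qed.

Lemma bump_bnd P k : exists2 C, 0 < C & forall x, `|bump P k x| <= C.
Proof.
have [C C0 bC] := bump_quad P k.
exists (4 * C + 1); first by rewrite ltr_wpDl// mulr_ge0.
move=> x; have [x1|x1] := ltP `|x| 1; last by rewrite /bump ltNge x1 normr0 addr_ge0// mulr_ge0.
have h1 : 1 <= `|1 : R| by rewrite normr1.
apply: (le_trans (bC x 1 h1)); rewrite -[leLHS]addr0 lerD// mulrC ler_wpM2r//.
by move: x1; rewrite ltr_norml => /andP[? ?]; nra.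
Qed.

Lemma bump_out P k x : 1 <= `|x| -> bump P k x = 0.
Proof. by move=> x1; rewrite /bump ltNge x1. Qed.

(** The classical mollifier profile exp(-1 / (1 - x^2)) on (-1, 1), not yet normalised. *)
Definition rho : R -> R := bump 1 0.

Lemma rho_ge0 x : 0 <= rho x.
Proof. by rewrite /rho /bump !hornerE ?expr0 ?mulr1 ?mul1r; case: ifPn => // _; exact: expR_ge0. Qed.

Lemma rhoN x : rho (- x) = rho x.
Proof. by rewrite /rho /bump !hornerE normrN sqrrN. Qed.

Lemma rho_half x : `|x| <= 2^-1 -> expR (- 2) <= rho x.
Proof.
move=> x2; rewrite /rho /bump !hornerE ?expr0 ?mulr1 ?mul1r ifT; last by rewrite (le_lt_trans x2)// invf_lt1// ltr1n.
rewrite ler_expR lerN2 invf_ple ?posrE//; last first.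
  by apply: one_sub_sqr_gt0; rewrite (le_lt_trans x2)// invf_lt1// ltr1n.
by move: x2; rewrite ler_norml => /andP[? ?]; nra.
Qed.

(** The normalisation is taken as the integral at scale [d] itself, so no dilation formula is
    involved; the lower bound [kcst_ge], linear in [d], is enough. *)
Definition kcst (d : R) : R := \int[mu]_x rho (x / d).
Definition ker (d : R) (x : R) : R := rho (x / d) / kcst d.
Definition dker (d : R) (x : R) : R := bump (dbump 1 0) 2 (x / d) / (d * kcst d).

Lemma measurable_scale (g : R -> R) d : continuous g -> measurable_fun setT (fun x => g (x / d)).
Proof.
move=> cg; apply: (measurableT_comp (continuous_measurable_fun cg)).
by apply: mulrr_measurable.
Qed.

Lemma nz_scale P k d : 0 < d -> nz d (fun x => bump P k (x / d)).
Proof.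
move=> d0 x dx; apply: bump_out; rewrite normrM normfV (gtr0_norm d0).
by rewrite ler_pdivlMr// mul1r ltW.
Qed.

Lemma bnd_scale P k d : bnd (fun x => bump P k (x / d)).
Proof. by have [C _ bC] := bump_bnd P k; exists C. Qed.

Lemma kcst_ge (d : R) : 0 < d -> expR (- 2) * d <= kcst d.
Proof.
move=> d0; rewrite /kcst.
have -> : expR (- 2) * d = \int[mu]_(x in `[(- (d / 2)), (d / 2)]) expR (- 2).
  by rewrite Rintegral_cst//= lebesgue_seg/=; [congr (_ * _); field|lra].
rewrite Rintegral_mkcond; apply: le_Rintegral => //.
- rewrite -restrict_EFin; apply/(integrable_mkcond _ _).1 => //.
  by apply: integrable_itv => //; exact: bnd_cst.
- apply: (@integrable_nz _ d); [by apply: measurable_scale; exact: bump_cont|exact: bnd_scale|exact: nz_scale].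
- move=> x _; rewrite patchE; case: ifPn => [|_]; last exact: rho_ge0.
  rewrite inE/= in_itv/= -ler_norml => xd; apply: rho_half.
  by rewrite normrM normfV (gtr0_norm d0) ler_pdivrMr// mulrC.
Qed.

Lemma kcst_gt0 (d : R) : 0 < d -> 0 < kcst d.
Proof. by move=> d0; rewrite (lt_le_trans _ (kcst_ge d0))// mulr_gt0// expR_gt0. Qed.

Lemma ker_cont d : continuous (ker d).
Proof.
move=> x; apply: cvgMl; apply: (@continuous_comp _ _ _ (fun x => x / d)).
  exact: mulrr_continuous.
exact: bump_cont.
Qed.

Lemma dker_cont d : continuous (dker d).
Proof.
move=> x; apply: cvgMl; apply: (@continuous_comp _ _ _ (fun x => x / d)).
  exact: mulrr_continuous.
exact: bump_cont.
Qed.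

Lemma is_derive_bump_scale P k d c x :
  is_derive x 1 (fun x => bump P k (x / d) * c) (bump (dbump P k) k.+2 (x / d) / d * c).
Proof.
have h : is_derive x 1 (fun x => x / d) d^-1.
  by apply: is_derive_eq; rewrite /GRing.scale/=; ring.
have h2 : is_derive x 1 (fun x => bump P k (x / d)) (bump (dbump P k) k.+2 (x / d) / d).
  apply: (@is_derive1_comp _ (bump P k) (fun x => x / d)); exact: is_derive_bump.
by apply: is_derive_eq; rewrite /GRing.scale/=; ring.
Qed.

Lemma is_derive_ker d x : 0 < d -> is_derive x 1 (ker d) (dker d x).
Proof.
move=> d0; have := is_derive_bump_scale 1 0 d (kcst d)^-1 x.
rewrite /dker invfM mulrA; exact.
Qed.

Lemma ker_ge0 d x : 0 < d -> 0 <= ker d x.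
Proof. by move=> d0; rewrite divr_ge0 ?rho_ge0// ltW// kcst_gt0. Qed.

Lemma kerN d x : ker d (- x) = ker d x.
Proof. by rewrite /ker mulNr rhoN. Qed.

Lemma nz_ker d : 0 < d -> nz d (ker d).
Proof. by move=> d0 x dx; rewrite /ker /rho (@nz_scale 1 0 d)// mul0r. Qed.

Lemma nz_dker d : 0 < d -> nz d (dker d).
Proof. by move=> d0 x dx; rewrite /dker (@nz_scale _ _ d)// mul0r. Qed.

(** This [C] is the source of the absolute constant of the theorem. The numerators are bounded by
    constants of the bump and [kcst_ge] bounds the normalisation below, whence the division by
    [expR (- 2)]; adding [C1] and [C2] lets one constant serve both kernels. *)
Lemma ker_bound : exists2 C, 0 < C & forall d x, 0 < d ->
  `|ker d x| <= C / d /\ `|dker d x| <= C / d ^+ 2.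
Proof.
have [C1 C10 h1] := bump_bnd 1 0.
have [C2 C20 h2] := bump_bnd (dbump 1 0) 2.
exists ((C1 + C2) / expR (- 2)); first by rewrite divr_gt0 ?expR_gt0// addr_gt0.
move=> d x d0; have k0 := kcst_gt0 d0; have ke := kcst_ge d0.
have e0 : 0 < expR (- 2 : R) by exact: expR_gt0.
have kd : (kcst d)^-1 <= (expR (- 2) * d)^-1 by rewrite lef_pV2 ?posrE ?mulr_gt0.
split; rewrite normrM normfV.
- rewrite (gtr0_norm k0) -mulrA -invfM ler_pM ?invr_ge0 ?(ltW k0)//.
  by rewrite (le_trans (h1 _))// lerDl ltW.
- rewrite (gtr0_norm (mulr_gt0 d0 k0)) -mulrA -invfM ler_pM ?invr_ge0 ?mulr_ge0 ?(ltW d0) ?(ltW k0)//.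
    by rewrite (le_trans (h2 _))// lerDr ltW.
  by rewrite lef_pV2 ?posrE ?mulr_gt0 ?exprn_gt0// expr2 mulrA mulrC ler_pM2l.
Qed.

Lemma ker_int1 d x : 0 < d -> \int[mu]_y ker d (x - y) = 1.
Proof.
move=> d0; under eq_Rintegral do rewrite -kerN opprB.
rewrite (@Rintegral_shift _ (- x) (ker d)); last by apply: continuous_measurable_fun; exact: ker_cont.
rewrite /ker RintegralZr//; first by rewrite mulfV// lt0r_neq0// kcst_gt0.
apply: (@integrable_nz _ d); [by apply: measurable_scale; exact: bump_cont|exact: bnd_scale|exact: nz_scale].
Qed.

(** A product of rescaled, reflected bumps. The family is stable under [pt] and [px], which only
    change the polynomials, the exponents and [c]; smoothness of all orders follows by induction on
    the list of derivatives. *)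
Definition tens (d e t0 x0 : R) P k Q l (c : R) (p : R * R) : R :=
  bump P k ((t0 - p.1) / d) * bump Q l ((x0 - p.2) / e) * c.

Lemma tens_cont d e t0 x0 P k Q l c : continuous (tens d e t0 x0 P k Q l c).
Proof.
move=> p; apply: cvgMl; apply: cvgM.
- apply: (@continuous_comp _ _ _ (fun p : R * R => (t0 - p.1) / d)); last exact: bump_cont.
  by apply: cvgMl; apply: cvgB; [exact: cvg_cst|exact: cvg_fst].
- apply: (@continuous_comp _ _ _ (fun p : R * R => (x0 - p.2) / e)); last exact: bump_cont.
  by apply: cvgMl; apply: cvgB; [exact: cvg_cst|exact: cvg_snd].
Qed.

Lemma is_derive_bump_refl (d t0 : R) P k (t c : R) : is_derive t 1 (fun s => bump P k ((t0 - s) / d) * c)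
  (bump (dbump P k) k.+2 ((t0 - t) / d) * (- (c / d))).
Proof.
have h : is_derive t 1 (fun x => t0 - x) (-1).
  by apply: is_derive_eq; rewrite /GRing.scale/=; ring.
have h2 : is_derive t 1 (fun s => bump P k ((t0 - s) / d) * c)
    (bump (dbump P k) k.+2 ((t0 - t) / d) / d * c * -1).
  apply: (@is_derive1_comp _ (fun s => bump P k (s / d) * c) (fun x => t0 - x)).
  exact: is_derive_bump_scale.
by apply: is_derive_eq; ring.
Qed.

Lemma is_derive_tens1 (d e t0 x0 : R) P k Q l (c : R) (p : R * R) :
  is_derive p.1 1 (fun s => tens d e t0 x0 P k Q l c (s, p.2))
  (tens d e t0 x0 (dbump P k) k.+2 Q l (- (c / d)) p).
Proof.
have h := is_derive_bump_refl d t0 P k p.1 (bump Q l ((x0 - p.2) / e) * c).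
rewrite /tens/=.
rewrite (_ : (fun s => _) = fun s => bump P k ((t0 - s) / d) * (bump Q l ((x0 - p.2) / e) * c)); last first.
  by apply/funext => s; rewrite mulrA.
by apply: is_derive_eq; ring.
Qed.

Lemma is_derive_tens2 (d e t0 x0 : R) P k Q l (c : R) (p : R * R) :
  is_derive p.2 1 (fun s => tens d e t0 x0 P k Q l c (p.1, s))
  (tens d e t0 x0 P k (dbump Q l) l.+2 (- (c / e)) p).
Proof.
have h := is_derive_bump_refl e x0 Q l p.2 (bump P k ((t0 - p.1) / d) * c).
rewrite /tens/=.
rewrite (_ : (fun s => _) = fun s => bump Q l ((x0 - s) / e) * (bump P k ((t0 - p.1) / d) * c)); last first.
  by apply/funext => s; rewrite mulrCA mulrA.
by apply: is_derive_eq; ring.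
Qed.

Lemma pt_tens (d e t0 x0 : R) P k Q l (c : R) :
  pt (tens d e t0 x0 P k Q l c) = tens d e t0 x0 (dbump P k) k.+2 Q l (- (c / d)).
Proof.
apply/funext => p; rewrite /pt derive1E.
by have h := is_derive_tens1 d e t0 x0 P k Q l c p; rewrite derive_val.
Qed.

Lemma px_tens (d e t0 x0 : R) P k Q l (c : R) :
  px (tens d e t0 x0 P k Q l c) = tens d e t0 x0 P k (dbump Q l) l.+2 (- (c / e)).
Proof.
apply/funext => p; rewrite /px derive1E.
by have h := is_derive_tens2 d e t0 x0 P k Q l c p; rewrite derive_val.
Qed.

Lemma smooth2_tens (d e t0 x0 : R) P k Q l (c : R) : smooth2 (tens d e t0 x0 P k Q l c).
Proof.
move=> ds.
have [P' [k' [Q' [l' [c' ->]]]]] : exists P' k' Q' l' c',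
    pder ds (tens d e t0 x0 P k Q l c) = tens d e t0 x0 P' k' Q' l' c'.
  elim: ds => [|b ds [P' [k' [Q' [l' [c' IH]]]]]] /=.
    by exists P, k, Q, l, c.
  rewrite IH; case: b; rewrite ?pt_tens ?px_tens.
  - by exists (dbump P' k'), k'.+2, Q', l', (- (c' / d)).
  - by exists P', k', (dbump Q' l'), l'.+2, (- (c' / e)).
split; first exact: tens_cont.
move=> p; split; first by have [] := is_derive_tens1 d e t0 x0 P' k' Q' l' c' p.
by have [] := is_derive_tens2 d e t0 x0 P' k' Q' l' c' p.
Qed.

(** Reflected around [(t0, x0)], so that testing the equation against it produces convolutions
    evaluated at [(t0, x0)]. *)
Definition kertest (d e t0 x0 : R) (p : R * R) : R := ker d (t0 - p.1) * ker e (x0 - p.2).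

Lemma kertestE (d e t0 x0 : R) :
  kertest d e t0 x0 = tens d e t0 x0 1 0 1 0 ((kcst d)^-1 * (kcst e)^-1).
Proof.
apply/funext => p; rewrite /kertest /ker /tens /rho; ring.
Qed.

Lemma pt_kertest (d e t0 x0 : R) p : 0 < d ->
  pt (kertest d e t0 x0) p = - (dker d (t0 - p.1) * ker e (x0 - p.2)).
Proof.
move=> d0; rewrite kertestE pt_tens /tens /dker /ker /rho invfM; ring.
Qed.

Lemma px_kertest (d e t0 x0 : R) p : 0 < e ->
  px (kertest d e t0 x0) p = - (ker d (t0 - p.1) * dker e (x0 - p.2)).
Proof.
move=> e0; rewrite kertestE px_tens /tens /dker /ker /rho invfM; ring.
Qed.

Lemma test_on_kertest (T d e t0 x0 : R) : 0 < d -> 0 < e -> d < t0 -> t0 < T - d ->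
  test_on (strip T) (kertest d e t0 x0).
Proof.
move=> d0 e0 dt tT; split; first by rewrite kertestE; exact: smooth2_tens.
exists (`[(t0 - d), (t0 + d)]%classic `*` `[(x0 - e), (x0 + e)]%classic); split.
  by apply: compact_setX; exact: segment_compact.
split.
  by move=> [t x] [/=]; rewrite /strip/= !in_itv/= => /andP[? ?] _; apply/andP; split; lra.
move=> [t x] /= /not_andP; rewrite !in_itv/= /kertest/= => -[] /negP h.
- rewrite (nz_ker d0) ?mul0r//; move: h; apply: contraR.
  by rewrite -leNgt ler_norml => /andP[? ?]; apply/andP; split; lra.
- rewrite [X in _ * X](nz_ker e0) ?mulr0//; move: h; apply: contraR.
  by rewrite -leNgt ler_norml => /andP[? ?]; apply/andP; split; lra.
Qed.

End bump.

(** * Convolution on the line with a compactly supported kernel *)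

Section convolution.
Context {R : realType}.
Notation mu := (@lebesgue_measure R).

Definition convol (k f : R -> R) (x : R) : R := \int[mu]_y (k (x - y) * f y).

Lemma measurable_refl (k : R -> R) (x : R) : measurable_fun setT k ->
  measurable_fun setT (fun y : R => k (x - y)).
Proof.
move=> mk; apply: (measurableT_comp mk); exact: measurable_funB.
Qed.

Lemma measurable_conv_integrand (k f : R -> R) (x : R) : measurable_fun setT k ->
  measurable_fun setT f -> measurable_fun setT (fun y : R => k (x - y) * f y).
Proof. by move=> mk mf; apply: measurable_funM => //; exact: measurable_refl. Qed.

Lemma nz_conv_integrand (k f : R -> R) (r x : R) : nz r k ->
  nz (r + `|x|) (fun y => k (x - y) * f y).
Proof.
move=> rk y ry; rewrite rk ?mul0r// distrC; have := lerB_dist y x; lra.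
Qed.

Lemma bnd_conv_integrand (k f : R -> R) x : bnd k -> bnd f -> bnd (fun y => k (x - y) * f y).
Proof. by move=> [C kC] bf; apply: bndM => //; exists C. Qed.

Lemma integrable_conv (k f : R -> R) r x : measurable_fun setT k -> bnd k -> nz r k ->
  measurable_fun setT f -> bnd f -> mu.-integrable setT (EFin \o (fun y => k (x - y) * f y)).
Proof.
move=> mk bk rk mf bf; apply: (@integrable_nz _ (r + `|x|)).
- exact: measurable_conv_integrand.
- exact: bnd_conv_integrand.
- exact: nz_conv_integrand.
Qed.

Lemma conv_itv (k f : R -> R) r x : nz r k ->
  convol k f x = \int[mu]_(y in `[(x - r), (x + r)]) (k (x - y) * f y).
Proof.
move=> rk; rewrite [RHS]Rintegral_mkcond; congr Rintegral; apply/funext => y.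
rewrite patchE; case: ifPn => //; rewrite notin_setE/= in_itv/= => /negP h.
rewrite rk ?mul0r//; move: h; apply: contraR.
by rewrite -leNgt ler_norml => /andP[? ?]; apply/andP; split; lra.
Qed.

Lemma conv_bound (k f : R -> R) r C M x : 0 <= r -> 0 <= C -> 0 <= M ->
  measurable_fun setT k -> (forall y, `|k y| <= C) -> nz r k ->
  measurable_fun setT f -> (forall y, `|f y| <= M) -> `|convol k f x| <= C * M * (2 * r).
Proof.
move=> r0 C0 M0 mk kC rk mf fM; rewrite (conv_itv f x rk).
have -> : 2 * r = (x + r) - (x - r) by ring.
apply: Rint_bound; first lra.
- exact: mulr_ge0.
- exact: measurable_conv_integrand.
- by move=> y; rewrite normrM ler_pM.
Qed.

Lemma is_derive_conv (k k' f : R -> R) (r x : R) : continuous k -> continuous k' ->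
  (forall z : R, is_derive z 1 k (k' z)) -> bnd k -> bnd k' -> nz r k -> nz r k' ->
  measurable_fun setT f -> bnd f -> is_derive x 1 (convol k f) (convol k' f x).
Proof.
move=> ck ck' dk bk bk' rk rk' mf bf.
have mk := continuous_measurable_fun ck; have mk' := continuous_measurable_fun ck'.
have d1 (z y : R) : is_derive z 1 (fun x => k (x - y) * f y) (k' (z - y) * f y).
  have h1 : is_derive z 1 (fun x => x - y) 1.
    by apply: is_derive_eq; rewrite /GRing.scale/=; ring.
  have h2 : is_derive z 1 (fun x => k (x - y)) (k' (z - y) * 1).
    exact: (@is_derive1_comp _ k (fun x => x - y)).
  by apply: is_derive_eq; rewrite /GRing.scale/=; ring.
pose F (x y : R) := k (x - y) * f y.
have d1E z y : partial1of2 F z y = k' (z - y) * f y.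
  by rewrite partial1of2E; have h := d1 z y; rewrite derive_val.
have [C C0 kC] := bndP bk'; have [M M0 fM] := bndP bf.
(* For [z] within 1 of [x] the integrand lives in [[x - r - 1, x + r + 1]], so one integrable
   function dominates the whole neighbourhood. *)
pose G (y : R) : R := C * M * \1_(`[(x - r - 1), (x + r + 1)]%classic) y.
have mG : measurable_fun setT G by apply: measurable_funM => //; exact: measurable_indic.
have Ix : `]x - 1, x + 1[%classic x by rewrite /= in_itv/=; apply/andP; split; lra.
have CM0 : 0 <= C * M by rewrite mulr_ge0// ltW.
have intG : mu.-integrable setT (EFin \o G).
  apply: (@integrable_bnd _ _ _ mu (`[(x - r - 1), (x + r + 1)]%classic : set R)) => //.
  - exact: lebesgue_seg_lty.
  - exists (C * M) => y; rewrite /G normrM (ger0_norm CM0) ler_piMr// indicE.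
    by case: (_ \in _); rewrite ?normr1 ?normr0.
  - by move=> y ny; rewrite /G indicE memNset ?mulr0.
have intF z : `]x - 1, x + 1[%classic z -> mu.-integrable setT (EFin \o F z).
  by move=> _; exact: (integrable_conv _ mk bk rk mf bf).
have derF z y : `]x - 1, x + 1[%classic z -> setT y -> derivable (F ^~ y) z 1.
  by move=> _ _; have [] := d1 z y.
have G0 y : 0 <= G y by rewrite /G mulr_ge0.
have Gub z y : `]x - 1, x + 1[%classic z -> setT y -> `|partial1of2 F z y| <= G y.
  rewrite /= in_itv/= => /andP[z1 z2] _; rewrite d1E /G indicE.
  case: (boolP (y \in _)) => [_|]; first by rewrite mulr1 normrM ler_pM.
  rewrite notin_setE/= in_itv/= => /negP h; rewrite rk' ?mul0r ?normr0 ?mulr0//.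
  move: h; apply: contraR; rewrite -leNgt ler_norml => /andP[? ?].
  by apply/andP; split; lra.
have dF := derivable_under_integral measurableT Ix intF derF G0 intG Gub.
have eF := differentiation_under_integral measurableT Ix intF derF G0 intG Gub.
apply: DeriveDef; first exact: dF.
rewrite -derive1E [LHS]eF; apply: eq_Rintegral => y _; exact: d1E.
Qed.

Lemma conv_cont (k f : R -> R) r : continuous k -> bnd k -> nz r k ->
  measurable_fun setT f -> bnd f -> continuous (convol k f).
Proof.
move=> ck bk rk mf bf x.
have mk := continuous_measurable_fun ck.
have [C C0 kC] := bndP bk; have [M M0 fM] := bndP bf.
pose G (y : R) : R := C * M * \1_(`[(x - r - 1), (x + r + 1)]%classic) y.
have mG : measurable_fun setT G by apply: measurable_funM => //; exact: measurable_indic.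
have CM0 : 0 <= C * M by rewrite mulr_ge0// ltW.
have intG : mu.-integrable setT (EFin \o G).
  apply: (@integrable_bnd _ _ _ mu (`[(x - r - 1), (x + r + 1)]%classic : set R)) => //.
  - exact: lebesgue_seg_lty.
  - exists (C * M) => y; rewrite /G normrM (ger0_norm CM0) ler_piMr// indicE.
    by case: (_ \in _); rewrite ?normr1 ?normr0.
  - by move=> y ny; rewrite /G indicE memNset ?mulr0.
pose F (x y : R) := k (x - y) * f y.
have intF z : `]x - 1, x + 1[%classic z -> mu.-integrable setT (EFin \o F z).
  by move=> _; exact: (integrable_conv _ mk bk rk mf bf).
have cF : {ae mu, forall y, setT y -> {in `]x - 1, x + 1[%classic, continuous (F ^~ y)}}.
  apply: aeW => y _ z _; apply: cvgMl.
  apply: (@continuous_comp _ _ _ (fun x => x - y)); last exact: ck.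
  by apply: cvgB; [exact: cvg_id|exact: cvg_cst].
have Gub z : `]x - 1, x + 1[%classic z -> {ae mu, forall y, setT y -> `|F z y| <= G y}.
  rewrite /= in_itv/= => /andP[z1 z2]; apply: aeW => y _; rewrite /F /G indicE.
  case: (boolP (y \in _)) => [_|]; first by rewrite mulr1 normrM ler_pM.
  rewrite notin_setE/= in_itv/= => /negP h; rewrite rk ?mul0r ?normr0 ?mulr0//.
  move: h; apply: contraR; rewrite -leNgt ler_norml => /andP[? ?].
  by apply/andP; split; lra.
have := @continuity_under_integral _ _ _ mu F setT measurableT _ _ intF cF G intG Gub x.
by apply; rewrite inE/= in_itv/=; apply/andP; split; lra.
Qed.

Lemma measurable_conv2 (k : R -> R) (f : R * R -> R) : measurable_fun setT k ->
  measurable_fun setT f -> measurable_fun setT (fun p => convol k (fun y => f (p.1, y)) p.2).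
Proof.
move=> mk mf.
apply: (@measurable_Rint1 _ _ _ (fun q : (R * R) * R => k (q.1.2 - q.2) * f (q.1.1, q.2))).
apply: measurable_funM.
- apply: (measurableT_comp mk); apply: measurable_funB => //.
  exact: (measurableT_comp (@measurable_snd _ _ R R) (@measurable_fst _ _ (R * R)%type R)).
- apply: (measurableT_comp mf); apply: measurable_fun_pair => //.
  exact: (measurableT_comp (@measurable_fst _ _ R R) (@measurable_fst _ _ (R * R)%type R)).
Qed.

Lemma measurable_ker d : measurable_fun setT (@ker R d).
Proof. by apply: continuous_measurable_fun; exact: ker_cont. Qed.

Lemma measurable_dker d : measurable_fun setT (@dker R d).
Proof. by apply: continuous_measurable_fun; exact: dker_cont. Qed.

Lemma bnd_ker d : 0 < d -> bnd (@ker R d).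
Proof. by move=> d0; have [C _ h] := @ker_bound R; exists (C / d) => x; have [] := h d x d0. Qed.

Lemma bnd_dker d : 0 < d -> bnd (@dker R d).
Proof. by move=> d0; have [C _ h] := @ker_bound R; exists (C / d ^+ 2) => x; have [] := h d x d0. Qed.

(** The kernel has integral one, so constants pass through the convolution; the order bounds below
    follow by subtracting the bound. *)
Lemma conv_ker_sub (f : R -> R) d c x : 0 < d -> measurable_fun setT f -> bnd f ->
  convol (ker d) f x - c = convol (ker d) (fun y => f y - c) x.
Proof.
move=> d0 mf bf; rewrite /convol.
under [RHS]eq_Rintegral do rewrite mulrBr.
have ik g : measurable_fun setT g -> bnd g ->
    mu.-integrable setT (EFin \o (fun y => ker d (x - y) * g y)).
  by move=> mg bg; apply: (integrable_conv _ (measurable_ker d) (bnd_ker d0) (nz_ker d0)).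
rewrite RintegralB//; last 2 first.
- exact: ik.
- by apply: ik => //; exact: bnd_cst.
congr (_ - _); rewrite RintegralZr ?ker_int1 ?mul1r//.
have := ik (cst 1) (measurable_cst _) (bnd_cst 1).
by apply: eq_ind; congr (_.-integrable _ _); apply/funext => y /=; rewrite mulr1.
Qed.

Lemma conv_ker_ge0 (f : R -> R) d x : 0 < d -> (forall y, 0 <= f y) -> 0 <= convol (ker d) f x.
Proof. by move=> d0 f0; apply: Rintegral_ge0 => y _; rewrite mulr_ge0// ker_ge0. Qed.

Lemma conv_ker_ge (f : R -> R) d m x : 0 < d -> measurable_fun setT f -> bnd f ->
  (forall y, m <= f y) -> m <= convol (ker d) f x.
Proof.
move=> d0 mf bf fm; rewrite -subr_ge0 conv_ker_sub//; apply: conv_ker_ge0 => // y.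
by rewrite subr_ge0.
Qed.

Lemma conv_ker_le (f : R -> R) d M x : 0 < d -> measurable_fun setT f -> bnd f ->
  (forall y, f y <= M) -> convol (ker d) f x <= M.
Proof.
move=> d0 mf bf fM; rewrite -subr_le0 conv_ker_sub//.
rewrite -oppr_ge0 -mulN1r /convol -RintegralZl//; last first.
  apply: (integrable_conv _ (measurable_ker d) (bnd_ker d0) (nz_ker d0)).
  - exact: measurable_funB.
  - by apply: bndB => //; exact: bnd_cst.
apply: Rintegral_ge0 => y _; rewrite mulN1r -mulrN mulr_ge0 ?ker_ge0//.
by rewrite oppr_ge0 subr_le0.
Qed.

(** At a Lebesgue point the error is at most [C / d] times the integral of [|f - f x|] over the ball
    of radius [d], that is [2 * C] times the mean of this function, since the ball has length
    [2 * d]. *)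
Lemma conv_ker_cvg (f : R -> R) (d_ : nat -> R) : (forall n, 0 < d_ n) ->
  d_ n @[n --> \oo] --> 0 -> measurable_fun setT f -> bnd f ->
  {ae mu, forall x, convol (ker (d_ n)) f x @[n --> \oo] --> f x}.
Proof.
move=> d0 dcv mf bf.
have [C C0 kC] := @ker_bound R; have [M M0 fM] := bndP bf.
have locf : locally_integrable setT f.
  split => //; first exact: openT.
  move=> K _ cK; have [A [_ KA]] := compact_bounded cK.
  have KI : K `<=` `[(- (`|A| + 1)), (`|A| + 1)]%classic.
    move=> x Kx /=; rewrite in_itv/= -ler_norml; apply: (KA (`|A| + 1)) => //.
    by rewrite ltr_pwDr// ler_norm.
  have mK := compact_measurable cK.
  apply: (@le_lt_trans _ _ (M%:E * mu `[(- (`|A| + 1))%R, (`|A| + 1)%R]%classic)%E); last first.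
    by rewrite lte_mul_pinfty// ?lee_fin ?ltW// lebesgue_seg_lty.
  rewrite -integral_cst//.
  apply: (@le_trans _ _ (\int[mu]_(x in K) (cst M%:E) x)%E).
    apply: ge0_le_integral => //=.
    - by apply/measurable_EFinP; apply: measurableT_comp => //; exact: measurable_funTS.
    - by move=> x _; rewrite lee_fin.
  by apply: ge0_subset_integral => //= x _; rewrite lee_fin ltW.
(* Differentiation of integrals is a limit from the right at 0, so positivity of each [d_ n] has to
   be put into the filter. *)
have dr : d_ n @[n --> \oo] --> 0^'+.
  by move=> A hA; have := dcv [set u | 0 < u -> A u] hA; apply: (@filterS nat \oo _ (fun n => 0 < d_ n -> A (d_ n))) => n h; exact: (h (d0 n)).
apply: aeS (lebesgue_differentiation locf) => x hx.
have h := cvg_comp _ _ dr hx.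
have hb n : (`|convol (ker (d_ n)) f x - f x|%:E <= (2 * C)%:E * davg f x (d_ n))%E.
  have dn := d0 n.
  rewrite conv_ker_sub// /davg /iavg lebesgue_measure_ball; last exact: ltW.
  have mg : measurable_fun setT (fun y => f y - f x) by exact: measurable_funB.
  have bg : bnd (fun y => f y - f x) by apply: bndB => //; exact: bnd_cst.
  rewrite /convol EFin_normr_Rintegral//; last first.
    exact: (integrable_conv _ (measurable_ker _) (bnd_ker dn) (nz_ker dn)).
  apply: le_trans.
    apply: le_abse_integral => //; apply/measurable_EFinP.
    exact: (measurable_conv_integrand _ (measurable_ker _) mg).
  rewrite muleA.
  have -> : ((2 * C)%:E * ((d_ n *+ 2)%:E)^-1 = (C / d_ n)%:E)%E.
    rewrite inver (_ : d_ n *+ 2 == 0 = false) ?mulrn_eq0 ?(gt_eqF dn)//=.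
    by rewrite -EFinM; congr EFin; rewrite -mulr_natl; field; rewrite gt_eqF.
  rewrite -ge0_integralZl//; last 3 first.
  - exact: measurable_ball.
  - by apply/measurable_EFinP; apply: measurableT_comp => //; exact: measurable_funTS.
  - by rewrite lee_fin divr_ge0 ?ltW.
  rewrite [leRHS]integral_mkcond; apply: ge0_le_integral => //.
  - apply: measurableT_comp => //; apply/measurable_EFinP.
    exact: (measurable_conv_integrand _ (measurable_ker _) mg).
  - apply/(measurable_restrictT _ _).1; first exact: measurable_ball.
    apply: measurable_funeM; apply/measurable_EFinP; apply: measurableT_comp => //.
    exact: measurable_funTS.
  - move=> y _; rewrite patchE; case: ifPn => [_|].
      by rewrite abse_EFin -EFinM lee_fin normrM ler_pM// (kC _ _ dn).1.
    rewrite notin_setE /ball/= => /negP; rewrite -leNgt => dxy.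
    rewrite /ker /rho bump_out ?mul0r ?mul0r ?normr0//.
    by rewrite normrM normfV (gtr0_norm dn) ler_pdivlMr// mul1r.
apply/subr_cvg0; apply: norm_cvg0.
have h2 : ((2 * C)%:E * davg f x (d_ n))%E @[n --> \oo] --> 0%E.
  by rewrite -(mule0 (2 * C)%:E); apply: cvgeZl.
have h3 : (`|convol (ker (d_ n)) f x - f x|)%:E @[n --> \oo] --> 0%E.
  apply: (@squeeze_cvge _ _ _ _ (cst 0%E) _ _ _ _ _ h2); last exact: cvg_cst.
  by apply: nearW => n; rewrite lee_fin normr_ge0 hb.
by move/fine_cvgP : h3 => [].
Qed.

Lemma Rint_derive0 (F f : R -> R) r : (forall x : R, is_derive x 1 F (f x)) -> continuous f ->
  nz r F -> nz r f -> \int[mu]_x f x = 0.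
Proof.
move=> dF cf rF rf.
(* [nz] says nothing at the points of modulus exactly [r]; the larger radius makes [F] vanish at
   both endpoints. *)
pose s := `|r| + 1.
have rs : r < s by rewrite /s ltr_pwDr// ler_norm.
have s0 : 0 < s by rewrite /s ltr_wpDl.
have nf : nz s f by move=> x sx; apply: rf; exact: lt_trans rs sx.
have dr x : derivable F x 1 by have [] := dF x.
have cF : continuous F by move=> x; apply/differentiable_continuous/derivable1_diffP.
rewrite (Rint_nz nf) /Rintegral (@continuous_FTC2 _ f F).
- by rewrite rF ?rF//= ?subrr// ?normrN gtr0_norm.
- by rewrite (lt_trans _ s0)// oppr_lt0.
- exact: continuous_subspaceT.
- split => // [|].
  + by apply: cvg_at_right_filter; exact: cF.
  + by apply: cvg_at_left_filter; exact: cF.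
- by move=> x _; rewrite derive1E; have h := dF x; rewrite derive_val.
Qed.

End convolution.

(** * Convexity of the flux and lower bounds for the cost *)

Section convex_cost.
Context {R : realType}.
Notation mu := (@lebesgue_measure R).
Variable a : R -> R.
Hypotheses (C2a : C2 a) (cvxa : strictly_convex a).

Lemma C2_is_derive (f : R -> R) (x : R) : C2 f -> is_derive x 1 f (derive1 f x).
Proof. by move=> [df _]; apply: DeriveDef; rewrite ?derive1E. Qed.

Lemma C2_is_derive2 (f : R -> R) (x : R) : C2 f -> is_derive x 1 (derive1 f) (derive1n 2 f x).
Proof. by move=> [_ [df _]]; apply: DeriveDef; [exact: df|rewrite derive1nS derive1n1 derive1E]. Qed.

Lemma derivable_continuous (f : R -> R) : (forall x, derivable f x 1) -> continuous f.
Proof. by move=> df x; apply/differentiable_continuous/derivable1_diffP. Qed.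

Lemma C2_cont (f : R -> R) : C2 f -> continuous f.
Proof. by move=> [df _]; exact: derivable_continuous. Qed.

Lemma C2_cont1 (f : R -> R) : C2 f -> continuous (derive1 f).
Proof. by move=> [_ [df _]]; exact: derivable_continuous. Qed.

(** Convexity between [m] and [w] bounds the difference quotient of [a] at [m] along the steps
    [l_ n * (w - m)]; letting [l_ n] tend to 0 gives the tangent inequality. *)
Lemma convex_tangent m w : a m + derive1 a m * (w - m) <= a w.
Proof.
have [->|wm] := eqVneq w m; first by rewrite subrr mulr0 addr0.
have wm0 : w - m != 0 by rewrite subr_eq0.
(* [harmonic 0] is 1; the division by 2 keeps the weight strictly below 1. *)
pose l_ (n : nat) : R := harmonic n / 2.
have l0 n : 0 < l_ n by rewrite divr_gt0// harmonic_gt0.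
have l1 n : l_ n < 1.
  rewrite ltr_pdivrMr// mul1r (@le_lt_trans _ _ 1)// ?ltr1n//.
  by rewrite /harmonic/= invf_le1// ler1n.
have lcv : l_ n @[n --> \oo] --> 0.
  by rewrite -(mul0r 2^-1); apply: cvgMl; exact: cvg_harmonic.
have hcv : l_ n * (w - m) @[n --> \oo] --> 0.
  by rewrite -(mul0r (w - m)); apply: cvgMl.
have da := C2_is_derive m C2a.
have dcv : h^-1 *: ((a \o shift m) (h *: 1) - a m) @[h --> 0^'] --> derive1 a m.
  by have [/cvg_ex[l hl] dl] := da; rewrite -dl /derive (cvg_lim _ hl).
have hn0 : (forall n, l_ n * (w - m) != 0) /\ l_ n * (w - m) @[n --> \oo] --> 0.
  by split=> // n; rewrite mulf_neq0// gt_eqF.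
move/cvgr_dnbhsP: dcv => /(_ _ hn0) ucv.
have ucv2 : (l_ n * (w - m))^-1 *: ((a \o shift m) ((l_ n * (w - m)) *: 1) - a m) * (w - m)
    @[n --> \oo] --> derive1 a m * (w - m) by exact: cvgMl.
rewrite addrC -lerBrDr -(cvg_lim _ ucv2)//; apply: limr_le; first exact: cvgP ucv2.
apply: nearW => n.
rewrite /shift/= [_%:A]mulr1 /GRing.scale/=.
have e1 : l_ n * (w - m) + m = l_ n * w + (1 - l_ n) * m by ring.
have l01 : 0 < l_ n < 1 by rewrite l0 l1.
have h := cvxa wm l01.
have ln0 : l_ n != 0 by rewrite gt_eqF.
rewrite e1; set z := a _ in h *.
have -> : (l_ n * (w - m))^-1 * (z - a m) * (w - m) = (z - a m) / l_ n.
  by field; rewrite ln0 wm0.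
rewrite ler_pdivrMr ?l0//; lra.
Qed.

Lemma derive1_nd v w : v <= w -> derive1 a v <= derive1 a w.
Proof.
rewrite le_eqVlt => /predU1P[->//|vw].
have h1 := convex_tangent v w; have h2 := convex_tangent w v.
have : 0 <= (derive1 a w - derive1 a v) * (w - v) by lra.
by rewrite pmulr_lge0 ?subr_gt0// subr_ge0.
Qed.

Lemma integrable_cont (f : R -> R) (v w : R) : continuous f ->
  mu.-integrable `[v, w]%classic (EFin \o f).
Proof.
move=> cf; apply: continuous_compact_integrable; first exact: segment_compact.
exact: continuous_subspaceT.
Qed.

Lemma Rint_FTC (F f : R -> R) (v w : R) : v <= w -> (forall x : R, is_derive x 1 F (f x)) ->
  continuous f -> \int[mu]_(x in `[v, w]) f x = F w - F v.
Proof.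
move=> vw dF cf; move: vw; rewrite le_eqVlt => /predU1P[->|vw].
  by rewrite set_itv1 Rintegral_set1 subrr.
have dr x : derivable F x 1 by have [] := dF x.
have cF := derivable_continuous dr.
rewrite /Rintegral (@continuous_FTC2 _ f F)//.
- exact: continuous_subspaceT.
- split => // [|].
  + by apply: cvg_at_right_filter; exact: cF.
  + by apply: cvg_at_left_filter; exact: cF.
- by move=> x _; rewrite derive1E; have h := dF x; rewrite derive_val.
Qed.

Lemma Rint_itv_split (f : R -> R) (v m w : R) : v <= m -> m <= w ->
  mu.-integrable `[v, w]%classic (EFin \o f) ->
  \int[mu]_(x in `[v, w]) f x = \int[mu]_(x in `[v, m]) f x + \int[mu]_(x in `[m, w]) f x.
Proof.
move=> vm mw itf.
have := @Rintegral_itvB R f (BLeft v) (BRight w) m itf.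
rewrite !bnd_simp => /(_ vm mw) /eqP; rewrite subr_eq addrC => /eqP ->.
congr (_ + _); apply: Rintegral_itv_obnd_cbnd; apply: integrableS itf => //.
by move=> x /=; rewrite !in_itv/= => /andP[mx ->]; rewrite andbT (le_trans vm)// ltW.
Qed.

(** The cost is twice the error of the trapezoidal rule for [a] on [[v, w]]. In this form no
    derivative of [a] remains, which makes additivity and measurability accessible. *)
Lemma Delta_closed v w : v <= w ->
  Delta a v w = (w - v) * (a v + a w) - 2 * \int[mu]_(s in `[v, w]) a s.
Proof.
move=> vw; rewrite /Delta (min_idPl vw) (max_idPr vw).
have ca := C2_cont C2a; have ca1 := C2_cont1 C2a.
have ida x := C2_is_derive x C2a.
(* Monotonicity of the derivative fixes the sign on either side of [p]. The result is arranged so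
   that its first summand is the derivative of [a p * (2 * p - (v + w))]. *)
have inner p : p \in `[v, w]%classic -> \int[mu]_(q in `[v, w]) `|derive1 a p - derive1 a q| =
    (2 * a p + derive1 a p * (2 * p - (v + w))) + ((a v + a w) - 4 * a p).
  rewrite inE/= in_itv/= => /andP[vp pw].
  rewrite (@Rint_itv_split _ v p w)//; last first.
    apply: (@integrable_cont (fun q => `|derive1 a p - derive1 a q|)) => q.
    apply: cvg_norm; apply: cvgB; [exact: cvg_cst|exact: ca1].
  have -> : \int[mu]_(q in `[v, p]) `|derive1 a p - derive1 a q| =
     derive1 a p * (p - v) - (a p - a v).
    rewrite (@eq_Rintegral _ _ _ mu _ (fun q => derive1 a p - derive1 a q)); last first.
      move=> q; rewrite inE/= in_itv/= => /andP[_ qp].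
      by rewrite ger0_norm// subr_ge0 derive1_nd.
    have dd (q : R) : is_derive q 1 (fun q => derive1 a p * q - a q) (derive1 a p - derive1 a q).
      by apply: is_derive_eq; rewrite /GRing.scale/=; ring.
    rewrite (Rint_FTC vp dd); first ring.
    by move=> q; apply: cvgB; [exact: cvg_cst|exact: ca1].
  have -> : \int[mu]_(q in `[p, w]) `|derive1 a p - derive1 a q| =
     (a w - a p) - derive1 a p * (w - p).
    rewrite (@eq_Rintegral _ _ _ mu _ (fun q => derive1 a q - derive1 a p)); last first.
      move=> q; rewrite inE/= in_itv/= => /andP[pq _].
      by rewrite distrC ger0_norm// subr_ge0 derive1_nd.
    have dd (q : R) : is_derive q 1 (fun q => a q - derive1 a p * q) (derive1 a q - derive1 a p).
      by apply: is_derive_eq; rewrite /GRing.scale/=; ring.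
    rewrite (Rint_FTC pw dd); first ring.
    by move=> q; apply: cvgB; [exact: ca1|exact: cvg_cst].
  ring.
have -> := @eq_Rintegral _ _ _ mu `[v, w]%classic _ _ inner.
have c1 : continuous (fun p => 2 * a p + derive1 a p * (2 * p - (v + w))).
  move=> p; apply: cvgD; first by apply: cvgMr; exact: ca.
  apply: cvgM; first exact: ca1.
  by apply: cvgB; [apply: cvgMr; exact: cvg_id|exact: cvg_cst].
have c2 : continuous (fun p => (a v + a w) - 4 * a p).
  by move=> p; apply: cvgB; [exact: cvg_cst|apply: cvgMr; exact: ca].
rewrite RintegralD//; [|exact: integrable_cont..].
have dd (p : R) : is_derive p 1 (fun p => a p * (2 * p - (v + w)))
    (2 * a p + derive1 a p * (2 * p - (v + w))).
  by apply: is_derive_eq; rewrite /GRing.scale/=; ring.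
rewrite (Rint_FTC vw dd)//.
rewrite RintegralB//; [|exact: (@integrable_cont (cst (a v + a w)) _ _ (@cst_continuous _ _ _))|
  by apply: (@integrable_cont (fun p => 4 * a p)) => p; apply: cvgMr; exact: ca].
rewrite RintegralZl//; last exact: integrable_cont.
rewrite Rintegral_cst//= lebesgue_seg//=; by field.
Qed.

Lemma DeltaC v w : Delta a v w = Delta a w v.
Proof. by rewrite /Delta minC maxC. Qed.

Lemma Delta_ge0 v w : 0 <= Delta a v w.
Proof.
by rewrite /Delta mulr_ge0//; apply: Rintegral_ge0 => p _; apply: Rintegral_ge0.
Qed.

(** By the closed form the left side equals [Delta a v w - Delta a v m - Delta a m w], since the
    integrals over the two pieces cancel; it is twice the area of the triangle spanned by three
    points of the graph. *)
Lemma Delta_split v m w : v <= m -> m <= w ->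
  (m - v) * a w + (w - m) * a v - (w - v) * a m <= Delta a v w.
Proof.
move=> vm mw; have h1 := Delta_ge0 v m; have h2 := Delta_ge0 m w.
move: h1 h2; rewrite !Delta_closed//; last exact: le_trans vm mw.
rewrite (@Rint_itv_split _ v m w)//; last exact/integrable_cont/(C2_cont C2a).
by move=> ? ?; lra.
Qed.

(** The Bregman divergence of [a] with base point [m]. *)
Definition breg m w := a w - a m - derive1 a m * (w - m).

Lemma breg_ge0 m w : 0 <= breg m w.
Proof. by have := convex_tangent m w; rewrite /breg; lra. Qed.

(** The triangle expression of [Delta_split] is exactly [(m - v) * breg m w + (w - m) * breg m v].
    Both terms are nonnegative; this lemma keeps the first one, its twin [Delta_lower'] the
    second. *)
Lemma Delta_lower v m w : v <= m -> m <= w -> (m - v) * breg m w <= Delta a v w.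
Proof.
move=> vm mw; apply: le_trans (Delta_split vm mw).
have h := convex_tangent m v; rewrite /breg.
have h2 : 0 <= (w - m) * (a v - (a m + derive1 a m * (v - m))).
  by rewrite mulr_ge0// subr_ge0.
rewrite -subr_ge0; apply: le_trans h2 _; rewrite le_eqVlt; apply/orP; left; apply/eqP; ring.
Qed.

Lemma Delta_lower' v m w : v <= m -> m <= w -> (w - m) * breg m v <= Delta a v w.
Proof.
move=> vm mw; apply: le_trans (Delta_split vm mw).
have h := convex_tangent m w; rewrite /breg.
have h2 : 0 <= (m - v) * (a w - (a m + derive1 a m * (w - m))).
  by rewrite mulr_ge0// subr_ge0.
rewrite -subr_ge0; apply: le_trans h2 _; rewrite le_eqVlt; apply/orP; left; apply/eqP; ring.
Qed.

(** The closed form is rewritten with an integral over the whole line, the moving endpoints being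
    put into the integrand, so that measurability of parametrised integrals applies. *)
Lemma measurable_Delta d (X : measurableType d) (f g : X -> R) :
  measurable_fun setT f -> measurable_fun setT g ->
  measurable_fun setT (fun x => Delta a (f x) (g x)).
Proof.
move=> mf mg; have ma := continuous_measurable_fun (C2_cont C2a).
pose lo x := minr (f x) (g x); pose hi x := maxr (f x) (g x).
have mlo : measurable_fun setT lo by exact: measurable_minr.
have mhi : measurable_fun setT hi by exact: measurable_maxr.
have -> : (fun x => Delta a (f x) (g x)) = fun x => (hi x - lo x) * (a (lo x) + a (hi x)) -
    2 * \int[mu]_s (if (lo x <= s) && (s <= hi x) then a s else 0).
  apply/funext => x; have lh : lo x <= hi x by rewrite /lo /hi; case: (leP (f x) (g x)) => // /ltW.
  have -> : Delta a (f x) (g x) = Delta a (lo x) (hi x).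
    by rewrite /lo /hi; case: (leP (f x) (g x)) => _; [|exact: DeltaC].
  rewrite Delta_closed//; congr (_ - 2 * _); rewrite Rintegral_mkcond; congr Rintegral.
  apply/funext => s; rewrite patchE.
  have -> : (s \in `[lo x, hi x]%classic) = (lo x <= s) && (s <= hi x).
    by apply/idP/idP; rewrite inE/= in_itv.
  by [].
apply: measurable_funB.
  apply: measurable_funM; first exact: measurable_funB.
  by apply: measurable_funD; exact: (measurableT_comp ma).
apply: measurable_funM => //.
apply: (@measurable_Rint1 _ _ _ (fun q : X * R => if (lo q.1 <= q.2) && (q.2 <= hi q.1) then a q.2 else 0)).
apply: measurable_fun_ifT => //.
- apply: measurable_and.
  + by apply: measurable_fun_ler => //; exact: (measurableT_comp mlo).
  + by apply: measurable_fun_ler => //; exact: (measurableT_comp mhi).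
- exact: (measurableT_comp ma).
Qed.

End convex_cost.

(** * The commutator estimate on one interval *)

Section commutator.
Context {R : realType}.
Notation mu := (@lebesgue_measure R).

Lemma bnd_comp {T : Type} (g : R -> R) (f : T -> R) : continuous g -> bnd f -> bnd (g \o f).
Proof.
move=> cg [M fM].
have cK : compact (g @` `[(- M), M]%classic).
  apply: continuous_compact; first exact: continuous_subspaceT.
  exact: segment_compact.
have [A [_ KA]] := compact_bounded cK.
exists (`|A| + 1) => x; apply: (KA (`|A| + 1)); first by rewrite ltr_pwDr// ler_norm.
by exists (f x) => //=; rewrite in_itv/= -ler_norml.
Qed.

Lemma conv_ker_cst (d c x : R) : 0 < d -> convol (ker d) (cst c) x = c.
Proof.
move=> d0; apply/eqP; rewrite -subr_eq0 conv_ker_sub//; last exact: bnd_cst.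
rewrite /convol (_ : (fun y => _) = cst 0); last by apply/funext => y /=; rewrite subrr mulr0.
by rewrite Rintegral_cst// mul0r.
Qed.

Lemma is_derive_conv_ker (f : R -> R) (d x : R) : 0 < d -> measurable_fun setT f -> bnd f ->
  is_derive x 1 (convol (ker d) f) (convol (dker d) f x).
Proof.
move=> d0 mf bf; apply: (@is_derive_conv _ (ker d) (dker d) f d x) => //.
- exact: ker_cont.
- exact: dker_cont.
- by move=> z; exact: is_derive_ker.
- exact: bnd_ker.
- exact: bnd_dker.
- exact: nz_ker.
- exact: nz_dker.
Qed.

(** The derivative of the kernel has integral zero; this is read off by differentiating the constant
    function [convol (ker d) (cst c)]. *)
Lemma conv_dker_cst (d c x : R) : 0 < d -> convol (dker d) (cst c) x = 0.
Proof.
move=> d0.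
have h : is_derive x 1 (convol (ker d) (cst c)) (convol (dker d) (cst c) x).
  by apply: is_derive_conv_ker => //; exact: bnd_cst.
rewrite (_ : convol (ker d) (cst c) = cst c) in h; last first.
  by apply/funext => y; exact: conv_ker_cst.
by rewrite -(@derive_val _ _ _ _ _ _ _ h) derive_cst.
Qed.

Lemma integrable_dker (g : R -> R) d x : 0 < d -> measurable_fun setT g -> bnd g ->
  mu.-integrable setT (EFin \o (fun y => dker d (x - y) * g y)).
Proof.
by move=> d0 mg bg; exact: (integrable_conv _ (measurable_dker d) (bnd_dker d0) (nz_dker d0)).
Qed.

Lemma integrable_ker (g : R -> R) d x : 0 < d -> measurable_fun setT g -> bnd g ->
  mu.-integrable setT (EFin \o (fun y => ker d (x - y) * g y)).
Proof.
by move=> d0 mg bg; exact: (integrable_conv _ (measurable_ker d) (bnd_ker d0) (nz_ker d0)).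
Qed.

Lemma conv_dker_sub (f : R -> R) d c x : 0 < d -> measurable_fun setT f -> bnd f ->
  convol (dker d) (fun y => f y - c) x = convol (dker d) f x.
Proof.
move=> d0 mf bf; rewrite -[RHS]subr0 -(conv_dker_cst c x d0) /convol -RintegralB//.
- by apply: eq_Rintegral => y _; rewrite mulrBr.
- exact: integrable_dker.
- by apply: integrable_dker => //; exact: bnd_cst.
Qed.

Lemma conv_ker_cont (f : R -> R) d : 0 < d -> measurable_fun setT f -> bnd f ->
  continuous (convol (ker d) f).
Proof.
move=> d0; apply: conv_cont; [exact: ker_cont|exact: bnd_ker|exact: nz_ker].
Qed.

Lemma conv_dker_cont (f : R -> R) d : 0 < d -> measurable_fun setT f -> bnd f ->
  continuous (convol (dker d) f).
Proof.
move=> d0; apply: conv_cont; [exact: dker_cont|exact: bnd_dker|exact: nz_dker].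
Qed.

Variable a : R -> R.
Hypotheses (C2a : C2 a) (cvxa : strictly_convex a).

(** Averaging is linear and fixes constants. Taking [m] equal to the average of [f] kills the last
    term and shows that the Jensen gap is nonnegative; for other [m], the tangent inequality at [m]
    shows that the average dominates the gap. *)
Lemma conv_breg (f : R -> R) d m x : 0 < d -> measurable_fun setT f -> bnd f ->
  convol (ker d) (fun y => breg a m (f y)) x =
  convol (ker d) (a \o f) x - a m - derive1 a m * (convol (ker d) f x - m).
Proof.
move=> d0 mf bf.
have ma := continuous_measurable_fun (C2_cont C2a).
have maf : measurable_fun setT (a \o f) by exact: measurableT_comp.
have baf : bnd (a \o f) by apply: bnd_comp => //; exact: C2_cont.
have mB (g : R -> R) c : measurable_fun setT g -> measurable_fun setT (fun y => g y - c).
  by move=> mg; exact: measurable_funB.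
have bB (g : R -> R) c : bnd g -> bnd (fun y => g y - c).
  by move=> bg; apply: bndB => //; exact: bnd_cst.
rewrite (conv_ker_sub (a m) x d0 maf baf) (conv_ker_sub m x d0 mf bf) /convol -RintegralZl//; last exact: integrable_ker (mB _ _ mf) (bB _ _ bf).
rewrite -RintegralB//.
- by apply: eq_Rintegral => y _; rewrite /breg/=; ring.
- exact: integrable_ker (mB _ _ maf) (bB _ _ baf).
- have := integrable_ker x d0 (measurable_funM (measurable_cst (derive1 a m)) (mB _ m mf))
    (bndM (bnd_cst (derive1 a m)) (bB _ m bf)).
  by apply: eq_ind; congr (_.-integrable _ _); apply/funext => y /=; congr EFin; ring.
Qed.

Lemma jensen_gap_ge0 (f : R -> R) d x : 0 < d -> measurable_fun setT f -> bnd f ->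
  0 <= convol (ker d) (a \o f) x - a (convol (ker d) f x).
Proof.
move=> d0 mf bf; have := conv_breg (convol (ker d) f x) x d0 mf bf.
rewrite subrr mulr0 subr0 => <-; apply: conv_ker_ge0 => // y; exact: breg_ge0.
Qed.

Lemma jensen_gap_le (f : R -> R) d m x : 0 < d -> measurable_fun setT f -> bnd f ->
  convol (ker d) (a \o f) x - a (convol (ker d) f x) <= convol (ker d) (fun y => breg a m (f y)) x.
Proof.
move=> d0 mf bf; rewrite conv_breg//.
have := convex_tangent C2a cvxa m (convol (ker d) f x); lra.
Qed.

Lemma le_conv_itv (k f : R -> R) (d x C : R) : 0 < d -> 0 <= C -> measurable_fun setT k ->
  (forall y, `|k y| <= C) -> nz d k -> measurable_fun setT f -> bnd f ->
  `|convol k f x| <= C * \int[mu]_(y in `[(x - d), (x + d)]) `|f y|.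
Proof.
move=> d0 C0 mk kC dk mf bf; rewrite (conv_itv f x dk).
have mi : measurable_fun setT (fun y : R => k (x - y) * f y) by exact: measurable_conv_integrand.
have bi : bnd (fun y : R => k (x - y) * f y) by apply: bnd_conv_integrand => //; exists C.
have mn : measurable_fun setT (fun y => `|f y|) by exact: measurableT_comp.
apply: (le_trans (le_normr_Rintegral _ (integrable_itv _ _ mi bi))) => //.
rewrite -RintegralZl//; last by apply: integrable_itv => //; exact: bnd_norm.
apply: le_Rintegral => //.
- by apply: (@integrable_itv _ _ _ (fun y => `|k (x - y) * f y|)); [exact: measurableT_comp|exact: bnd_norm].
- apply: (@integrable_itv _ _ _ (fun y => C * `|f y|)); first exact: measurable_funM.
  by apply: bndM; [exact: bnd_cst|exact: bnd_norm].
- by move=> y _; rewrite normrM ler_wpM2r.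
Qed.

(* [P] and [N] are the integrals of the positive and negative parts of [f - m]; choosing [m] to be
   the mean makes them equal, so the first moment may be computed on the side of [m] opposite to
   any given value [f z]. *)
Lemma moment_breg_le (f : R -> R) (u w : R) : u < w -> measurable_fun setT f -> bnd f ->
  exists m, ((\int[mu]_(y in `[u, w]) `|f y - m| * \int[mu]_(z in `[u, w]) breg a m (f z))%:E <=
    2%:E * \int[mu]_(z in `[u, w]) \int[mu]_(y in `[u, w]) (Delta a (f y) (f z))%:E)%E.
Proof.
move=> uw mf bf; pose m := (w - u)^-1 * \int[mu]_(y in `[u, w]) f y; exists m.
pose fp y := maxr (f y - m) 0; pose fm y := maxr (m - f y) 0.
have mfm : measurable_fun setT (fun y => f y - m) by exact: measurable_funB.
have mmf : measurable_fun setT (fun y => m - f y) by exact: measurable_funB.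
have mfp : measurable_fun setT fp by exact: measurable_maxr.
have mfn : measurable_fun setT fm by exact: measurable_maxr.
have bfm : bnd (fun y => f y - m) by apply: bndB => //; exact: bnd_cst.
have bmax (g : R -> R) : bnd g -> bnd (fun y => maxr (g y) 0).
  by move=> [M gM]; exists M => y; case: (leP (g y) 0) => // _; rewrite normr0 (le_trans _ (gM y)).
have bmf : bnd (fun y => m - f y) by apply: bndB => //; exact: bnd_cst.
have bfp : bnd fp by exact: bmax.
have bfn : bnd fm by exact: bmax.
have hB (s t : R) : maxr (s - t) 0 - maxr (t - s) 0 = s - t.
  by case: (leP (s - t) 0) => h1; case: (leP (t - s) 0) => h2; lra.
have hN (s t : R) : `|s - t| = maxr (s - t) 0 + maxr (t - s) 0.
  case: (leP (s - t) 0) => h1; case: (leP (t - s) 0) => h2.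
  - by rewrite ler0_norm//; lra.
  - by rewrite ler0_norm//; lra.
  - by rewrite gtr0_norm//; lra.
  - lra.
pose P := \int[mu]_(y in `[u, w]) fp y; pose N := \int[mu]_(y in `[u, w]) fm y.
have ifp := integrable_itv u w mfp bfp; have ifn := integrable_itv u w mfn bfn.
have PN : P = N.
  apply/eqP; rewrite -subr_eq0 /P /N -RintegralB//.
  rewrite (@eq_Rintegral _ _ _ mu _ (fun y => f y - m)); last first.
    by move=> y _; exact: hB.
  rewrite RintegralB//; [|exact: integrable_itv|by apply: integrable_itv => //; exact: bnd_cst].
  rewrite Rintegral_cst//= lebesgue_seg/=; last exact: ltW.
  by rewrite /m mulrAC mulVf ?mul1r ?subrr// subr_eq0 gt_eqF.
have SP : \int[mu]_(y in `[u, w]) `|f y - m| = P + N.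
  by rewrite /P /N -RintegralD//; apply: eq_Rintegral => y _; exact: hN.
set S := \int[mu]_(y in `[u, w]) `|f y - m| in SP *.
have S2P : S = 2 * P by rewrite SP -PN; ring.
have S2N : S = 2 * N by rewrite SP PN; ring.
have mbr : measurable_fun setT (fun z => breg a m (f z)).
  have ma := continuous_measurable_fun (C2_cont C2a).
  apply: measurable_funB; first by apply: measurable_funB => //; exact: measurableT_comp.
  exact: measurable_funM.
have bbr : bnd (fun z => breg a m (f z)).
  apply: bndB; last by apply: bndM => //; exact: bnd_cst.
  by apply: bndB; [apply: (@bnd_comp _ a f) => //; exact: C2_cont|exact: bnd_cst].
have mD2 : measurable_fun setT (fun q : R * R => Delta a (f q.2) (f q.1)).
  apply: measurable_Delta => //.
  - exact: (measurableT_comp mf (@measurable_snd _ _ R R)).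
  - exact: (measurableT_comp mf (@measurable_fst _ _ R R)).
have mDz z : measurable_fun setT (fun y => Delta a (f y) (f z)).
  exact: measurable_Delta.
have key z : ((S * breg a m (f z))%:E <=
    2%:E * \int[mu]_(y in `[u, w]) (Delta a (f y) (f z))%:E)%E.
  (* [g] stands for one of the two parts of [f - m]. Wherever [g y > 0] the value [m] lies between
     [f y] and [f z], so the pointwise hypothesis will come from [Delta_lower] or [Delta_lower']. *)
  have aux (g : R -> R) : measurable_fun setT g -> bnd g -> (forall y, 0 <= g y) ->
      S = 2 * \int[mu]_(y in `[u, w]) g y ->
      (forall y, g y * breg a m (f z) <= Delta a (f y) (f z)) ->
      ((S * breg a m (f z))%:E <= 2%:E * \int[mu]_(y in `[u, w]) (Delta a (f y) (f z))%:E)%E.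
    move=> mg bg g0 -> gD.
    rewrite -mulrA EFinM lee_pmul2l//.
    have ig := integrable_itv u w mg bg.
    rewrite -RintegralZr// /Rintegral fineK; last first.
      apply: integrable_fin_num => //.
      apply: (@integrable_itv _ _ _ (fun y => g y * breg a m (f z))).
        exact: measurable_funM.
      by apply: bndM => //; exact: bnd_cst.
    apply: ge0_le_integral => //.
    - by move=> y _; rewrite lee_fin mulr_ge0// breg_ge0.
    - by apply/measurable_EFinP; apply: measurable_funTS; exact: measurable_funM.
    - by apply/measurable_EFinP; apply: measurable_funTS; exact: mDz.
    - by move=> y _; rewrite lee_fin.
  have [fzm|fzm] := leP m (f z).
  - apply: (aux fm) => //; first by move=> y; rewrite /fm le_max lexx orbT.
    move=> y; rewrite /fm; case: (leP (m - f y) 0) => h.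
      by rewrite mul0r Delta_ge0.
    by apply: Delta_lower => //; lra.
  - apply: (aux fp) => //; first by move=> y; rewrite /fp le_max lexx orbT.
    move=> y; rewrite /fp; case: (leP (f y - m) 0) => h.
      by rewrite mul0r Delta_ge0.
    by rewrite DeltaC; apply: Delta_lower' => //; lra.
have mI : measurable_fun setT (fun z => \int[mu]_(y in `[u, w]) (Delta a (f y) (f z))%:E)%E.
  rewrite (_ : (fun z => _) = fun z => (\int[mu]_y
     ((Delta a (f y) (f z) * \1_(`[u, w]%classic) y)%:E))%E); last first.
    apply/funext => z; rewrite integral_mkcond; apply: eq_integral => y _.
    by rewrite patchE indicE; case: ifPn => _; rewrite ?mulr1 ?mulr0.
  apply: (@measurable_fun_fubini_tonelli_F _ _ _ _ _ mu
    (fun q : R * R => (Delta a (f q.2) (f q.1) * \1_(`[u, w]%classic) q.2)%:E)) => //.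
  - apply/measurable_EFinP; apply: measurable_funM => //.
    apply: (measurableT_comp _ (@measurable_snd _ _ R R)); exact: measurable_indic.
  - by move=> q; rewrite lee_fin mulr_ge0// Delta_ge0.
rewrite -RintegralZl//; last exact: integrable_itv.
rewrite /Rintegral fineK; last first.
  apply: integrable_fin_num => //.
  apply: (@integrable_itv _ _ _ (fun z => S * breg a m (f z))).
    exact: measurable_funM.
  by apply: bndM => //; exact: bnd_cst.
rewrite -ge0_integralZl//; last 2 first.
- exact: measurable_funTS.
- by move=> z _; apply: integral_ge0 => y _; rewrite lee_fin Delta_ge0.
have S0 : 0 <= S by apply: Rintegral_ge0.
apply: ge0_le_integral => //.
- by move=> z _; rewrite lee_fin mulr_ge0// breg_ge0.
- by apply/measurable_EFinP; apply: measurable_funTS; exact: measurable_funM.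
- by apply: measurable_funTS; exact: measurable_funeM.
Qed.

(** Both factors are measured from one [m]: subtracting [m] does not change the convolution with
    [dker e], and [jensen_gap_le] holds for any base point. The constant is [C / e ^ 2] times
    [C / e] times the 2 of [moment_breg_le]. *)
Lemma commutator_bound (C : R) (f : R -> R) (e x : R) : 0 < C ->
  (forall d x, 0 < d -> `|ker d x| <= C / d /\ `|dker d x| <= C / d ^+ 2) ->
  0 < e -> measurable_fun setT f -> bnd f ->
  ((`|convol (dker e) f x| * `|convol (ker e) (a \o f) x - a (convol (ker e) f x)|)%:E <=
   (2 * C ^+ 2 / e ^+ 3)%:E * \int[mu]_(z in `[(x - e)%R, (x + e)%R])
     \int[mu]_(y in `[(x - e)%R, (x + e)%R]) (Delta a (f y) (f z))%:E)%E.
Proof.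
move=> C0 hC e0 mf bf.
have uw : x - e < x + e by lra.
have [m hm] := moment_breg_le uw mf bf.
have mbr : measurable_fun setT (fun z => breg a m (f z)).
  have ma := continuous_measurable_fun (C2_cont C2a).
  apply: measurable_funB; first by apply: measurable_funB => //; exact: measurableT_comp.
  by apply: measurable_funM => //; exact: measurable_funB.
have bbr : bnd (fun z => breg a m (f z)).
  apply: bndB; last by apply: bndM; [exact: bnd_cst|apply: bndB => //; exact: bnd_cst].
  by apply: bndB; [apply: (@bnd_comp _ a f) => //; exact: C2_cont|exact: bnd_cst].
have h1 : `|convol (dker e) f x| <= C / e ^+ 2 * \int[mu]_(y in `[(x - e), (x + e)]) `|f y - m|.
  rewrite -(conv_dker_sub m x e0 mf bf); apply: le_conv_itv => //.
  - by rewrite divr_ge0 ?exprn_ge0// ltW.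
  - exact: measurable_dker.
  - by move=> y; exact: (hC e y e0).2.
  - exact: nz_dker.
  - exact: measurable_funB.
  - by apply: bndB => //; exact: bnd_cst.
have h2 : `|convol (ker e) (a \o f) x - a (convol (ker e) f x)| <=
    C / e * \int[mu]_(y in `[(x - e), (x + e)]) breg a m (f y).
  rewrite ger0_norm ?jensen_gap_ge0//.
  apply: (le_trans (jensen_gap_le m x e0 mf bf)); apply: (le_trans (ler_norm _)).
  rewrite (_ : \int[mu]_(y in `[(x - e), (x + e)]) breg a m (f y) =
    \int[mu]_(y in `[(x - e), (x + e)]) `|breg a m (f y)|); last first.
    by apply: eq_Rintegral => y _; rewrite ger0_norm// breg_ge0.
  apply: le_conv_itv => //.
  - by rewrite divr_ge0// ltW.
  - exact: measurable_ker.
  - by move=> y; exact: (hC e y e0).1.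
  - exact: nz_ker.
apply: (@le_trans _ _ ((C ^+ 2 / e ^+ 3)%:E * (2%:E * \int[mu]_(z in `[(x - e)%R, (x + e)%R])
     \int[mu]_(y in `[(x - e)%R, (x + e)%R]) (Delta a (f y) (f z))%:E))%E); last first.
  rewrite muleA -EFinM le_eqVlt; apply/orP; left; apply/eqP; congr (_%:E * _)%E; ring.
apply: le_trans (lee_wpmul2l _ hm); last by rewrite lee_fin divr_ge0 ?exprn_ge0// ltW.
rewrite -EFinM lee_fin; apply: (le_trans (ler_pM _ _ h1 h2)) => //.
rewrite le_eqVlt; apply/orP; left; apply/eqP; field; rewrite gt_eqF//.
Qed.

End commutator.

(** * Chain rule in time for a bounded measurable function *)

Section chain_rule.
Context {R : realType}.
Notation mu := (@lebesgue_measure R).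

Lemma cvg_harmonicR (c : R) : (c * harmonic n : R) @[n --> \oo] --> 0.
Proof. by rewrite -(mulr0 c); apply: cvgMr; exact: cvg_harmonic. Qed.

Lemma cvg_seq_cont (g : R -> R) (u_ : nat -> R) (l : R) : continuous g ->
  u_ n @[n --> \oo] --> l -> g (u_ n) @[n --> \oo] --> g l.
Proof. by move=> cg ul; exact: (cvg_comp _ _ ul (cg l)). Qed.

(** The hypothesis says weakly that v' = -g. The mollification [w n] satisfies this classically
    where [psi] lives, so the integral of the derivative of [psi * eta (w n)] is 0; almost
    everywhere convergence and uniform bounds carry the identity to [v]. *)
Lemma weak_chain_rule (T al be : R) (v g psi psi' eta eta' : R -> R) :
  0 < al -> be < T ->
  measurable_fun setT v -> bnd v -> measurable_fun setT g -> bnd g ->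
  (forall d t, 0 < d -> d < t -> t < T - d -> convol (dker d) v t = - convol (ker d) g t) ->
  (forall t : R, is_derive t 1 psi (psi' t)) -> continuous psi' ->
  (forall t, t < al \/ be < t -> psi t = 0) -> (forall t, t < al \/ be < t -> psi' t = 0) ->
  (forall s : R, is_derive s 1 eta (eta' s)) -> continuous eta' ->
  \int[mu]_t (psi' t * eta (v t)) = \int[mu]_t (psi t * (eta' (v t) * g t)).
Proof.
move=> al0 beT mv bv mg bg vg dpsi cpsi' psi0 psi'0 deta ceta'.
have cont (h h' : R -> R) : (forall t : R, is_derive t 1 h (h' t)) -> continuous h.
  by move=> dh; apply: derivable_continuous => t; have [] := dh t.
have cpsi := cont _ _ dpsi; have ceta := cont _ _ deta.
pose r := `|al| + `|be|.
have outr t : r < `|t| -> t < al \/ be < t.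
  rewrite /r => h; have [ta|ta] := ltP t al; [by left|right].
  move: h; have ha := ler_norm be; have hb := normr_ge0 al; rewrite (gtr0_norm al0).
  rewrite (@ger0_norm _ t); last lra.
  by lra.
have bounded (h : R -> R) : continuous h -> (forall t, t < al \/ be < t -> h t = 0) -> bnd h.
  move=> ch h0.
  (* Clamping [t] to a segment makes [h] bounded by compactness. The upper end is [maxr al be] so
     that the segment is nonempty even when [be < al], in which case [h] is identically 0. *)
  have [M hM] : bnd (h \o (fun t => maxr al (minr t (maxr al be)))).
    apply: bnd_comp => //; exists r => t.
    have hr : forall s, al <= s <= maxr al be -> `|s| <= r.
      move=> s /andP[s1]; rewrite le_max /r => /orP[s2|s2].
        rewrite ger0_norm; last lra. by have := ler_norm al; have := normr_ge0 be; lra.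
      rewrite ger0_norm; last lra. by have := ler_norm be; have := normr_ge0 al; lra.
    apply: hr; rewrite le_max lexx/= ge_max le_max lexx/= ge_min lexx orbT//.
  exists M => t; have [ta|ta] := ltP t al.
    by rewrite h0; [rewrite normr0 (le_trans _ (hM 0))|left].
  have [tb|tb] := ltP be t.
    by rewrite h0; [rewrite normr0 (le_trans _ (hM 0))|right].
  have := hM t; rewrite /= (min_idPl _); last by rewrite le_max tb orbT.
  by rewrite (max_idPr _).
have bpsi := bounded _ cpsi psi0; have bpsi' := bounded _ cpsi' psi'0.
(* Staying below both [al] and [T - be] keeps every time of [[al, be]] at distance more than [d_ n]
   from 0 and [T], where the mollified equation is available. *)
pose d_ (n : nat) : R := minr al (T - be) / 2 * harmonic n.
have m0 : 0 < minr al (T - be) by rewrite lt_min al0 subr_gt0.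
have d0 n : 0 < d_ n by rewrite mulr_gt0 ?divr_gt0// harmonic_gt0.
have dle n : d_ n < minr al (T - be).
  apply: (@le_lt_trans _ _ (minr al (T - be) / 2)); last lra.
  rewrite /d_ ler_piMr//; first by rewrite divr_ge0// ltW.
  by rewrite /harmonic/= invf_le1// ler1n.
have dcv : d_ n @[n --> \oo] --> 0 by exact: cvg_harmonicR.
pose w n := convol (ker (d_ n)) v; pose gw n := convol (ker (d_ n)) g.
have [Mv Mv0 vM] := bndP bv; have [Mg Mg0 gM] := bndP bg.
have wM n t : `|w n t| <= Mv.
  rewrite ler_norml; apply/andP; split.
  - by apply: conv_ker_ge => // y; have := vM y; rewrite ler_norml => /andP[].
  - by apply: conv_ker_le => // y; have := vM y; rewrite ler_norml => /andP[].
have gwM n t : `|gw n t| <= Mg.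
  rewrite ler_norml; apply/andP; split.
  - by apply: conv_ker_ge => // y; have := gM y; rewrite ler_norml => /andP[].
  - by apply: conv_ker_le => // y; have := gM y; rewrite ler_norml => /andP[].
have cw n : continuous (w n) by exact: conv_ker_cont.
have cgw n : continuous (gw n) by exact: conv_ker_cont.
have cw' n : continuous (convol (dker (d_ n)) v).
  exact: conv_dker_cont.
have dw n (t : R) : is_derive t 1 (w n) (convol (dker (d_ n)) v t) by exact: is_derive_conv_ker.
have deq n : \int[mu]_t (psi' t * eta (w n t)) = \int[mu]_t (psi t * (eta' (w n t) * gw n t)).
  have dF (t : R) : is_derive t 1 (fun t => psi t * eta (w n t))
      (psi' t * eta (w n t) - psi t * (eta' (w n t) * gw n t)).
    have he : is_derive t 1 (fun t => eta (w n t)) (eta' (w n t) * convol (dker (d_ n)) v t).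
      exact: (@is_derive1_comp _ eta (w n)).
    apply: is_derive_eq; rewrite /GRing.scale/=.
    have [ta|ta] := ltP t al; first by rewrite psi0 ?psi'0 ?mul0r; [ring|left|left].
    have [tb|tb] := ltP be t; first by rewrite psi0 ?psi'0 ?mul0r; [ring|right|right].
    have := dle n; rewrite lt_min => /andP[h1 h2].
    rewrite vg//; [|lra|lra]; rewrite /gw; ring.
  have c1 : continuous (fun t => psi' t * eta (w n t)).
    move=> t; apply: cvgM; first exact: cpsi'.
    by apply: (@continuous_comp _ _ _ (w n) eta); [exact: cw|exact: ceta].
  have c2 : continuous (fun t => psi t * (eta' (w n t) * gw n t)).
    move=> t; apply: cvgM; first exact: cpsi.
    apply: cvgM; last exact: cgw.
    by apply: (@continuous_comp _ _ _ (w n) eta'); [exact: cw|exact: ceta'].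
  have z : \int[mu]_t (psi' t * eta (w n t) - psi t * (eta' (w n t) * gw n t)) = 0.
    apply: (Rint_derive0 (r := r) dF).
    - by move=> t; apply: cvgB; [exact: c1|exact: c2].
    - by move=> t /outr h; rewrite psi0// mul0r.
    - by move=> t /outr h; rewrite psi0// psi'0// !mul0r subrr.
  apply/eqP; rewrite -subr_eq0 -RintegralB// ?z//.
  - apply: (@integrable_nz _ r); first exact: continuous_measurable_fun.
      by apply: bndM => //; apply: (bnd_comp ceta); exists Mv => t; exact: wM.
    by move=> t /outr h; rewrite psi'0// mul0r.
  - apply: (@integrable_nz _ r); first exact: continuous_measurable_fun.
      apply: bndM => //; apply: bndM; last by exists Mg => t; exact: gwM.
      by apply: (bnd_comp ceta'); exists Mv => t; exact: wM.
    by move=> t /outr h; rewrite psi0// mul0r.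
have mpsi := continuous_measurable_fun cpsi; have mpsi' := continuous_measurable_fun cpsi'.
have meta := continuous_measurable_fun ceta; have meta' := continuous_measurable_fun ceta'.
have mw n := continuous_measurable_fun (@cw n); have mgw n := continuous_measurable_fun (@cgw n).
have wcv := conv_ker_cvg d0 dcv mv bv; have gcv := conv_ker_cvg d0 dcv mg bg.
have [Kp _ hKp] := bndP bpsi; have [Kp' _ hKp'] := bndP bpsi'.
(* Treating [(n, t)] as a single variable yields a bound uniform in [n], as dominated convergence
   requires. *)
have [Ke _ hKe] := bndP (bnd_comp ceta (ex_intro (fun M => forall q : nat * R, `|w q.1 q.2| <= M) Mv (fun q => wM q.1 q.2))).
have [Ke' _ hKe'] := bndP (bnd_comp ceta' (ex_intro (fun M => forall q : nat * R, `|w q.1 q.2| <= M) Mv (fun q => wM q.1 q.2))).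
have l1 : \int[mu]_t (psi' t * eta (w n t)) @[n --> \oo] --> \int[mu]_t (psi' t * eta (v t)).
  apply: (@Rdct _ r (Kp' * Ke)).
  - by move=> n; apply: measurable_funM => //; exact: (measurableT_comp meta).
  - by apply: measurable_funM => //; exact: (measurableT_comp meta).
  - by move=> n t; rewrite normrM ler_pM//; exact: (hKe (n, t)).
  - by move=> n t /outr h; rewrite psi'0// mul0r.
  - apply: aeS wcv => t ht; apply: cvgMr.
    exact: (cvg_seq_cont ceta ht).
have l2 : \int[mu]_t (psi t * (eta' (w n t) * gw n t)) @[n --> \oo] -->
    \int[mu]_t (psi t * (eta' (v t) * g t)).
  apply: (@Rdct _ r (Kp * (Ke' * Mg))).
  - move=> n; apply: measurable_funM => //; apply: measurable_funM => //.
    exact: (measurableT_comp meta').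
  - by apply: measurable_funM => //; apply: measurable_funM => //; exact: (measurableT_comp meta').
  - move=> n t; rewrite normrM ler_pM// normrM ler_pM//; exact: (hKe' (n, t)).
  - by move=> n t /outr h; rewrite psi0// mul0r.
  - apply: aeS (aeI wcv gcv) => t [ht1 ht2]; apply: cvgMr; apply: cvgM => //.
    exact: (cvg_seq_cont ceta' ht1).
have E : (fun n => \int[mu]_t (psi' t * eta (w n t))) =
    (fun n => \int[mu]_t (psi t * (eta' (w n t) * gw n t))).
  by apply/funext => n; exact: deq.
by rewrite -(cvg_lim _ l1)// E (cvg_lim _ l2).
Qed.

End chain_rule.

(** * Test functions on the plane: slices, supports, thickening *)

Section test_functions.
Context {R : realType}.
Notation mu := (@lebesgue_measure R).
Notation lam := (@lam2 R).

Lemma smooth2_cont (phi : R * R -> R) : smooth2 phi ->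
  [/\ continuous phi, continuous (pt phi) & continuous (px phi)].
Proof.
move=> sphi; split.
- by have [] := sphi [::].
- by have [] := sphi [:: true].
- by have [] := sphi [:: false].
Qed.

Lemma smooth2_is_derive_t (phi : R * R -> R) (t x : R) : smooth2 phi ->
  is_derive t 1 (fun s => phi (s, x)) (pt phi (t, x)).
Proof.
move=> /(_ [::])[_ /(_ (t, x))[h _]]; apply: DeriveDef; first exact: h.
by rewrite /pt/= derive1E.
Qed.

Lemma smooth2_is_derive_x (phi : R * R -> R) (t x : R) : smooth2 phi ->
  is_derive x 1 (fun y => phi (t, y)) (px phi (t, x)).
Proof.
move=> /(_ [::])[_ /(_ (t, x))[_ h]]; apply: DeriveDef; first exact: h.
by rewrite /px/= derive1E.
Qed.

Lemma continuous_at_pair (X : topologicalType) (f g : X -> R) (x : X) :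
  {for x, continuous f} -> {for x, continuous g} -> {for x, continuous (fun z => (f z, g z))}.
Proof.
move=> cf cg A [[B C] /= [fB gC] BC].
apply: (@filterS _ (nbhs x) _ ((f @^-1` B) `&` (g @^-1` C))).
  by move=> z [? ?]; exact: BC.
by apply: filterI; [exact: cf|exact: cg].
Qed.

Lemma continuous_slice1 (f : R * R -> R) (t : R) : continuous f -> continuous (fun x => f (t, x)).
Proof.
move=> cf x; apply: (@continuous_comp _ _ _ (fun x => (t, x)) f); last exact: cf.
by apply: continuous_at_pair; [exact: cvg_cst|exact: cvg_id].
Qed.

Lemma continuous_slice2 (f : R * R -> R) (x : R) : continuous f -> continuous (fun t => f (t, x)).
Proof.
move=> cf t; apply: (@continuous_comp _ _ _ (fun t => (t, x)) f); last exact: cf.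
by apply: continuous_at_pair; [exact: cvg_id|exact: cvg_cst].
Qed.

Lemma derive_out (f : R -> R) (A : set R) (x : R) : open A -> A x -> (forall y, A y -> f y = 0) ->
  derive1 f x = 0.
Proof.
move=> oA Ax f0; rewrite derive1E.
have h : is_derive x 1 f 0.
  have d0 : is_derive x 1 (cst 0 : R -> R) 0 by exact: is_derive_cst.
  apply: near_eq_is_derive d0.
  have : nbhs x A by apply: open_nbhs_nbhs; split.
  by apply: filterS => y /f0.
by rewrite derive_val.
Qed.

Lemma pt_px_out (phi : R * R -> R) (K : set (R * R)) p : compact K ->
  (forall p, ~ K p -> phi p = 0) -> ~ K p -> pt phi p = 0 /\ px phi p = 0.
Proof.
move=> cK phi0 nKp.
have oC : open (~` K).
  by apply: closed_openC; apply: compact_closed.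
split.
- apply: (@derive_out _ [set s | (~` K) (s, p.2)]).
  + apply: (@open_comp _ _ (fun s => (s, p.2)) (~` K)) => // s _.
    by apply: (@continuous_at_pair _ (fun s : R => s) (fun=> p.2)); [exact: cvg_id|exact: cvg_cst].
  + by case: p nKp.
  + by move=> s /= /phi0.
- apply: (@derive_out _ [set s | (~` K) (p.1, s)]).
  + apply: (@open_comp _ _ (fun s => (p.1, s)) (~` K)) => // s _.
    by apply: (@continuous_at_pair _ (fun=> p.1) (fun s : R => s)); [exact: cvg_cst|exact: cvg_id].
  + by case: p nKp.
  + by move=> s /= /phi0.
Qed.

Lemma compact_plane_bounded (K : set (R * R)) : compact K ->
  exists2 r, 0 < r & forall p, K p -> `|p.1| <= r /\ `|p.2| <= r.
Proof.
move=> cK.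
have c1 : compact (fst @` K).
  apply: continuous_compact cK; apply: continuous_subspaceT => p; exact: cvg_fst.
have c2 : compact (snd @` K).
  apply: continuous_compact cK; apply: continuous_subspaceT => p; exact: cvg_snd.
have [A [_ KA]] := compact_bounded c1; have [B [_ KB]] := compact_bounded c2.
exists (`|A| + `|B| + 1); first by rewrite ltr_pwDr// addr_ge0.
move=> p Kp; split.
- by apply: (KA (`|A| + `|B| + 1)); [have := ler_norm A; have := normr_ge0 B; lra|exists p].
- by apply: (KB (`|A| + `|B| + 1)); [have := ler_norm B; have := normr_ge0 A; lra|exists p].
Qed.

(** A uniform margin between a compact set and the complement of an open neighbourhood, in each
    coordinate. It later keeps the support away from the times 0 and T and its x-translates inside
    U. *)
Lemma compact_thicken (K W : set (R * R)) : compact K -> open W -> K `<=` W ->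
  exists2 e, 0 < e & forall p s y, K p -> `|s| < e -> `|y| < e -> W (p.1 + s, p.2 + y).
Proof.
move=> cK oW KW.
move/compact_near_coveringP : cK => /(_ (R * R)%type (nbhs ((0, 0) : R * R))
  (fun q p => W (p.1 + q.1, p.2 + q.2)) _).
case=> [p Kp|[A B] /= [A0 B0] hAB]; last first.
  move/nbhs_ballP : A0 => [e1 /= e10 h1]; move/nbhs_ballP : B0 => [e2 /= e20 h2].
  exists (minr e1 e2); first by rewrite lt_min e10.
  move=> p s y Kp; rewrite !lt_min => /andP[s1 _] /andP[_ y2].
  apply: (hAB (s, y)) => //; split; [apply: h1|apply: h2]; by rewrite /ball/= sub0r normrN.
have cf : continuous (fun z : (R * R) * (R * R) => (z.1.1 + z.2.1, z.1.2 + z.2.2)).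
  move=> z; apply: (@continuous_at_pair _ (fun z : (R * R) * (R * R) => z.1.1 + z.2.1)
    (fun z => z.1.2 + z.2.2)); apply: cvgD.
  - by apply: (@continuous_comp _ _ _ fst fst); exact: cvg_fst.
  - by apply: (@continuous_comp _ _ _ snd fst); [exact: cvg_snd|exact: cvg_fst].
  - by apply: (@continuous_comp _ _ _ fst snd); [exact: cvg_fst|exact: cvg_snd].
  - by apply: (@continuous_comp _ _ _ snd snd); exact: cvg_snd.
have nW : nbhs (p.1 + 0, p.2 + 0) W.
  by apply: open_nbhs_nbhs; split => //; rewrite !addr0 -surjective_pairing; exact: KW.
have := cf (p, (0, 0)) W nW.
by move=> [[A B] /= [pA B0] hAB]; exists (A, B) => // -[x y] [/= Ax By]; apply: (hAB (x, y)).
Qed.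

End test_functions.

(** * Mollification in x and the regularised equation *)

Section regularised_identity.
Context {R : realType}.
Notation mu := (@lebesgue_measure R).
Notation lam := (@lam2 R).
Variables (T : R) (a : R -> R) (ut : R * R -> R) (K : set (R * R)) (m M r : R).
Hypotheses (C2a : C2 a) (mut : measurable_fun setT ut) (utb : forall p, m <= ut p <= M).
Hypothesis weak_ut : forall psi, test_on (strip T) psi ->
  \int[lam]_p (ut p * pt psi p + a (ut p) * px psi p) = 0.
Hypotheses (cK : compact K) (Kr : forall p, K p -> `|p.1| <= r /\ `|p.2| <= r).

(** Only x is smoothed. With [g] equal to [id] and to [a] this gives v and b of the overview, and
    [dmol] gives their x-derivatives. *)
Definition mol (e : R) (g : R -> R) (p : R * R) : R :=
  convol (ker e) (fun y => g (ut (p.1, y))) p.2.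
Definition dmol (e : R) (g : R -> R) (p : R * R) : R :=
  convol (dker e) (fun y => g (ut (p.1, y))) p.2.

Lemma bnd_ut : bnd ut.
Proof.
exists (`|m| + `|M|) => p; have /andP[h1 h2] := utb p.
rewrite ler_norml; apply/andP; split.
- by have := ler_norm (- m); rewrite normrN; have := normr_ge0 M; lra.
- by have := ler_norm M; have := normr_ge0 m; lra.
Qed.

Lemma bnd_slice (f : R * R -> R) t : bnd f -> bnd (fun y => f (t, y)).
Proof. by move=> [B fB]; exists B. Qed.

Lemma measurable_ut_slice (g : R -> R) t : continuous g ->
  measurable_fun setT (fun y => g (ut (t, y))).
Proof.
move=> cg; apply: (measurableT_comp (continuous_measurable_fun cg)).
exact: measurable_slice1.
Qed.

Lemma bnd_ut_slice (g : R -> R) t : continuous g -> bnd (fun y => g (ut (t, y))).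
Proof. by move=> cg; apply: (bnd_comp cg); apply: (@bnd_slice ut); exact: bnd_ut. Qed.

Lemma measurable_gut (g : R -> R) : continuous g -> measurable_fun setT (g \o ut).
Proof. by move=> cg; exact: (measurableT_comp (continuous_measurable_fun cg)). Qed.

Lemma measurable_mol e g : continuous g -> measurable_fun setT (mol e g).
Proof.
move=> cg; apply: (@measurable_conv2 _ (ker e) (g \o ut)); first exact: measurable_ker.
exact: measurable_gut.
Qed.

Lemma measurable_dmol e g : continuous g -> measurable_fun setT (dmol e g).
Proof.
move=> cg; apply: (@measurable_conv2 _ (dker e) (g \o ut)); first exact: measurable_dker.
exact: measurable_gut.
Qed.

Lemma bnd_conv2 (k g : R -> R) d : 0 < d -> measurable_fun setT k -> bnd k -> nz d k ->
  continuous g -> bnd (fun p => convol k (fun y => g (ut (p.1, y))) p.2).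
Proof.
move=> d0 mk /bndP[C C0 kC] dk cg.
have /bndP[G G0 hG] : bnd (g \o ut) by apply: bnd_comp => //; exact: bnd_ut.
exists (C * G * (2 * d)) => p; apply: conv_bound => //; try exact: ltW.
- exact: measurable_ut_slice.
- by move=> y; exact: (hG (p.1, y)).
Qed.

Lemma bnd_mol e g : 0 < e -> continuous g -> bnd (mol e g).
Proof.
by move=> e0; apply: bnd_conv2; [exact: e0|exact: measurable_ker|exact: bnd_ker|exact: nz_ker].
Qed.

Lemma bnd_dmol e g : 0 < e -> continuous g -> bnd (dmol e g).
Proof.
by move=> e0; apply: bnd_conv2; [exact: e0|exact: measurable_dker|exact: bnd_dker|exact: nz_dker].
Qed.

(** Averages stay in the interval, so [eta''] is only ever evaluated where the supremum over [I]
    controls it. *)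
Lemma mol_itv e p : 0 < e -> m <= mol e id p <= M.
Proof.
move=> e0; have cid : continuous (id : R -> R) by move=> ?; exact: cvg_id.
apply/andP; split.
- apply: conv_ker_ge => //; [exact: (@measurable_ut_slice id)|exact: (@bnd_ut_slice id)|].
  by move=> y; have /andP[] := utb (p.1, y).
- apply: conv_ker_le => //; [exact: (@measurable_ut_slice id)|exact: (@bnd_ut_slice id)|].
  by move=> y; have /andP[] := utb (p.1, y).
Qed.

Lemma bnd_cs (f : R * R -> R) : continuous f -> (forall p, ~ K p -> f p = 0) -> bnd f.
Proof.
move=> cf f0.
have cfK : compact (f @` K).
  by apply: continuous_compact cK; exact: continuous_subspaceT.
have [A [_ KA]] := compact_bounded cfK.
exists (`|A| + 1) => p; have [Kp|nKp] := pselect (K p); last by rewrite f0// normr0.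
by apply: (KA (`|A| + 1)); [rewrite ltr_pwDr// ler_norm|exists p].
Qed.

Lemma cs_nz2 (f : R * R -> R) : (forall p, ~ K p -> f p = 0) -> nz2 r f.
Proof.
move=> f0 p h; apply: f0 => /Kr[h1 h2]; move: h.
by rewrite ltNge h1/= ltNge h2.
Qed.

(** The weak equation is tested against [kertest d e t0 x0]. By Fubini the product kernel splits,
    the inner integral in x being the mollification at scale [e] and the outer one a convolution in
    time; the identity holds for every [x0]. *)
Lemma mollified_equation e d t0 x0 : 0 < e -> 0 < d -> d < t0 -> t0 < T - d ->
  convol (dker d) (fun t => mol e id (t, x0)) t0 = - convol (ker d) (fun t => dmol e a (t, x0)) t0.
Proof.
move=> e0 d0 dt tT; have cid : continuous (id : R -> R) by move=> ?; exact: cvg_id.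
have ca := C2_cont C2a.
have := weak_ut (test_on_kertest x0 d0 e0 dt tT).
under eq_Rintegral do rewrite pt_kertest// px_kertest//.
pose F1 (p : R * R) := dker d (t0 - p.1) * ker e (x0 - p.2) * ut p.
pose F2 (p : R * R) := ker d (t0 - p.1) * dker e (x0 - p.2) * a (ut p).
pose s := `|t0| + d + `|x0| + e.
have mfst (k : R -> R) (c : R) : measurable_fun setT k -> measurable_fun setT (fun p : R * R => k (c - p.1)).
  by move=> mk; apply: (measurableT_comp mk); apply: measurable_funB.
have msnd (k : R -> R) (c : R) : measurable_fun setT k -> measurable_fun setT (fun p : R * R => k (c - p.2)).
  by move=> mk; apply: (measurableT_comp mk); apply: measurable_funB.
have bpr (k : R -> R) (h : R * R -> R) : bnd k -> bnd (fun p => k (h p)).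
  by move=> [B kB]; exists B.
have nF (k l : R -> R) (h : R * R -> R) : nz d k -> nz e l ->
    nz2 s (fun p => k (t0 - p.1) * l (x0 - p.2) * h p).
  move=> dk el p /orP[hp|hp].
  - rewrite dk ?mul0r//; have := lerB_dist p.1 t0; rewrite distrC /s in hp *.
    by have := normr_ge0 x0; lra.
  - rewrite [l _]el ?mulr0 ?mul0r//; have := lerB_dist p.2 x0; rewrite distrC /s in hp *.
    by have := normr_ge0 t0; lra.
have mF1 : measurable_fun setT F1.
  apply: measurable_funM => //; apply: measurable_funM.
  - by apply: mfst; exact: measurable_dker.
  - by apply: msnd; exact: measurable_ker.
have mF2 : measurable_fun setT F2.
  apply: measurable_funM; last exact: measurable_gut.
  apply: measurable_funM.
  - by apply: mfst; exact: measurable_ker.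
  - by apply: msnd; exact: measurable_dker.
have bF1 : bnd F1.
  apply: bndM; last exact: bnd_ut.
  by apply: bndM; apply: bpr; [exact: bnd_dker|exact: bnd_ker].
have bF2 : bnd F2.
  apply: bndM; last by apply: bnd_comp => //; exact: bnd_ut.
  by apply: bndM; apply: bpr; [exact: bnd_ker|exact: bnd_dker].
have nF1 : nz2 s F1 by apply: nF; [exact: nz_dker|exact: nz_ker].
have nF2 : nz2 s F2 by apply: nF; [exact: nz_ker|exact: nz_dker].
have -> : \int[lam]_p (ut p * - (dker d (t0 - p.1) * ker e (x0 - p.2)) +
    a (ut p) * - (ker d (t0 - p.1) * dker e (x0 - p.2))) =
    - (\int[lam]_p F1 p + \int[lam]_p F2 p).
  rewrite -RintegralD//; [|exact: integrable_nz2 nF1|exact: integrable_nz2 nF2].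
  rewrite -mulN1r -RintegralZl//; last first.
    have := integrableD measurableT (integrable_nz2 mF1 bF1 nF1) (integrable_nz2 mF2 bF2 nF2).
    by apply: eq_integrable => // p _.
  by apply: eq_Rintegral => p _; rewrite /F1 /F2; ring.
move/eqP; rewrite oppr_eq0 addr_eq0 => /eqP.
rewrite (Rfubini1 mF1 bF1 nF1) (Rfubini1 mF2 bF2 nF2) => h.
have E1 t : \int[mu]_x F1 (t, x) = dker d (t0 - t) * mol e id (t, x0).
  rewrite /mol /convol -RintegralZl//; first by apply: eq_Rintegral => x _; rewrite /F1/= mulrA.
  by apply: (@integrable_ker _ (fun y => ut (t, y))) => //; [exact: (@measurable_ut_slice id)|exact: (@bnd_ut_slice id)].
have E2 t : \int[mu]_x F2 (t, x) = ker d (t0 - t) * dmol e a (t, x0).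
  rewrite /dmol /convol -RintegralZl//; first by apply: eq_Rintegral => x _; rewrite /F2/= mulrA.
  by apply: (@integrable_dker _ (fun y => a (ut (t, y)))) => //; [exact: measurable_ut_slice|exact: bnd_ut_slice].
move: h; under eq_Rintegral do rewrite E1.
by under [in RHS]eq_Rintegral do rewrite E2.
Qed.

End regularised_identity.

(** * The entropy identity at scale e and its limit *)

Section entropy_limit.
Context {R : realType}.
Notation mu := (@lebesgue_measure R).
Notation lam := (@lam2 R).
Variables (T : R) (a eta q : R -> R) (ut phi : R * R -> R) (K : set (R * R)) (m M r al be : R).
Hypotheses (C2a : C2 a) (C2eta : C2 eta) (fluxq : is_flux a eta q).
Hypotheses (mut : measurable_fun setT ut) (utb : forall p, m <= ut p <= M).
Hypothesis weak_ut : forall psi, test_on (strip T) psi ->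
  \int[lam]_p (ut p * pt psi p + a (ut p) * px psi p) = 0.
Hypotheses (sphi : smooth2 phi) (cK : compact K) (phi0 : forall p, ~ K p -> phi p = 0).
Hypotheses (Kr : forall p, K p -> `|p.1| <= r /\ `|p.2| <= r).
Hypotheses (al0 : 0 < al) (beT : be < T) (Kal : forall p, K p -> al <= p.1 <= be).

Let ca : continuous a. Proof. exact: C2_cont. Qed.
Let ca1 : continuous (derive1 a). Proof. exact: C2_cont1. Qed.
Let ceta : continuous eta. Proof. exact: C2_cont. Qed.
Let ceta1 : continuous (derive1 eta). Proof. exact: C2_cont1. Qed.
Let ceta2 : continuous (derive1n 2 eta). Proof. by have [_ []] := C2eta. Qed.
Let cq : continuous q. Proof. by have [dq _] := fluxq; exact: derivable_continuous. Qed.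
Let cid : continuous (id : R -> R). Proof. by move=> ?; exact: cvg_id. Qed.
Let cphi : continuous phi. Proof. by have [] := smooth2_cont sphi. Qed.
Let cpt : continuous (pt phi). Proof. by have [] := smooth2_cont sphi. Qed.
Let cpx : continuous (px phi). Proof. by have [] := smooth2_cont sphi. Qed.
Let pt0 p : ~ K p -> pt phi p = 0. Proof. by move=> /(pt_px_out cK phi0)[]. Qed.
Let px0 p : ~ K p -> px phi p = 0. Proof. by move=> /(pt_px_out cK phi0)[]. Qed.
Let bphi : bnd phi. Proof. exact: (bnd_cs cK). Qed.
Let bpt : bnd (pt phi). Proof. exact: (bnd_cs cK). Qed.
Let bpx : bnd (px phi). Proof. exact: (bnd_cs cK). Qed.
Let mphi : measurable_fun setT phi. Proof. exact: continuous_measurable_plane. Qed.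
Let mpt : measurable_fun setT (pt phi). Proof. exact: continuous_measurable_plane. Qed.
Let mpx : measurable_fun setT (px phi). Proof. exact: continuous_measurable_plane. Qed.

Let deta (s : R) : is_derive s 1 eta (derive1 eta s). Proof. exact: C2_is_derive. Qed.
Let deta1 (s : R) : is_derive s 1 (derive1 eta) (derive1n 2 eta s). Proof. exact: C2_is_derive2. Qed.
Let da (s : R) : is_derive s 1 a (derive1 a s). Proof. exact: C2_is_derive. Qed.
Let dq (s : R) : is_derive s 1 q (derive1 eta s * derive1 a s).
Proof. by have [d e] := fluxq; apply: DeriveDef; rewrite // -derive1E e. Qed.

Let mcomp (g : R -> R) (f : R * R -> R) : continuous g -> measurable_fun setT f ->
  measurable_fun setT (fun p => g (f p)).
Proof. by move=> cg mf; exact: (measurableT_comp (continuous_measurable_fun cg)). Qed.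

Section fixed_scale.
Variable e : R.
Hypothesis e0 : 0 < e.
Let v := mol ut e id.
Let vx := dmol ut e id.
Let b := mol ut e a.
Let bx := dmol ut e a.
Let mv : measurable_fun setT v. Proof. exact: measurable_mol. Qed.
Let mvx : measurable_fun setT vx. Proof. exact: measurable_dmol. Qed.
Let mb : measurable_fun setT b. Proof. exact: measurable_mol. Qed.
Let mbx : measurable_fun setT bx. Proof. exact: measurable_dmol. Qed.
Let bv : bnd v. Proof. exact: bnd_mol. Qed.
Let bvx : bnd vx. Proof. exact: bnd_dmol. Qed.
Let bb : bnd b. Proof. exact: bnd_mol. Qed.
Let bbx : bnd bx. Proof. exact: bnd_dmol. Qed.

(** [f4] is the x-derivative of phi eta'(v) multiplied by b - a(v), and [f2 + f3 + f4] is the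
    x-derivative of phi (q(v) + eta'(v) (b - a(v))). *)
Let f1 p := pt phi p * eta (v p).
Let f2 p := px phi p * q (v p).
Let f3 p := phi p * (derive1 eta (v p) * bx p).
Let f4 p := (px phi p * derive1 eta (v p) + phi p * (derive1n 2 eta (v p) * vx p)) * (b p - a (v p)).

Let mf1 : measurable_fun setT f1.
Proof. by apply: measurable_funM => //; exact: mcomp. Qed.
Let mf2 : measurable_fun setT f2.
Proof. by apply: measurable_funM => //; exact: mcomp. Qed.
Let mf3 : measurable_fun setT f3.
Proof. by apply: measurable_funM => //; apply: measurable_funM => //; exact: mcomp. Qed.
Let mf4 : measurable_fun setT f4.
Proof.
apply: measurable_funM; last by apply: measurable_funB => //; exact: mcomp.
apply: measurable_funD; apply: measurable_funM => //; first exact: mcomp.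
by apply: measurable_funM => //; exact: mcomp.
Qed.
Let bf1 : bnd f1. Proof. by apply: bndM => //; exact: bnd_comp. Qed.
Let bf2 : bnd f2. Proof. by apply: bndM => //; exact: bnd_comp. Qed.
Let bf3 : bnd f3. Proof. by apply: bndM => //; apply: bndM => //; exact: (bnd_comp ceta1). Qed.
Let bf4 : bnd f4.
Proof.
apply: bndM; last by apply: bndB => //; exact: (bnd_comp ca).
apply: bndD; apply: bndM => //; first exact: (bnd_comp ceta1).
by apply: bndM => //; exact: (bnd_comp ceta2).
Qed.
Let z1 p : ~ K p -> f1 p = 0. Proof. by move=> nK; rewrite /f1 pt0// mul0r. Qed.
Let z2 p : ~ K p -> f2 p = 0. Proof. by move=> nK; rewrite /f2 px0// mul0r. Qed.
Let z3 p : ~ K p -> f3 p = 0. Proof. by move=> nK; rewrite /f3 phi0// mul0r. Qed.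
Let z4 p : ~ K p -> f4 p = 0.
Proof. by move=> nK; rewrite /f4 px0// phi0// !mul0r addr0 mul0r. Qed.

Let itg f : measurable_fun setT f -> bnd f -> (forall p, ~ K p -> f p = 0) ->
  lam.-integrable setT (EFin \o f).
Proof. by move=> mf bf zf; apply: (integrable_nz2 mf bf (cs_nz2 Kr zf)). Qed.

(** Fubini with [t] innermost: for each fixed [x] this is the weak chain rule, whose equation
    hypothesis is [mollified_equation]. *)
Lemma time_part : \int[lam]_p f1 p = \int[lam]_p f3 p.
Proof.
rewrite (Rfubini2 mf1 bf1 (cs_nz2 Kr z1)) (Rfubini2 mf3 bf3 (cs_nz2 Kr z3)).
apply: eq_Rintegral => x _.
have out t : t < al \/ be < t -> ~ K (t, x).
  by move=> h /Kal /= /andP[h1 h2]; case: h; rewrite ltNge ?h1 ?h2.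
apply: (@weak_chain_rule _ T al be (fun t => v (t, x)) (fun t => bx (t, x)) (fun t => phi (t, x))
  (fun t => pt phi (t, x)) eta (derive1 eta)) => //.
- exact: measurable_slice2.
- by case: bv => B h; exists B.
- exact: measurable_slice2.
- by case: bbx => B h; exists B.
- move=> d t d0 dt tT; exact: (mollified_equation C2a mut utb weak_ut).
- by move=> t; exact: smooth2_is_derive_t.
- exact: continuous_slice2.
- by move=> t /out /phi0.
- by move=> t /out /pt0.
Qed.

(** For each fixed [t] the integrand is an exact x-derivative of a compactly supported function; no
    equation is used here, the flux relation q' = eta' a' makes the terms match. *)
Lemma space_part : \int[lam]_p (f2 p + f3 p + f4 p) = 0.
Proof.
have m234 : measurable_fun setT (fun p => f2 p + f3 p + f4 p).
  by apply: measurable_funD => //; exact: measurable_funD.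
have b234 : bnd (fun p => f2 p + f3 p + f4 p) by apply: bndD => //; exact: bndD.
have z234 p : ~ K p -> f2 p + f3 p + f4 p = 0 by move=> nK; rewrite z2// z3// z4// !addr0.
rewrite (Rfubini1 m234 b234 (cs_nz2 Kr z234)).
suff key (t : R) : \int[mu]_x (f2 (t, x) + f3 (t, x) + f4 (t, x)) = 0.
  rewrite (_ : (fun t => _) = cst 0); first by rewrite Rintegral_cst// mul0r.
  by apply/funext => t; exact: key.
have dv (x : R) : is_derive x 1 (fun x => v (t, x)) (vx (t, x)).
  exact: (is_derive_conv_ker x e0 (@measurable_ut_slice _ _ mut id t cid) (@bnd_ut_slice _ _ _ _ utb id t cid)).
have db (x : R) : is_derive x 1 (fun x => b (t, x)) (bx (t, x)).
  exact: (is_derive_conv_ker x e0 (@measurable_ut_slice _ _ mut a t ca) (@bnd_ut_slice _ _ _ _ utb a t ca)).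
have dphi (x : R) : is_derive x 1 (fun x => phi (t, x)) (px phi (t, x)) by exact: smooth2_is_derive_x.
have dqv (x : R) : is_derive x 1 (fun x => q (v (t, x)))
    (derive1 eta (v (t, x)) * derive1 a (v (t, x)) * vx (t, x)).
  exact: (@is_derive1_comp _ q (fun x => v (t, x))).
have dev (x : R) : is_derive x 1 (fun x => derive1 eta (v (t, x))) (derive1n 2 eta (v (t, x)) * vx (t, x)).
  exact: (@is_derive1_comp _ (derive1 eta) (fun x => v (t, x))).
have dav (x : R) : is_derive x 1 (fun x => a (v (t, x))) (derive1 a (v (t, x)) * vx (t, x)).
  exact: (@is_derive1_comp _ a (fun x => v (t, x))).
have cv : continuous (fun x => v (t, x)).
  by apply: derivable_continuous => x; have [] := dv x.
have cb : continuous (fun x => b (t, x)).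
  by apply: derivable_continuous => x; have [] := db x.
have cvx : continuous (fun x => vx (t, x)).
  exact: (conv_dker_cont e0 (@measurable_ut_slice _ _ mut id t cid) (@bnd_ut_slice _ _ _ _ utb id t cid)).
have cbx : continuous (fun x => bx (t, x)).
  exact: (conv_dker_cont e0 (@measurable_ut_slice _ _ mut a t ca) (@bnd_ut_slice _ _ _ _ utb a t ca)).
have cphit := @continuous_slice1 _ _ t cphi; have cpxt := @continuous_slice1 _ _ t cpx.
have ccomp (g : R -> R) : continuous g -> continuous (fun x => g (v (t, x))).
  by move=> cg x; apply: (@continuous_comp _ _ _ (fun x => v (t, x)) g); [exact: cv|exact: cg].
have nK x : r < `|x| -> ~ K (t, x) by move=> rx /Kr[_ /=]; rewrite leNgt rx.
apply: (@Rint_derive0 _ (fun x => phi (t, x) * (q (v (t, x)) + derive1 eta (v (t, x)) * (b (t, x) - a (v (t, x))))) _ r).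
- move=> x.
  have d1 : is_derive x 1 (fun x => b (t, x) - a (v (t, x))) (bx (t, x) - derive1 a (v (t, x)) * vx (t, x)).
    by apply: is_derive_eq; ring.
  have d2 : is_derive x 1 (fun x => derive1 eta (v (t, x)) * (b (t, x) - a (v (t, x))))
      (derive1 eta (v (t, x)) * (bx (t, x) - derive1 a (v (t, x)) * vx (t, x)) +
       derive1n 2 eta (v (t, x)) * vx (t, x) * (b (t, x) - a (v (t, x)))).
    by apply: is_derive_eq; rewrite /GRing.scale/=; ring.
  have d3 : is_derive x 1 (fun x => q (v (t, x)) + derive1 eta (v (t, x)) * (b (t, x) - a (v (t, x))))
      (derive1 eta (v (t, x)) * derive1 a (v (t, x)) * vx (t, x) +
       (derive1 eta (v (t, x)) * (bx (t, x) - derive1 a (v (t, x)) * vx (t, x)) +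
       derive1n 2 eta (v (t, x)) * vx (t, x) * (b (t, x) - a (v (t, x))))).
    by apply: is_derive_eq; ring.
  apply: (@is_derive_eq _ _ _ _ _ _ _ _ (@is_deriveM _ _ (fun x => phi (t, x)) _ x 1 _ _ (dphi x) d3)).
  by rewrite /GRing.scale /f2 /f3 /f4 /=; ring.
- move=> x; apply: cvgD; first apply: cvgD.
  + by apply: cvgM; [exact: cpxt|exact: ccomp].
  + apply: cvgM; first exact: cphit.
    by apply: cvgM; [exact: ccomp|exact: cbx].
  + apply: cvgM; last by apply: cvgB; [exact: cb|exact: ccomp].
    apply: cvgD; first by apply: cvgM; [exact: cpxt|exact: ccomp].
    apply: cvgM; first exact: cphit.
    by apply: cvgM; [exact: ccomp|exact: cvx].
- by move=> x /nK h; rewrite phi0// mul0r.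
- by move=> x /nK h; rewrite z234.
Qed.

Lemma entropy_identity : \int[lam]_p (pt phi p * eta (v p) + px phi p * q (v p)) =
  - (\int[lam]_p (px phi p * derive1 eta (v p) * (b p - a (v p))) +
     \int[lam]_p (phi p * (derive1n 2 eta (v p) * vx p) * (b p - a (v p)))).
Proof.
pose g1 p := px phi p * derive1 eta (v p) * (b p - a (v p)).
pose g2 p := phi p * (derive1n 2 eta (v p) * vx p) * (b p - a (v p)).
have mav : measurable_fun setT (fun p => b p - a (v p)) by apply: measurable_funB => //; exact: mcomp.
have bav : bnd (fun p => b p - a (v p)) by apply: bndB => //; exact: (bnd_comp ca).
have mg1 : measurable_fun setT g1.
  by apply: measurable_funM => //; apply: measurable_funM => //; exact: mcomp.
have mg2 : measurable_fun setT g2.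
  apply: measurable_funM => //; apply: measurable_funM => //.
  by apply: measurable_funM => //; exact: mcomp.
have bg1 : bnd g1 by apply: bndM => //; apply: bndM => //; exact: (bnd_comp ceta1).
have bg2 : bnd g2.
  by apply: bndM => //; apply: bndM => //; apply: bndM => //; exact: (bnd_comp ceta2).
have zg1 p : ~ K p -> g1 p = 0 by move=> nK; rewrite /g1 px0// !mul0r.
have zg2 p : ~ K p -> g2 p = 0 by move=> nK; rewrite /g2 phi0// !mul0r.
have -> : \int[lam]_p g1 p + \int[lam]_p g2 p = \int[lam]_p f4 p.
  rewrite -RintegralD//; [|exact: itg|exact: itg].
  by apply: eq_Rintegral => p _; rewrite /g1 /g2 /f4; ring.
rewrite RintegralD//; [|exact: (itg mf1)|exact: (itg mf2)].
rewrite time_part.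
have := space_part; rewrite RintegralD//; last 2 first.
- apply: (@itg (fun p => f2 p + f3 p)); [exact: measurable_funD|exact: bndD|].
  by move=> p nK; rewrite z2// z3// addr0.
- exact: itg.
rewrite RintegralD//; [|exact: itg|exact: itg] => h.
by apply/eqP; rewrite -subr_eq0 opprK -[X in _ == X]h; apply/eqP; ring.
Qed.

End fixed_scale.

(** Of the two error terms of [entropy_identity], the one with [px phi] tends to 0 because b - a(v)
    does so boundedly and almost everywhere. The other contains v_x, for which no uniform bound is
    at hand; it is therefore bounded by [c] through the hypothesis. *)
Lemma entropy_le (c e0 : R) : 0 < e0 ->
  (forall e, 0 < e -> e < e0 -> \int[lam]_p (phi p * (derive1n 2 eta (mol ut e id p) * dmol ut e id p) *
      (mol ut e a p - a (mol ut e id p))) <= c) ->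
  - (\int[lam]_p (pt phi p * eta (ut p) + px phi p * q (ut p))) <= c.
Proof.
move=> e00 hc.
pose e_ (n : nat) : R := e0 / 2 * harmonic n.
have e_0 n : 0 < e_ n by rewrite mulr_gt0 ?divr_gt0// harmonic_gt0.
have e_le n : e_ n < e0.
  apply: (@le_lt_trans _ _ (e0 / 2)); last lra.
  rewrite /e_ ler_piMr//; first by rewrite divr_ge0// ltW.
  by rewrite /harmonic/= invf_le1// ler1n.
have ecv : e_ n @[n --> \oo] --> 0 by exact: cvg_harmonicR.
pose v n := mol ut (e_ n) id; pose b n := mol ut (e_ n) a.
have vcv t : {ae mu, forall x, v n (t, x) @[n --> \oo] --> ut (t, x)}.
  by apply: (conv_ker_cvg e_0 ecv); [exact: (@measurable_ut_slice _ _ mut id)|exact: (@bnd_ut_slice _ _ _ _ utb id)].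
have bcv t : {ae mu, forall x, b n (t, x) @[n --> \oo] --> a (ut (t, x))}.
  by apply: (conv_ker_cvg e_0 ecv); [exact: (measurable_ut_slice mut)|exact: (bnd_ut_slice utb)].
have bvn : bnd (fun z : nat * (R * R) => v z.1 z.2).
  have [B hB] := bnd_ut utb; exists (`|m| + `|M|) => z.
  have /andP[h1 h2] := mol_itv mut utb z.2 (e_0 z.1).
  rewrite ler_norml; apply/andP; split.
  - by have := ler_norm (- m); rewrite normrN; have := normr_ge0 M; rewrite /v; lra.
  - by have := ler_norm M; have := normr_ge0 m; rewrite /v; lra.
have [Aq _ hAq] := bndP (bnd_comp cq bvn); have [Ae _ hAe] := bndP (bnd_comp ceta bvn).
have [Ae1 _ hAe1] := bndP (bnd_comp ceta1 bvn); have [Aa _ hAa] := bndP (bnd_comp ca bvn).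
have [Ba Ba0 hBa] := bndP (bnd_comp ca (bnd_ut utb)).
have hb n p : `|b n p| <= Ba.
  have mA := @measurable_ut_slice _ _ mut a p.1 ca; have bA := @bnd_ut_slice _ _ _ _ utb a p.1 ca.
  rewrite ler_norml; apply/andP; split.
  - by apply: conv_ker_ge => // y; have := hBa (p.1, y); rewrite ler_norml => /andP[].
  - by apply: conv_ker_le => // y; have := hBa (p.1, y); rewrite ler_norml => /andP[].
have [Pt _ hPt] := bndP bpt; have [Px _ hPx] := bndP bpx.
have mv n : measurable_fun setT (v n) by exact: measurable_mol.
have mb n : measurable_fun setT (b n) by exact: measurable_mol.
have l1 : \int[lam]_p (pt phi p * eta (v n p) + px phi p * q (v n p)) @[n --> \oo] -->
    \int[lam]_p (pt phi p * eta (ut p) + px phi p * q (ut p)).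
  apply: (@Rdct2 _ r (Pt * Ae + Px * Aq)).
  - by move=> n; apply: measurable_funD; apply: measurable_funM => //; exact: mcomp.
  - by apply: measurable_funD; apply: measurable_funM => //; exact: mcomp.
  - move=> n p; apply: (le_trans (ler_normD _ _)); rewrite !normrM lerD// ler_pM//.
    + exact: (hAe (n, p)).
    + exact: (hAq (n, p)).
  - by move=> n; apply: (cs_nz2 Kr) => p nK; rewrite pt0// px0// !mul0r addr0.
  - by apply: bndD; apply: bndM => //; [apply: (bnd_comp ceta)|apply: (bnd_comp cq)]; exact: (bnd_ut utb).
  - by apply: (cs_nz2 Kr) => p nK; rewrite pt0// px0// !mul0r addr0.
  - move=> t; apply: aeS (vcv t) => x hx.
    by apply: cvgD; apply: cvgMr; exact: cvg_seq_cont.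
have l2 : \int[lam]_p (px phi p * derive1 eta (v n p) * (b n p - a (v n p))) @[n --> \oo] --> 0.
  have -> : (0 : R) = \int[lam]_p (cst 0 p) by rewrite Rintegral_cst// mul0r.
  apply: (@Rdct2 _ r (Px * Ae1 * (Ba + Aa))).
  - move=> n; apply: measurable_funM; last by apply: measurable_funB => //; exact: mcomp.
    by apply: measurable_funM => //; exact: mcomp.
  - exact: measurable_cst.
  - move=> n p; rewrite !normrM ler_pM//; first by rewrite ler_pM//; exact: (hAe1 (n, p)).
    by rewrite (le_trans (ler_normB _ _))// lerD//; exact: (hAa (n, p)).
  - by move=> n; apply: (cs_nz2 Kr) => p nK; rewrite px0// !mul0r.
  - exact: bnd_cst.
  - by [].
  - move=> t; apply: aeS (aeI (vcv t) (bcv t)) => x [hv hb'].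
    rewrite (_ : cst 0 (t, x) = px phi (t, x) * derive1 eta (ut (t, x)) * (a (ut (t, x)) - a (ut (t, x)))); last first.
      by rewrite subrr mulr0.
    apply: cvgM; first by apply: cvgMr; exact: cvg_seq_cont.
    by apply: cvgB => //; exact: cvg_seq_cont.
have l3 : \int[lam]_p (pt phi p * eta (v n p) + px phi p * q (v n p)) +
    \int[lam]_p (px phi p * derive1 eta (v n p) * (b n p - a (v n p))) @[n --> \oo] -->
    \int[lam]_p (pt phi p * eta (ut p) + px phi p * q (ut p)).
  by rewrite -[X in _ --> X]addr0; exact: cvgD.
rewrite lerNl -(cvg_lim _ l3)//; apply: limr_ge; first exact: cvgP l3.
apply: nearW => n; have h := hc _ (e_0 n) (e_le n).
by rewrite /= /v /b entropy_identity// opprD addrAC addNr add0r lerN2.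
Qed.

End entropy_limit.

(** * Translations of the plane in the x direction *)

Section plane_shift.
Context {R : realType}.
Notation mu := (@lebesgue_measure R).
Notation lam := (@lam2 R).

Lemma measurable_shift2 (h : R) : measurable_fun setT (fun p : R * R => (p.1, p.2 + h)).
Proof. by apply: measurable_fun_pair => //; exact: measurable_funD. Qed.

Lemma ge0_integral_shift2 (h : R) (G : R * R -> \bar R) : measurable_fun setT G ->
  (forall p, 0 <= G p)%E -> (\int[lam]_p G (p.1, p.2 + h)%R = \int[lam]_p G p)%E.
Proof.
move=> mG G0.
have mG' : measurable_fun setT (fun p : R * R => G (p.1, p.2 + h)%R).
  exact: (measurableT_comp mG (measurable_shift2 h)).
apply: (etrans (@fubini_tonelli1 _ _ _ _ _ mu mu (fun p : R * R => G (p.1, p.2 + h)%R) mG' _)) => //.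
apply: esym; apply: (etrans (@fubini_tonelli1 _ _ _ _ _ mu mu G mG G0)).
apply: eq_integral => t _; rewrite /fubini_F/=; apply: esym.
apply: (@ge0_integral_shift _ h (fun x => G (t, x))) => //.
exact: (measurableT_comp mG (@pair1_measurable _ _ R R t)).
Qed.

(** A window that moves with [x] becomes a fixed indicator in the offset, which allows the integrals
    to be interchanged later. *)
Lemma ge0_integral_itv_shift (x e : R) (G : R -> \bar R) : measurable_fun setT G ->
  (forall z, 0 <= G z)%E ->
  (\int[mu]_(z in `[(x - e)%R, (x + e)%R]) G z =
   \int[mu]_z ((\1_(`[(- e), e]%classic) z)%:E * G (z + x)%R))%E.
Proof.
move=> mG G0; rewrite integral_mkcond.
rewrite -(@ge0_integral_shift _ x (G \_ `[(x - e), (x + e)]%classic)).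
- apply: eq_integral => z _; rewrite patchE indicE.
  have -> : (z + x \in `[(x - e), (x + e)]%classic) = (z \in `[(- e), e]%classic).
    by apply/idP/idP; rewrite !inE/= !in_itv/= => /andP[? ?]; apply/andP; split; lra.
  by case: (_ \in _); rewrite ?mul1e ?mul0e.
- by apply/(measurable_restrictT _ _).1 => //; exact: measurable_funTS.
- by move=> z; apply: erestrict_ge0.
Qed.

Lemma compact_measurable_plane (K : set (R * R)) : compact K -> measurable K.
Proof.
move=> cK; rewrite -(setCK K); apply: measurableC; apply: open_measurable_plane.
by apply: closed_openC; apply: compact_closed.
Qed.

End plane_shift.

(** * Tonelli between the plane and the line *)

Section plane_sigma_finite.
Context {R : realType}.
Notation mu := (@lebesgue_measure R).
Notation lam := (@lam2 R).

(* [lam2] has no canonical sigma-finite structure; this copy carries the one Tonelli needs. *)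
Definition plane_measure : set (measurableTypeR R * measurableTypeR R)%type -> \bar R := lam.

HB.instance Definition _ := Measure.on plane_measure.

Lemma sigma_finite_lam2 : sigma_finite setT plane_measure.
Proof.
pose I n : set R := `[(- n%:R), n%:R]%classic.
exists (fun n => I n `*` I n).
  apply/seteqP; split => [[t x] _|//].
  have [n hn] : exists n : nat, `|t| + `|x| <= n%:R.
    by exists (Num.truncn (`|t| + `|x|)).+1; rewrite ltW// truncnS_gt.
  exists n => //; split; rewrite /I/= in_itv/= -ler_norml; apply: le_trans hn.
    by rewrite lerDl.
  by rewrite lerDr.
move=> n; split; first by apply: measurableX; exact: measurable_itv.
suff : (mu (I n) * mu (I n) < +oo)%E.
  apply: le_lt_trans; rewrite le_eqVlt; apply/orP; left; apply/eqP.
  by apply: product_measure1E; exact: measurable_itv.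
apply: lte_mul_pinfty => //; last exact: lebesgue_seg_lty.
by rewrite ge0_fin_numE// lebesgue_seg_lty.
Qed.

HB.instance Definition _ := Measure_isSigmaFinite.Build _ _ _ plane_measure sigma_finite_lam2.

Lemma ge0_integral_lam2_swap (f : (R * R) * R -> \bar R) :
  measurable_fun setT f -> (forall w, 0 <= f w)%E ->
  (\int[lam]_p \int[mu]_z f (p, z) = \int[mu]_z \int[lam]_p f (p, z))%E.
Proof. by move=> mf f0; apply: (@fubini_tonelli _ _ _ _ _ plane_measure mu f). Qed.

Lemma measurable_integral_lam2 d (X : measurableType d) (f : X * (R * R) -> \bar R) :
  measurable_fun setT f -> (forall w, 0 <= f w)%E ->
  measurable_fun setT (fun x => \int[lam]_p f (x, p))%E.
Proof. by move=> mf f0; apply: (@measurable_fun_fubini_tonelli_F _ _ _ _ _ plane_measure f). Qed.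

End plane_sigma_finite.

(** * Essential bounds and a bounded representative of u *)

Section representative.
Context {R : realType}.
Notation mu := (@lebesgue_measure R).
Notation lam := (@lam2 R).

(** Directly from the integral as a supremum over simple functions below, so neither function nor
    set has to be measurable. The cost over [U] is of this kind, since [u] is only known to be
    measurable on the open strip. *)
Lemma ge0_le_integralW d (X : measurableType d) (nu : {measure set X -> \bar R})
    (f g : X -> \bar R) (A B : set X) : A `<=` B ->
  (forall x, A x -> 0 <= f x)%E -> (forall x, B x -> 0 <= g x)%E ->
  (forall x, A x -> f x <= g x)%E ->
  (\int[nu]_(x in A) f x <= \int[nu]_(x in B) g x)%E.
Proof.
move=> AB f0 g0 fg; rewrite !ge0_integralE//; apply: ereal_sup_le => _ [h /= hf <-].
exists h => //= x; apply: le_trans (hf x) _; rewrite !patchE; case: ifPn => [|_].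
  by rewrite inE => Ax; rewrite mem_set; [exact: fg|exact: AB].
by case: ifPn => //; rewrite inE => /g0.
Qed.

Lemma open_strip (T : R) : open (strip T).
Proof.
have -> : strip T = fst @^-1` `]0, T[%classic.
  by apply/seteqP; split => p; rewrite /strip/= in_itv.
apply: open_comp; last exact: interval_open.
by move=> p _; exact: cvg_fst.
Qed.

Lemma measurable_strip (T : R) : measurable (strip T).
Proof. by apply: open_measurable_plane; exact: open_strip. Qed.

Lemma lam_strip_gt0 (T : R) : 0 < T -> (0 < lam (strip T))%E.
Proof.
move=> T0.
have h : (lam (`]0%R, T[%classic `*` `]0%R, 1%R[%classic) <= lam (strip T))%E.
  apply: le_measure; rewrite ?inE.
  - by apply: measurableX; exact: measurable_itv.
  - exact: measurable_strip.
  - by move=> [t x] [/=]; rewrite /strip/= in_itv.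
apply: lt_le_trans h.
have -> : (lam (`]0%R, T[%classic `*` `]0%R, 1%R[%classic) =
    mu `]0%R, T[%classic * mu `]0%R, 1%R[%classic)%E.
  by apply: product_measure1E; exact: measurable_itv.
by rewrite !lebesgue_measure_itv/= !lte_fin T0 ltr01 !sube0 mule1 lte_fin.
Qed.

Lemma lam_negligible_shift (N : set (R * R)) (h : R) : measurable N -> lam N = 0%E ->
  lam [set p | N (p.1, p.2 + h)] = 0%E.
Proof.
move=> mN N0.
have mN' : measurable [set p : R * R | N (p.1, p.2 + h)].
  have := measurable_shift2 h measurableT mN; rewrite setTI; exact.
have := @ge0_integral_shift2 _ h (fun p => (\1_N p)%:E).
rewrite (_ : (\int[lam]_p (\1_N p)%:E)%E = lam N); last by rewrite integral_indic// setIT.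
rewrite (_ : (\int[lam]_p (\1_N (p.1, p.2 + h)%R)%:E)%E = lam [set p | N (p.1, p.2 + h)]); last first.
  transitivity (\int[lam]_p (\1_[set p : R * R | N (p.1, p.2 + h)%R] p)%:E)%E.
    by apply: eq_integral => p _; rewrite !indicE; congr (_%:R%:E); apply/idP/idP; rewrite !inE.
  by rewrite integral_indic// setIT.
move=> ->//.
by apply/measurable_EFinP; exact: measurable_indic.
Qed.

Variables (T : R) (u : R * R -> R).
Hypotheses (T0 : 0 < T) (Lu : Linf T u).

Lemma ess_bounds : exists m M : R, [/\ einf T u = m%:E, esup T u = M%:E, m <= M &
  exists N : set (R * R), [/\ measurable N, lam N = 0%E &
    forall p, strip T p -> ~ N p -> m <= u p <= M]].
Proof.
have [mu_ hB] := Lu.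
set f := (fun p => if `[< strip T p >] then _ else _) in hB.
have [N1 [mN1 N10 h1]] := @ess_sup_ge _ _ R (mu \x mu)%E f.
have [N2 [mN2 N20 h2]] := @ess_sup_ge _ _ R (mu \x mu)%E
  (fun p => if `[< strip T p >] then (u p)%:E else -oo%E).
have [N3 [mN3 N30 h3]] := @ess_inf_le _ _ R (mu \x mu)%E
  (fun p => if `[< strip T p >] then (u p)%:E else +oo%E).
pose N := N1 `|` N2 `|` N3.
have mN : measurable N by apply: measurableU => //; exact: measurableU.
have N0 : lam N = 0%E.
  by rewrite /N; apply: null_set_setU => //; [exact: measurableU|exact: null_set_setU].
have hN p : strip T p -> ~ N p -> [/\ ((`|u p|)%:E <= ess_sup lam f)%E,
    ((u p)%:E <= esup T u)%E & (einf T u <= (u p)%:E)%E].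
  move=> sp nN; split.
  - apply: contrapT => h; apply: nN; left; left; apply: h1 => /= h'; apply: h.
    by move: h'; rewrite /f asboolT.
  - apply: contrapT => h; apply: nN; left; right; apply: h2 => /= h'; apply: h.
    by move: h'; rewrite asboolT.
  - apply: contrapT => h; apply: nN; right; apply: h3 => /= h'; apply: h.
    by move: h'; rewrite asboolT.
(* The strip has positive measure, so some good point exists; the value of [u] there separates
   [einf] from [esup] and makes both finite. *)
have [p0 [sp0 nN0]] : exists p0, strip T p0 /\ ~ N p0.
  apply: contrapT => hn; have : (lam (strip T) <= lam N)%E.
    apply: le_measure; rewrite ?inE//; first exact: measurable_strip.
    by move=> p sp; apply: contrapT => nN; apply: hn; exists p.
  by rewrite N0 leNgt lam_strip_gt0.
have [a1 a2 a3] := hN _ sp0 nN0.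
have Bs0 : (0 <= ess_sup lam f)%E by apply: le_trans a1; rewrite lee_fin.
have Bfin : ess_sup lam f \is a fin_num by rewrite ge0_fin_numE.
have aeN (P : R * R -> Prop) : (forall p, ~ N p -> P p) -> {ae (mu \x mu)%E, forall p, P p}.
  by move=> hP; exists N; split => // p nP; apply: contrapT => nN; apply: nP; exact: hP.
have es : (esup T u <= ess_sup lam f)%E.
  apply/(@ess_supP _ _ _ (mu \x mu)%E); apply: aeN => p nN.
  have [sp|sp] := pselect (strip T p); last by rewrite asboolF// leNye.
  rewrite asboolT//; have [h _ _] := hN _ sp nN; apply: le_trans h.
  by rewrite lee_fin ler_norm.
have ei : (- ess_sup lam f <= einf T u)%E.
  apply/(@ess_infP _ _ _ (mu \x mu)%E); apply: aeN => p nN.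
  have [sp|sp] := pselect (strip T p); last by rewrite asboolF// leey.
  rewrite asboolT//; have [h _ _] := hN _ sp nN; rewrite leeNl; apply: le_trans h.
  by rewrite -EFinN lee_fin -normrN ler_norm.
have fs : esup T u \is a fin_num.
  rewrite fin_numElt (lt_le_trans _ a2) ?ltNyr//=; apply: le_lt_trans es _.
  by move: Bfin; rewrite fin_numElt => /andP[].
have fi : einf T u \is a fin_num.
  rewrite fin_numElt (le_lt_trans a3) ?ltry// andbT; apply: lt_le_trans ei.
  by rewrite lteNr/=; move: Bfin; rewrite fin_numElt => /andP[].
exists (fine (einf T u)), (fine (esup T u)); rewrite !fineK//; split => //.
  by rewrite -lee_fin !fineK//; exact: le_trans a3 a2.
exists N; split => // p sp nN; have [_ h2' h3'] := hN _ sp nN.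
by rewrite -!lee_fin !fineK// h2' h3'.
Qed.

Variables (m M : R) (N : set (R * R)).
Hypotheses (mM : m <= M) (mN : measurable N) (N0 : lam N = 0%E).
Hypothesis uN : forall p, strip T p -> ~ N p -> m <= u p <= M.

Let A : set (R * R) := strip T `&` u @^-1` `[m, M]%classic.

Let mA : measurable A.
Proof. by have [mu_ _] := Lu; apply: mu_; [exact: measurable_strip|exact: measurable_itv]. Qed.

(** A restriction is 0 off its set; subtracting [m] before and adding it afterwards turns this
    default into [m], so all values lie in [[m, M]]. *)
Definition rep (p : R * R) : R := m + ((fun p => u p - m) \_ A) p.

Lemma measurable_rep : measurable_fun setT rep.
Proof.
have [mu_ _] := Lu.
apply: measurable_funD => //; apply/(measurable_restrictT _ _).1 => //.
apply: measurable_funB => //; apply: measurable_funS mu_; first exact: measurable_strip.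
exact: subIsetl.
Qed.

Lemma rep_itv p : m <= rep p <= M.
Proof.
rewrite /rep patchE; case: ifPn => [|_]; last by rewrite addr0 lexx.
by rewrite inE => -[_ /=]; rewrite in_itv/= addrCA subrr addr0.
Qed.

Lemma repE p : strip T p -> ~ N p -> rep p = u p.
Proof.
move=> sp nN; rewrite /rep patchE mem_set; first by rewrite addrCA subrr addr0.
by split => //=; rewrite in_itv/=; exact: uN.
Qed.

(** One statement for two uses: [id] and [a] transfer the weak equation, [eta] and [q] the entropy
    production. Passing from the strip to the whole plane is possible because the test function is
    supported in the strip. *)
Lemma Rintegral_rep (g1 g2 : R -> R) (psi : R * R -> R) : continuous g1 -> continuous g2 ->
  test_on (strip T) psi ->
  \int[lam]_(p in strip T) (g1 (u p) * pt psi p + g2 (u p) * px psi p) =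
  \int[lam]_p (pt psi p * g1 (rep p) + px psi p * g2 (rep p)).
Proof.
move=> c1 c2 [spsi [K [cK [Ks psi0]]]]; have [mu_ _] := Lu.
have ms := measurable_strip T; have mr := measurable_rep.
have [_ cpt cpx] := smooth2_cont spsi.
have mpt := continuous_measurable_plane cpt; have mpx := continuous_measurable_plane cpx.
have mg1 := continuous_measurable_fun c1; have mg2 := continuous_measurable_fun c2.
have z p : ~ strip T p -> pt psi p * g1 (rep p) + px psi p * g2 (rep p) = 0.
  move=> nsp; have [-> ->] := pt_px_out cK psi0 (fun Kp => nsp (Ks p Kp)).
  by rewrite !mul0r addr0.
have -> : \int[lam]_p (pt psi p * g1 (rep p) + px psi p * g2 (rep p)) =
    \int[lam]_(p in strip T) (pt psi p * g1 (rep p) + px psi p * g2 (rep p)).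
  rewrite [RHS]Rintegral_mkcond; congr Rintegral; apply/funext => p.
  by rewrite patchE; case: ifPn => //; rewrite notin_setE => /z.
rewrite /Rintegral; congr fine; apply: (@ae_eq_integral _ _ _ (mu \x mu)%E) => //.
- apply/measurable_EFinP; apply: measurable_funD.
  + by apply: measurable_funM; [exact: measurableT_comp|exact: measurable_funTS].
  + by apply: measurable_funM; [exact: measurableT_comp|exact: measurable_funTS].
- apply/measurable_EFinP; apply: measurable_funTS; apply: measurable_funD.
  + by apply: measurable_funM => //; exact: measurableT_comp.
  + by apply: measurable_funM => //; exact: measurableT_comp.
- exists N; split => // p /= hp; apply: contrapT => nN; apply: hp => sp.
  by rewrite repE// mulrC [X in _ + X]mulrC.
Qed.

(** The integrand involves two points, so the exceptional set and its translate are both removed. A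
    shift in x does not leave the strip, so [rep] agrees with [u] at both points. *)
Lemma cost_rep (a : R -> R) (U W : set (R * R)) (h : R) : C2 a -> strictly_convex a ->
  measurable W -> W `<=` U -> W `<=` strip T ->
  (\int[lam]_(p in W) (Delta a (rep p) (rep (p.1, p.2 + h)%R))%:E <=
   \int[lam]_(p in U) (Delta a (u p) (u (p.1, p.2 + h)%R))%:E)%E.
Proof.
move=> C2a cvx mW WU Ws; have mr := measurable_rep.
pose N' := N `|` [set p | N (p.1, p.2 + h)].
have mN2 : measurable [set p : R * R | N (p.1, p.2 + h)].
  have := measurable_shift2 h measurableT mN; rewrite setTI; exact.
have mN' : measurable N' by exact: measurableU.
have N'0 : lam N' = 0%E by apply: null_set_setU => //; exact: lam_negligible_shift.
have mD : measurable_fun setT (fun p => (Delta a (rep p) (rep (p.1, p.2 + h)))%:E).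
  by apply/measurable_EFinP; apply: measurable_Delta => //; exact: (measurableT_comp mr (measurable_shift2 _)).
apply: (@le_trans _ _ (\int[lam]_(p in W `\` N') (Delta a (rep p) (rep (p.1, p.2 + h)%R))%:E)%E).
  rewrite (@ge0_negligible_integral _ _ _ (mu \x mu)%E W N')//.
  - exact: measurable_funTS.
  - by move=> p _; rewrite lee_fin Delta_ge0.
apply: ge0_le_integralW.
- by move=> p [/WU].
- by move=> p _; rewrite lee_fin Delta_ge0.
- by move=> p _; rewrite lee_fin Delta_ge0.
- move=> p [Wp nN].
  have nN1 : ~ N p by move=> Np; apply: nN; left.
  have nN2 : ~ N (p.1, p.2 + h) by move=> Np; apply: nN; right.
  have sp := Ws _ Wp.
  have sp' : strip T (p.1, p.2 + h) by [].
  by rewrite (repE sp nN1) (repE sp' nN2).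
Qed.

End representative.

Section indic_seg.
Context {R : realType}.
Notation mu := (@lebesgue_measure R).

Lemma integral_indic_seg (e c : R) : 0 <= e -> 0 <= c ->
  (\int[mu]_y (\1_(`[(- e), e]%classic) y * c)%:E = (2 * e * c)%:E)%E.
Proof.
move=> e0 c0; set B := `[_, _]%classic.
have mB1 : measurable_fun setT (fun y : R => (\1_B y : R)%:E).
  by apply/measurable_EFinP; apply: measurable_indic; exact: measurable_itv.
under eq_integral do rewrite mulrC EFinM.
rewrite ge0_integralZl// ?lee_fin// integral_indic//; last exact: measurable_itv.
have ee : - e <= e by apply: (@le_trans _ _ 0); rewrite ?oppr_le0.
rewrite setIT; transitivity (c%:E * mu `[(- e)%R, e]%classic)%E => //.
by rewrite (lebesgue_seg ee) opprK -EFinM mulrC mulr_natl mulr2n.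
Qed.

Lemma integral2_indic_seg (e c : R) : 0 <= e -> 0 <= c ->
  (\int[mu]_z \int[mu]_y (\1_(`[(- e), e]%classic) z * \1_(`[(- e), e]%classic) y * c)%:E =
   (2 * e * (2 * e * c))%:E)%E.
Proof.
move=> e0 c0; set B := `[_, _]%classic.
transitivity (\int[mu]_z (\1_B z * (2 * e * c))%:E)%E; last first.
  by apply: integral_indic_seg; rewrite ?mulr_ge0.
apply: eq_integral => z _.
transitivity (\int[mu]_y (\1_B y * (\1_B z * c))%:E)%E.
  by apply: eq_integral => y _; rewrite [\1_B z * _]mulrC mulrA.
by rewrite integral_indic_seg//; [rewrite mulrCA|rewrite mulr_ge0].
Qed.

End indic_seg.

(** * From the commutator to the regularity cost *)

Section cost_bound.
Context {R : realType}.
Notation mu := (@lebesgue_measure R).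
Notation lam := (@lam2 R).

Lemma Delta_refl (a : R -> R) s : C2 a -> strictly_convex a -> Delta a s s = 0.
Proof.
by move=> C2a cv; rewrite Delta_closed// subrr mul0r set_itv1 Rintegral_set1 mulr0 subrr.
Qed.

Variables (a eta : R -> R) (ut phi : R * R -> R) (K W : set (R * R)) (m M r C Lam L e : R).
Hypotheses (C2a : C2 a) (cvxa : strictly_convex a) (ceta2 : continuous (derive1n 2 eta)).
Hypotheses (mut : measurable_fun setT ut) (utb : forall p, m <= ut p <= M).
Hypotheses (mphi : measurable_fun setT phi) (cK : compact K) (phi0 : forall p, ~ K p -> phi p = 0).
Hypothesis phi1 : forall p, `|phi p| <= 1.
Hypothesis Kr : forall p, K p -> `|p.1| <= r /\ `|p.2| <= r.
Hypotheses (C0 : 0 < C) (hC : forall d x, 0 < d -> `|ker d x| <= C / d /\ `|dker d x| <= C / d ^+ 2).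
Hypotheses (Lam0 : 0 <= Lam) (hLam : forall s, m <= s <= M -> `|derive1n 2 eta s| <= Lam).
Hypotheses (L0 : 0 <= L) (e0 : 0 < e) (mW : measurable W).
Hypothesis KW : forall p y, K p -> `|y| <= e -> W (p.1, p.2 + y).
Hypothesis hL : forall h, h != 0 -> `|h| <= 2 * e ->
  (\int[lam]_(p in W) (Delta a (ut p) (ut (p.1, p.2 + h)%R))%:E <= (`|h| * L)%:E)%E.

Let mK : measurable K. Proof. exact: compact_measurable_plane. Qed.
Let B : set R := `[(- e), e]%classic.
Let mB : measurable B. Proof. exact: measurable_itv. Qed.
Let ca : continuous a. Proof. exact: C2_cont. Qed.
Let cid : continuous (id : R -> R). Proof. by move=> ?; exact: cvg_id. Qed.

(** The double integral of the commutator estimate in offsets [y], [z] from the centre [p.2], cut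
    off to [K]; all domains of integration are now fixed. *)
Let D (p : R * R) (z y : R) : R :=
  \1_K p * \1_B z * \1_B y * Delta a (ut (p.1, p.2 + y)) (ut (p.1, p.2 + z)).

Let D_ge0 p z y : 0 <= D p z y.
Proof. by rewrite /D mulr_ge0 ?Delta_ge0// !mulr_ge0. Qed.

Let mD : measurable_fun setT (fun w : (R * R) * R * R => D w.1.1 w.1.2 w.2).
Proof.
have m1 : measurable_fun setT (fun w : (R * R) * R * R => w.1.1).
  exact: (measurableT_comp (@measurable_fst _ _ (R * R)%type R) (@measurable_fst _ _ ((R * R) * R)%type R)).
have m2 : measurable_fun setT (fun w : (R * R) * R * R => w.1.2).
  exact: (measurableT_comp (@measurable_snd _ _ (R * R)%type R) (@measurable_fst _ _ ((R * R) * R)%type R)).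
have m3 : measurable_fun setT (fun w : (R * R) * R * R => w.2) by exact: measurable_snd.
have m11 : measurable_fun setT (fun w : (R * R) * R * R => w.1.1.1).
  exact: (measurableT_comp (@measurable_fst _ _ R R) m1).
have m12 : measurable_fun setT (fun w : (R * R) * R * R => w.1.1.2).
  exact: (measurableT_comp (@measurable_snd _ _ R R) m1).
apply: measurable_funM; last first.
  apply: measurable_Delta => //.
  - by apply: (measurableT_comp mut); apply: measurable_fun_pair => //; exact: measurable_funD.
  - by apply: (measurableT_comp mut); apply: measurable_fun_pair => //; exact: measurable_funD.
apply: measurable_funM; first apply: measurable_funM.
- by apply: (measurableT_comp _ m1); exact: measurable_indic.
- by apply: (measurableT_comp _ m2); exact: measurable_indic.
- by apply: (measurableT_comp _ m3); exact: measurable_indic.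
Qed.

(** For fixed offsets, translating x by [y] leaves an increment h = z - y of size at most [2 * e],
    and the translate of [K] stays in [W]. Hence the bound [|h| * L <= 2 * e * L]. *)
Lemma integral_D_le z y :
  (\int[lam]_p (D p z y)%:E <= (\1_B z * \1_B y * (2 * e * L))%:E)%E.
Proof.
have [zB|zB] := boolP (z \in B); last first.
  rewrite (_ : (fun p => _) = cst 0%E); first by rewrite integral0 lee_fin !mulr_ge0// ltW.
  by apply/funext => p; rewrite /D (indicE R B z) (negbTE zB) mulr0 !mul0r.
have [yB|yB] := boolP (y \in B); last first.
  rewrite (_ : (fun p => _) = cst 0%E); first by rewrite integral0 lee_fin !mulr_ge0// ltW.
  by apply/funext => p; rewrite /D (indicE R B y) (negbTE yB) mulr0 !mul0r.
rewrite !indicE zB yB !mul1r.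
move: zB yB; rewrite !inE /B/= !in_itv/= -!ler_norml => zB yB.
pose G (p : R * R) := (\1_K (p.1, p.2 - y)%R * Delta a (ut p) (ut (p.1, p.2 + (z - y))%R))%:E.
have mG : measurable_fun setT G.
  apply/measurable_EFinP; apply: measurable_funM.
    by apply: (measurableT_comp _ (measurable_shift2 (- y))); exact: measurable_indic.
  by apply: measurable_Delta => //; exact: (measurableT_comp mut (measurable_shift2 _)).
have G0 p : (0 <= G p)%E by rewrite lee_fin mulr_ge0// Delta_ge0.
have -> : (\int[lam]_p (D p z y)%:E = \int[lam]_p G p)%E.
  have DG p : D p z y = \1_K (p.1, p.2 + y - y) *
      Delta a (ut (p.1, p.2 + y)) (ut (p.1, p.2 + y + (z - y))).
    have -> : p.2 + y + (z - y) = p.2 + z by ring.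
    rewrite addrK -surjective_pairing /D (indicE R B z) (indicE R B y).
    have -> : z \in B by apply/mem_set; rewrite /B/= in_itv/= -ler_norml.
    have -> : y \in B by apply/mem_set; rewrite /B/= in_itv/= -ler_norml.
    by rewrite !mulr1.
  rewrite -(ge0_integral_shift2 y mG G0); apply: eq_integral => p _.
  by rewrite DG.
(* [hL] excludes the zero increment, where the cost vanishes identically. *)
have [zy|zy] := eqVneq (z - y) 0.
  rewrite (_ : G = cst 0%E); first by rewrite integral0 lee_fin !mulr_ge0// ltW.
  by apply/funext => -[t x]; rewrite /G zy/= addr0 Delta_refl// mulr0.
have hzy : `|z - y| <= 2 * e by rewrite (le_trans (ler_normB _ _))//; lra.
apply: (@le_trans _ _ (`|z - y| * L)%:E); last by rewrite lee_fin ler_wpM2r.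
apply: le_trans (hL zy hzy); rewrite [leRHS]integral_mkcond.
apply: ge0_le_integral => //.
- apply/(measurable_restrictT _ _).1 => //; apply: measurable_funTS; apply/measurable_EFinP.
  by apply: measurable_Delta => //; exact: (measurableT_comp mut (measurable_shift2 _)).
- move=> [t x] _; rewrite /G patchE /= indicE.
  case: (boolP ((t, x - y) \in K)) => [|_].
    rewrite inE => /KW /(_ yB) /=; rewrite subrK => Wp.
    by rewrite mem_set// mul1r.
  by rewrite mul0r; case: ifPn => // _; rewrite lee_fin Delta_ge0.
Qed.

(** The factor [2 * C ^ 2 / e ^ 3] meets the area [(2 * e) ^ 2] of the square of offsets and the
    bound [2 * e * L] for each offset: the powers of [e] cancel and 16 remains. *)
Lemma commutator_cost :
  (\int[lam]_p (\1_K p * (`|dmol ut e id p| * `|mol ut e a p - a (mol ut e id p)|))%:E <=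
   (16 * C ^+ 2 * L)%:E)%E.
Proof.
have mD3 : measurable_fun setT (fun w : (R * R) * R * R => (D w.1.1 w.1.2 w.2)%:E).
  exact/measurable_EFinP.
have D30 (w : (R * R) * R * R) : (0 <= (D w.1.1 w.1.2 w.2)%:E)%E by rewrite lee_fin ?D_ge0.
have mH2 : measurable_fun setT (fun w : (R * R) * R => (\int[mu]_y (D w.1 w.2 y)%:E)%E).
  exact: (@measurable_fun_fubini_tonelli_F _ _ _ _ _ mu (fun w : (R * R) * R * R => (D w.1.1 w.1.2 w.2)%:E)).
have H20 (w : (R * R) * R) : (0 <= \int[mu]_y (D w.1 w.2 y)%:E)%E.
  by apply: integral_ge0 => y _; rewrite lee_fin.
have mH1 : measurable_fun setT (fun p : R * R => (\int[mu]_z \int[mu]_y (D p z y)%:E)%E).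
  exact: (@measurable_fun_fubini_tonelli_F _ _ _ _ _ mu (fun w : (R * R) * R => (\int[mu]_y (D w.1 w.2 y)%:E)%E)).
have H10 p : (0 <= \int[mu]_z \int[mu]_y (D p z y)%:E)%E.
  by apply: integral_ge0 => z _; exact: (H20 (p, z)).
have c0 : 0 <= 2 * C ^+ 2 / e ^+ 3 by rewrite divr_ge0 ?mulr_ge0 ?exprn_ge0// ltW.
have mg : measurable_fun setT (fun p => \1_K p * (`|dmol ut e id p| * `|mol ut e a p - a (mol ut e id p)|)).
  apply: measurable_funM; first exact: measurable_indic.
  apply: measurable_funM; apply: measurableT_comp => //; first exact: measurable_dmol.
  apply: measurable_funB; first exact: measurable_mol.
  by apply: (measurableT_comp (continuous_measurable_fun ca)); exact: measurable_mol.
have step1 : (\int[lam]_p (\1_K p * (`|dmol ut e id p| * `|mol ut e a p - a (mol ut e id p)|))%:E <=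
    \int[lam]_p ((2 * C ^+ 2 / e ^+ 3)%:E * \int[mu]_z \int[mu]_y (D p z y)%:E))%E.
  apply: ge0_le_integral => //.
  - exact/measurable_EFinP.
  - exact: measurable_funeM.
  - move=> p _; rewrite indicE; have [pK|pK] := boolP (p \in K); last first.
      by rewrite mul0r mule_ge0// lee_fin.
    rewrite mul1r.
    have ms := @measurable_ut_slice _ _ mut id p.1 cid; have bs := @bnd_ut_slice _ _ _ _ utb id p.1 cid.
    apply: (le_trans (commutator_bound C2a cvxa p.2 C0 hC e0 ms bs)).
    rewrite le_eqVlt; apply/orP; left; apply/eqP; congr (_ * _)%E.
    have mDz z : measurable_fun setT (fun y => (Delta a (ut (p.1, y)) (ut (p.1, z)))%:E).
      by apply/measurable_EFinP; apply: measurable_Delta.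
    have inner z : (\int[mu]_(y in `[(p.2 - e)%R, (p.2 + e)%R]) (Delta a (ut (p.1, y)) (ut (p.1, z)))%:E =
        \int[mu]_y ((\1_B y)%:E * (Delta a (ut (p.1, y + p.2)%R) (ut (p.1, z)))%:E))%E.
      by apply: ge0_integral_itv_shift => // y; rewrite lee_fin Delta_ge0.
    transitivity (\int[mu]_(z in `[(p.2 - e)%R, (p.2 + e)%R])
      \int[mu]_y ((\1_B y)%:E * (Delta a (ut (p.1, y + p.2)%R) (ut (p.1, z)))%:E))%E.
      by apply: eq_integral => z _; exact: inner.
    rewrite (@ge0_integral_itv_shift _ p.2 e (fun z =>
      \int[mu]_y ((\1_B y)%:E * (Delta a (ut (p.1, y + p.2)%R) (ut (p.1, z)))%:E))%E); last 2 first.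
    + apply: (@measurable_fun_fubini_tonelli_F _ _ _ _ _ mu (fun w : R * R =>
        ((\1_B w.2)%:E * (Delta a (ut (p.1, w.2 + p.2)%R) (ut (p.1, w.1)))%:E)%E)).
      * apply: emeasurable_funM; apply/measurable_EFinP.
          by apply: (measurableT_comp _ (@measurable_snd _ _ R R)); exact: measurable_indic.
        apply: measurable_Delta => //; apply: (measurableT_comp mut); apply: measurable_fun_pair => //.
        exact: measurable_funD.
      * by move=> w; rewrite mule_ge0// lee_fin// Delta_ge0.
    + by move=> z; apply: integral_ge0 => y _; rewrite mule_ge0// lee_fin// Delta_ge0.
    apply: eq_integral => z _; rewrite -ge0_integralZl//.
    + apply: eq_integral => y _; rewrite -!EFinM.
      by rewrite /D (indicE R K p) pK mul1r mulrA (addrC y) (addrC z).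
    + apply: emeasurable_funM; apply/measurable_EFinP; first exact: measurable_indic.
      apply: measurable_Delta => //; apply: (measurableT_comp mut); apply: measurable_fun_pair => //.
      exact: measurable_funD.
    + by move=> y _; rewrite mule_ge0// lee_fin// Delta_ge0.
apply: (le_trans step1); rewrite ge0_integralZl//.
(* The plane integral is moved innermost, since the cost hypothesis speaks of fixed offsets. *)
have -> : (\int[lam]_p \int[mu]_z \int[mu]_y (D p z y)%:E =
    \int[mu]_z \int[mu]_y \int[lam]_p (D p z y)%:E)%E.
  rewrite (ge0_integral_lam2_swap mH2 H20); apply: eq_integral => z _.
  apply: (@ge0_integral_lam2_swap _ (fun w : (R * R) * R => (D w.1 z w.2)%:E)).
  - apply: (measurableT_comp mD3 (_ : measurable_fun setT (fun w : (R * R) * R => ((w.1, z), w.2)))).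
    by apply: measurable_fun_pair => //; exact: measurable_fun_pair.
  - by move=> w; rewrite lee_fin.
apply: (@le_trans _ _ ((2 * C ^+ 2 / e ^+ 3)%:E * \int[mu]_z \int[mu]_y (\1_B z * \1_B y * (2 * e * L))%:E)%E).
  rewrite lee_wpmul2l ?lee_fin//.
  have mzy : measurable_fun setT (fun w : R * R => (\int[lam]_p (D p w.1 w.2)%:E)%E).
    apply: (@measurable_integral_lam2 _ _ _ (fun w : (R * R) * (R * R) => (D w.2 w.1.1 w.1.2)%:E)).
    - apply: (measurableT_comp mD3 (_ : measurable_fun setT (fun w : (R * R) * (R * R) => ((w.2, w.1.1), w.1.2)))).
      apply: measurable_fun_pair; first apply: measurable_fun_pair => //.
        exact: (measurableT_comp (@measurable_fst _ _ R R) (@measurable_fst _ _ (R * R)%type (R * R)%type)).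
      exact: (measurableT_comp (@measurable_snd _ _ R R) (@measurable_fst _ _ (R * R)%type (R * R)%type)).
    - by move=> w; rewrite lee_fin.
  have zy0 z y : (0 <= \int[lam]_p (D p z y)%:E)%E by apply: integral_ge0 => p _; rewrite lee_fin.
  have mind : measurable_fun setT (fun w : R * R => (\1_B w.1 * \1_B w.2 * (2 * e * L))%:E).
    apply/measurable_EFinP; apply: measurable_funM => //; apply: measurable_funM.
    - by apply: (measurableT_comp _ (@measurable_fst _ _ R R)); exact: measurable_indic.
    - by apply: (measurableT_comp _ (@measurable_snd _ _ R R)); exact: measurable_indic.
  have ind0 z y : (0 <= (\1_B z * \1_B y * (2 * e * L))%:E)%E by rewrite lee_fin !mulr_ge0// ltW.
  apply: ge0_le_integral => //.
  - by move=> z _; apply: integral_ge0.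
  - by apply: (@measurable_fun_fubini_tonelli_F _ _ _ _ _ mu (fun w : R * R => (\int[lam]_p (D p w.1 w.2)%:E)%E)) => // w.
  - by apply: (@measurable_fun_fubini_tonelli_F _ _ _ _ _ mu (fun w : R * R => (\1_B w.1 * \1_B w.2 * (2 * e * L))%:E)) => // w.
  - move=> z _; apply: ge0_le_integral => //.
    + exact: (measurableT_comp mzy (@pair1_measurable _ _ R R z)).
    + exact: (measurableT_comp mind (@pair1_measurable _ _ R R z)).
    + by move=> y _; exact: integral_D_le.
have -> : (\int[mu]_z \int[mu]_y (\1_B z * \1_B y * (2 * e * L))%:E = (2 * e * (2 * e * (2 * e * L)))%:E)%E.
  by apply: integral2_indic_seg; rewrite ?mulr_ge0// ltW.
by rewrite -EFinM lee_fin le_eqVlt; apply/orP; left; apply/eqP; field; rewrite gt_eqF.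
Qed.

(** Pointwise, [|phi|] is at most the indicator of [K] and [|eta''(v)|] at most [Lam], so the
    estimate reduces to [commutator_cost]. *)
Lemma dissipation_bound :
  \int[lam]_p (phi p * (derive1n 2 eta (mol ut e id p) * dmol ut e id p) *
      (mol ut e a p - a (mol ut e id p))) <= 16 * C ^+ 2 * Lam * L.
Proof.
pose g p := `|dmol ut e id p| * `|mol ut e a p - a (mol ut e id p)|.
have mg : measurable_fun setT g.
  apply: measurable_funM; apply: measurableT_comp => //; first exact: measurable_dmol.
  apply: measurable_funB; first exact: measurable_mol.
  by apply: (measurableT_comp (continuous_measurable_fun ca)); exact: measurable_mol.
have bg : bnd g.
  apply: bndM; apply: bnd_norm; first exact: (bnd_dmol mut utb e0 cid).
  by apply: bndB; [exact: (bnd_mol mut utb e0 ca)|apply: (bnd_comp ca); exact: (bnd_mol mut utb e0 cid)].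
have mKg : measurable_fun setT (fun p => \1_K p * g p).
  by apply: measurable_funM => //; exact: measurable_indic.
have bKg : bnd (fun p => \1_K p * g p).
  by apply: bndM => //; exists 1 => p; rewrite indicE; case: (_ \in _); rewrite ?normr1 ?normr0.
have zKg p : ~ K p -> \1_K p * g p = 0 by move=> nK; rewrite indicE memNset// mul0r.
have iKg := integrable_nz2 mKg bKg (cs_nz2 Kr zKg).
have hKg : \int[lam]_p (\1_K p * g p) <= 16 * C ^+ 2 * L.
  rewrite -lee_fin /Rintegral fineK; first exact: commutator_cost.
  exact: integrable_fin_num.
apply: (@le_trans _ _ (Lam * \int[lam]_p (\1_K p * g p))); last first.
  apply: (le_trans (ler_wpM2l Lam0 hKg)).
  by rewrite le_eqVlt; apply/orP; left; apply/eqP; ring.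
rewrite -RintegralZl//; apply: le_Rintegral => //.
- apply: (@integrable_nz2 _ r).
  + apply: measurable_funM.
      apply: measurable_funM => //; apply: measurable_funM; last exact: measurable_dmol.
      by apply: (measurableT_comp (continuous_measurable_fun ceta2)); exact: measurable_mol.
    apply: measurable_funB; first exact: measurable_mol.
    by apply: (measurableT_comp (continuous_measurable_fun ca)); exact: measurable_mol.
  + apply: bndM.
      apply: bndM; first by exists 1.
      by apply: bndM; [apply: (bnd_comp ceta2); exact: (bnd_mol mut utb e0 cid)|exact: (bnd_dmol mut utb e0 cid)].
    by apply: bndB; [exact: (bnd_mol mut utb e0 ca)|apply: (bnd_comp ca); exact: (bnd_mol mut utb e0 cid)].
  + by apply: (cs_nz2 Kr) => p nK; rewrite phi0// !mul0r.
- apply: (@integrable_nz2 _ r (fun p => Lam * (\1_K p * g p))).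
  + exact: measurable_funM.
  + by apply: bndM => //; exact: bnd_cst.
  + by apply: (cs_nz2 Kr) => p nK; rewrite zKg// mulr0.
- move=> p _; have [pK|pK] := pselect (K p); last by rewrite phi0// zKg// !mul0r mulr0.
  rewrite indicE mem_set// mul1r; apply: (le_trans (ler_norm _)); rewrite /g !normrM.
  rewrite -!mulrA -[leRHS]mul1r ler_pM// ?mulr_ge0// mulrA mulrA ler_wpM2r// ler_wpM2r//.
  by apply: hLam; exact: (mol_itv mut utb).
Qed.

End cost_bound.

(** * Assembling the estimate *)

Section conclusion.
Context {R : realType}.
Notation mu := (@lebesgue_measure R).
Notation lam := (@lam2 R).

(** The extreme value theorem on [[m, M]]: the supremum is attained, hence real. *)
Lemma sup_I_eta2P (T : R) (u : R * R -> R) (eta : R -> R) (m M : R) :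
  einf T u = m%:E -> esup T u = M%:E -> m <= M -> continuous (derive1n 2 eta) ->
  exists Lam : R, [/\ sup_I_eta2 T u eta = Lam%:E, 0 <= Lam &
    forall s, m <= s <= M -> `|derive1n 2 eta s| <= Lam].
Proof.
move=> em eM mM ce.
have cn : {within `[m, M], continuous (fun s => `|derive1n 2 eta s|)}.
  apply: continuous_subspaceT => s; apply: continuous_comp; first exact: ce.
  exact: norm_continuous.
have [c cI hc] := EVT_max mM cn.
exists `|derive1n 2 eta c|; split; [|by []|by move=> s sI; apply: hc; rewrite in_itv].
rewrite /sup_I_eta2 em eM; apply/le_anti/andP; split.
  by apply: ge_ereal_sup => _ [s /= sI <-]; rewrite lee_fin hc// in_itv/= -!lee_fin.
by apply: ereal_sup_ubound; exists c => //=; rewrite !lee_fin; move: cI; rewrite in_itv.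
Qed.

(** A supremum over no increments would be -oo; [e / 2] is always admissible. *)
Lemma reg_cost_ge0 (a : R -> R) (u : R * R -> R) (U : set (R * R)) :
  (0 <= reg_cost a u U)%E.
Proof.
apply: le_ereal_inf_tmp => _ [e /= e0 <-].
apply: (@le_trans _ _ (((`|e / 2|)^-1)%:E *
   (\int[lam]_(p in U) (Delta a (u p) (u (p.1, p.2 + e / 2)%R))%:E))%E).
  apply: mule_ge0; first by rewrite lee_fin invr_ge0.
  by apply: integral_ge0 => p _; rewrite lee_fin Delta_ge0.
apply: ereal_sup_ubound; exists (e / 2) => //=.
rewrite ger0_norm ?divr_ge0 ?ltW// divr_gt0//= ltr_pdivrMr//.
by rewrite mulr_natr mulr2n ltrDl.
Qed.

Lemma reg_cost_lt (a : R -> R) (u : R * R -> R) (U : set (R * R)) (L : R) :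
  (reg_cost a u U < L%:E)%E -> exists2 e, 0 < e & forall h, h != 0 -> `|h| < e ->
    (\int[lam]_(p in U) (Delta a (u p) (u (p.1, p.2 + h)%R))%:E <= (`|h| * L)%:E)%E.
Proof.
move=> /ereal_inf_lt[_ [e /= e0 <-] he]; exists e => // h h0 hlt.
have hp : 0 < `|h| by rewrite normr_gt0.
have : (((`|h|)^-1)%:E * (\int[lam]_(p in U) (Delta a (u p) (u (p.1, p.2 + h)%R))%:E) <= L%:E)%E.
  apply: le_trans (ltW he); apply: ereal_sup_ubound; exists h => //=.
  by rewrite hp.
by rewrite lee_pdivrMl// EFinM.
Qed.

Section fixed_solution.
Variables (C T : R) (a eta q : R -> R) (u phi : R * R -> R) (K W U : set (R * R)) (m M : R) (N : set (R * R)).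
Hypotheses (C0 : 0 < C) (hC : forall d x, 0 < d -> `|ker d x| <= C / d /\ `|dker d x| <= C / d ^+ 2).
Hypotheses (C2a : C2 a) (cvxa : strictly_convex a).
Hypotheses (Lu : Linf T u) (weak_u : weak_solution T a u).
Hypotheses (C2eta : C2 eta) (fluxq : is_flux a eta q).
Hypotheses (mM : m <= M) (mN : measurable N) (N0 : lam N = 0%E).
Hypothesis uN : forall p, strip T p -> ~ N p -> m <= u p <= M.
Hypotheses (oW : open W) (WU : W `<=` U) (Ws : W `<=` strip T).
Hypotheses (sphi : smooth2 phi) (cK : compact K) (KW : K `<=` W).
Hypotheses (phi0 : forall p, ~ K p -> phi p = 0) (phi1 : forall p, `|phi p| <= 1).

(** The alternative [Lam = 0] covers an infinite cost: eta'' then vanishes on [[m, M]], where v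
    takes its values, so the dissipation term is zero whatever the cost is. *)
Lemma entropy_prod_le (Lam L : R) : 0 <= Lam -> 0 <= L ->
  (forall s, m <= s <= M -> `|derive1n 2 eta s| <= Lam) ->
  Lam = 0 \/ (reg_cost a u U < L%:E)%E ->
  entropy_prod T u eta q phi <= 16 * C ^+ 2 * Lam * L.
Proof.
move=> Lam0 L0 hLam hL.
have ca := C2_cont C2a; have ceta := C2_cont C2eta; have cq := derivable_continuous fluxq.1.
have cid : continuous (id : R -> R) by move=> ?; exact: cvg_id.
pose ut := rep T u m M.
have mut : measurable_fun setT ut by exact: (measurable_rep Lu).
have utb p : m <= ut p <= M by exact: rep_itv.
have mW := open_measurable_plane oW.
have tphi : test_on (strip T) phi.
  by split => //; exists K; split => //; split => // p /KW/Ws.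
rewrite /entropy_prod (Rintegral_rep Lu mN N0 uN ceta cq tphi).
have [r r0 Kr] := compact_plane_bounded cK.
(* [e1] separates the support from the times 0 and [T]; [e2] keeps its translates in [W]. *)
have [e1 e10 he1] := compact_thicken cK (@open_strip R T) (subset_trans KW Ws).
have [e2 e20 he2] := compact_thicken cK oW KW.
have Kal p : K p -> e1 / 2 <= p.1 <= T - e1 / 2.
  move=> Kp.
  have h1 : `|e1 / 2| < e1 by rewrite ger0_norm; lra.
  have := he1 p (e1 / 2) 0 Kp h1; rewrite normr0 => /(_ e10)/andP[/= _ h2].
  have := he1 p (- (e1 / 2)) 0 Kp; rewrite normrN normr0 => /(_ h1 e10)/andP[/= h3 _].
  by apply/andP; split; lra.
have al0 : 0 < e1 / 2 by lra.
have beT : T - e1 / 2 < T by lra.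
have weak_ut psi : test_on (strip T) psi ->
    \int[lam]_p (ut p * pt psi p + a (ut p) * px psi p) = 0.
  move=> tpsi; rewrite -[RHS](weak_u tpsi) (Rintegral_rep Lu mN N0 uN cid ca tpsi).
  by apply: eq_Rintegral => p _; rewrite [ut p * _]mulrC [a _ * _]mulrC.
have [e3 e30 he3] : exists2 e3, 0 < e3 & Lam = 0 \/ forall h, h != 0 -> `|h| < e3 ->
    (\int[lam]_(p in U) (Delta a (u p) (u (p.1, p.2 + h)%R))%:E <= (`|h| * L)%:E)%E.
  case: hL => [->|/reg_cost_lt[e3 e30 he3]]; first by exists 1 => //; left.
  by exists e3 => //; right.
(* Below [e3 / 2] the increments, of size at most [2 * e], stay under the threshold [e3] of the cost
   bound. *)
apply: (@entropy_le _ T a eta q ut phi K m M r (e1 / 2) (T - e1 / 2) C2a C2eta fluxq mut utb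
  weak_ut sphi cK phi0 Kr al0 beT Kal _ (Num.min (e3 / 2) e2)).
  by rewrite lt_min e20 divr_gt0.
move=> e e0; rewrite lt_min => /andP[ee3 ee2].
case: he3 => [Lam_0|he3].
  rewrite Lam_0 mulr0 mul0r (_ : Rintegral _ _ _ = 0)//.
  rewrite /Rintegral integral0_eq// => p _; congr EFin.
  have /hLam := @mol_itv _ ut m M mut utb e p e0.
  by rewrite Lam_0 normr_le0 => /eqP ->; rewrite mul0r mulr0 mul0r.
have mphi : measurable_fun setT phi.
  by apply: continuous_measurable_plane; have [] := smooth2_cont sphi.
apply: (@dissipation_bound _ a eta ut phi K W m M r C Lam L e) => //; first by case: C2eta => _ [].
  move=> p y Kp ye; rewrite -[p.1]addr0; apply: he2 => //; first by rewrite normr0.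
  exact: le_lt_trans ee2.
move=> h h0 he; apply: le_trans (he3 h h0 _); last by apply: (le_lt_trans he); lra.
exact: (cost_rep Lu mN N0 uN).
Qed.

End fixed_solution.

End conclusion.

Theorem theorem1 (R : realType) :
  exists C0 : R, 0 < C0 /\
  forall (T : R) (a : R -> R) (u : R * R -> R),
    0 < T -> C2 a -> strictly_convex a ->
    Linf T u -> weak_solution T a u -> finite_entropy_production T a u ->
    forall (eta q : R -> R) (U : set (R * R)),
      C2 eta -> is_flux a eta q -> rel_open T U ->
      (entropy_TV T u eta q U <= C0%:E * sup_I_eta2 T u eta * reg_cost a u U)%E.
Proof.
have [C C0 hC] := @ker_bound R.
exists (16 * C ^+ 2); split; first by rewrite mulr_gt0// exprn_gt0.
move=> T a u T0 C2a cvxa Lu weak_u _ eta q U C2eta fluxq [V [oV UE]].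
have [m [M [em eM mM [N [mN N0 uN]]]]] := ess_bounds T0 Lu.
have [Lam [-> Lam0 hLam]] := sup_I_eta2P em eM mM C2eta.2.2.
apply: ge_ereal_sup => _ [phi [[sphi [K [cK [KW phi0]]]] phi1] <-].
(* [U] is only relatively open in the closed strip; cutting it with the open strip removes the
   boundary times and gives an open set of the plane. *)
have oW : open (U `&` strip T).
  have -> : U `&` strip T = V `&` strip T.
    rewrite UE -setIA; congr (_ `&` _); apply/setIidPr => p /andP[p0 pT].
    by rewrite /cstrip/= !ltW.
  by apply: openI => //; exact: open_strip.
have WU : U `&` strip T `<=` U by exact: subIsetl.
have Ws : U `&` strip T `<=` strip T by exact: subIsetr.
have key := entropy_prod_le C0 hC C2a cvxa Lu weak_u C2eta fluxq mM mN N0 uN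
  oW WU Ws sphi cK KW phi0 phi1 Lam0 _ hLam.
rewrite -EFinM; have c0 : 0 <= 16 * C ^+ 2 * Lam by rewrite mulr_ge0// mulr_ge0// exprn_ge0// ltW.
(* Here the right side is 0 even if the cost is infinite. For positive [Lam] an infinite cost makes
   the right side infinite. *)
have [Lam_0|Lam_gt0] := eqVneq Lam 0.
  rewrite Lam_0 mulr0 mul0e lee_fin.
  by apply: (le_trans (key 0 (lexx _) (or_introl Lam_0))); rewrite mulr0.
have := @reg_cost_ge0 R a u U; case E : reg_cost => [L| |]//= L0; last first.
  by rewrite gt0_muley ?leey// lte_fin !mulr_gt0// ?exprn_gt0// lt_def Lam_gt0.
rewrite lee_fin in L0.
(* A bound strictly above the cost is needed to extract a threshold for [h]; the excess
   [d / (c + 1)] is multiplied by [c] and so contributes at most [d]. *)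
rewrite -EFinM lee_fin; apply/ler_addgt0Pr => d d0.
pose c := 16 * C ^+ 2 * Lam.
have c10 : 0 < c + 1 by rewrite ltr_wpDl.
have d'0 : 0 < d / (c + 1) by rewrite divr_gt0.
have := key (L + d / (c + 1)) (addr_ge0 L0 (ltW d'0)).
rewrite E lte_fin ltrDl d'0 => /(_ (or_intror erefl)) h.
apply: (le_trans h); rewrite mulrDr lerD2l -/c mulrCA ger_pMr// ler_pdivrMr// mul1r.
by rewrite lerDl.
Qed.
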